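(* Let $1\le q\le p<\infty$ and $\alpha\in(-\infty,1/q)$. Then $$JNQ^{\alpha}_{p,q}(\mathbb{R}^n)=\left[JNQ^{\alpha,\mathrm{dyadic}}_{p,q}(\mathbb{R}^n)\cap JN^{\mathrm{con}}_{p,q}(\mathbb{R}^n)\right].$$
   Context: Here $n\in\mathbb{N}$, $n\ge1$. A measurable function $f$ on $\mathbb{R}^n$ is a Lebesgue measurable function with $|f|<\infty$ almost everywhere. A cube has finite positive edge length and all its edges parallel to the coordinate axes, and need not be open or closed. For $\ell\in(0,\infty)$, $\Pi_\ell$ is the class of all collections $\{Q_j\}_j$ of cubes of $\mathbb{R}^n$ with pairwise disjoint interiors and equal edge length $\ell$. For a bounded measurable set $E$ with $|E|>0$, $f_E:=\frac1{|E|}\int_E f\,dy$. For $p,q\in[1,\infty)$ and $\alpha\in\mathbb{R}$, the space $JNQ^{\alpha}_{p,q}(\mathbb{R}^n)$ is the set of all measurable $f$ on $\mathbb{R}^n$ with $$\|f\|_{JNQ^\alpha_{p,q}(\mathbb{R}^n)}:=\sup_{\ell\in(0,\infty),\,\{Q_j\}_j\in\Pi_\ell}\Big\{\sum_j|Q_j|\Big[|Q_j|^{\frac{q\alpha}{n}-1}\int_{Q_j}\int_{Q_j}\frac{|f(x)-f(y)|^q}{|x-y|^{n+q\alpha}}\,dy\,dx\Big]^{p/q}\Big\}^{1/p}<\infty.$$ The space $JN^{\mathrm{con}}_{p,q}(\mathbb{R}^n)$ is the set of all $f\in L^1_{\mathrm{loc}}(\mathbb{R}^n)$ with $$\|f\|_{JN^{\mathrm{con}}_{p,q}(\mathbb{R}^n)}:=\sup_{\ell\in(0,\infty),\,\{Q_j\}_j\in\Pi_\ell}\Big\{\sum_j|Q_j|\Big[\frac1{|Q_j|}\int_{Q_j}|f(x)-f_{Q_j}|^q\,dx\Big]^{p/q}\Big\}^{1/p}<\infty.$$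 For $k\in\mathbb{Z}$, $\mathscr{D}_k(\mathbb{R}^n)$ is the set of all dyadic cubes $2^{-k}(\mathbf{j}+[0,1)^n)$, $\mathbf{j}\in\mathbb{Z}^n$, and $\mathscr{D}(\mathbb{R}^n):=\bigcup_{k\in\mathbb{Z}}\mathscr{D}_k(\mathbb{R}^n)$. With $\ell(I)$ the edge length of $I$, the dyadic distance is $\delta(x,y):=\inf\{\ell(I): x,y\in I\in\mathscr{D}(\mathbb{R}^n)\}$ (infinite for points in different octants). The dyadic space $JNQ^{\alpha,\mathrm{dyadic}}_{p,q}(\mathbb{R}^n)$ is the set of all measurable $f$ on $\mathbb{R}^n$ with $$\|f\|_{JNQ^{\alpha,\mathrm{dyadic}}_{p,q}(\mathbb{R}^n)}:=\sup_{k\in\mathbb{Z}}\Big\{\sum_{Q\in\mathscr{D}_k(\mathbb{R}^n)}|Q|\Big[|Q|^{\frac{q\alpha}{n}-1}\int_Q\int_Q\frac{|f(x)-f(y)|^q}{[\delta(x,y)]^{n+q\alpha}}\,dx\,dy\Big]^{p/q}\Big\}^{1/p}<\infty.$$ *)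

(* Defs.v *)
From HB Require Import structures.
From mathcomp Require Import all_boot all_order all_algebra.
From mathcomp Require Import all_classical all_reals all_analysis.
From mathcomp Require Import measurable_realfun.

Set Implicit Arguments.
Unset Strict Implicit.
Unset Printing Implicit Defensive.
Import Order.TTheory GRing.Theory Num.Theory.
Import numFieldNormedType.Exports.

Local Open Scope classical_set_scope.
Local Open Scope ring_scope.
Local Open Scope ereal_scope.

(* n-fold product, on Borel sets, of the Lebesgue measure of R. *)
Fixpoint lebesgue_tuple (R : realType) (n : nat) :
    set (n.-tuple (measurableTypeR R)) -> \bar R :=
  match n with
  | 0 => \d_ [tuple]
  | m.+1 => pushforward (@lebesgue_measure R \x @lebesgue_tuple R m)
              (fun z => [the m.+1.-tuple (measurableTypeR R) of z.1 :: z.2])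
  end.

Lemma lebesgue_tuple0 (R : realType) n : @lebesgue_tuple R n set0 = 0.
Proof.
elim: n => [|n IHn]; first by rewrite /= measure0.
rewrite /= /pushforward preimage_set0 /product_measure1.
by apply: integral0_eq => x _ /=; rewrite xsection0.
Qed.

Lemma lebesgue_tuple_ge0 (R : realType) n A : 0 <= @lebesgue_tuple R n A.
Proof.
elim: n A => [|n IHn] A; first exact: measure_ge0.
rewrite /= /pushforward /product_measure1.
by apply: integral_ge0 => x _ /=; exact: IHn.
Qed.

(* Outer measure generated by the product measure, carried over to row vectors.
   Its Caratheodory sigma-algebra is the completion of the Borel sigma-algebra,
   i.e. the sigma-algebra of Lebesgue measurable sets. *)
Definition lebesgue_outer (R : realType) (n : nat) (A : set 'rV[R]_n) : \bar R :=
  mu_ext (@lebesgue_tuple R n) ((fun t => \row_i tnth t i) @^-1` A).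
Arguments lebesgue_outer : clear implicits.

Section lebesgue_outer_measure.
Context (R : realType) (n : nat).

Let outer0 : lebesgue_outer R n set0 = 0.
Proof. exact: mu_ext0 (@lebesgue_tuple0 R n) (@lebesgue_tuple_ge0 R n). Qed.

Let outer_ge0 A : 0 <= lebesgue_outer R n A.
Proof. exact: mu_ext_ge0 (@lebesgue_tuple_ge0 R n) _. Qed.

Let outer_le : {homo lebesgue_outer R n : A B / A `<=` B >-> A <= B}.
Proof. by move=> A B AB; apply: le_mu_ext => t; exact: AB. Qed.

Let outer_subadditive : sigma_subadditive (lebesgue_outer R n).
Proof.
move=> F; rewrite /lebesgue_outer preimage_bigcup.
exact: mu_ext_sigma_subadditive (@lebesgue_tuple_ge0 R n) _.
Qed.

HB.instance Definition _ := isOuterMeasure.Build R 'rV[R]_n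
  (lebesgue_outer R n) outer0 outer_ge0 outer_le outer_subadditive.

End lebesgue_outer_measure.

Definition lebesgueRn (R : realType) (n : nat) : measurableType _ :=
  caratheodory_type (lebesgue_outer R n).

Definition leb (R : realType) (n : nat) : set (lebesgueRn R n) -> \bar R :=
  lebesgue_outer R n.

HB.instance Definition _ (R : realType) (n : nat) :=
  isMeasure.Build _ (lebesgueRn R n) R (@leb R n)
    (@caratheodory_measure0 _ _ (lebesgue_outer R n))
    (@caratheodory_measure_ge0 _ _ (lebesgue_outer R n))
    (@caratheodory_measure_sigma_additive _ _ (lebesgue_outer R n)).

Section JNQ.
Context (R : realType) (n : nat).
Local Notation Rn := 'rV[R]_n.
Local Notation mu := (@leb R n).
Implicit Types (Q : set Rn) (C : set (set Rn)) (x y : Rn) (p q alpha l : R).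
Implicit Types f : Rn -> \bar R.

Definition eucl x : R := Num.sqrt (\sum_i (x 0 i) ^+ 2)%R.

Definition vol Q : R := fine (mu Q).

Definition mean f Q : \bar R := (vol Q)^-1%:E * \int[mu]_(y in Q) f y.

(* Each edge is an interval of length l, open or closed at either end. *)
Definition cube l Q : Prop :=
  exists (a : Rn) (bl br : 'I_n -> bool),
    Q = [set x | forall i, x 0%R i \in
           Interval (BSide (bl i) (a 0%R i)) (BSide (br i) (a 0%R i + l)%R)].

Definition Pi l : set (set (set Rn)) :=
  [set C | (forall Q, C Q -> cube l Q) /\ trivIset C (@interior Rn)].

Definition dyadic (k : int) : set (set Rn) :=
  [set Q | exists j : 'rV[int]_n,
     Q = [set (2 ^ (- k)) *: (map_mx intr j + u)%R
         | u in [set u : Rn | forall i, u 0%R i \in `[0%R, 1%R[ ]]].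

(* The edge length of a cube of [dyadic k] is 2 ^ (- k). *)
Definition delta x y : \bar R :=
  ereal_inf [set ((2 : R) ^ (- k))%:E
            | k in [set k | exists2 I, dyadic k I & I x /\ I y]].

Definition ae_finite_measurable : set (Rn -> \bar R) :=
  [set f | measurable_fun setT (f : lebesgueRn R n -> \bar R) /\
           {ae mu, forall x, f x \is a fin_num}].

Definition L1loc : set (Rn -> \bar R) :=
  [set f | ae_finite_measurable f /\
           forall K : set Rn, compact K -> mu.-integrable K f].

Definition JNQ_norm p q alpha f : \bar R :=
  ereal_sup [set (\esum_(Q in C) ((vol Q)%:E *
      ((vol Q `^ (q * alpha / n%:R - 1))%:E *
       \int[mu]_(x in Q) \int[mu]_(y in Q)
         (`|f x - f y| `^ q *
          ((eucl (x - y)%R `^ (n%:R + q * alpha))^-1)%:E)) `^ (p / q)))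
        `^ p^-1
    | C in [set C | exists2 l, (0 < l)%R & Pi l C]].

Definition JNQ p q alpha : set (Rn -> \bar R) :=
  [set f | ae_finite_measurable f /\ JNQ_norm p q alpha f < +oo].

Definition JNcon_norm p q f : \bar R :=
  ereal_sup [set (\esum_(Q in C) ((vol Q)%:E *
      ((vol Q)^-1%:E * \int[mu]_(x in Q) `|f x - mean f Q| `^ q) `^ (p / q)))
        `^ p^-1
    | C in [set C | exists2 l, (0 < l)%R & Pi l C]].

Definition JNcon p q : set (Rn -> \bar R) :=
  [set f | L1loc f /\ JNcon_norm p q f < +oo].

(* [delta x y] is finite for x and y in a common dyadic cube. *)
Definition JNQ_dyadic_norm p q alpha f : \bar R :=
  ereal_sup [set (\esum_(Q in dyadic k) ((vol Q)%:E *
      ((vol Q `^ (q * alpha / n%:R - 1))%:E *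
       \int[mu]_(x in Q) \int[mu]_(y in Q)
         (`|f x - f y| `^ q *
          ((fine (delta x y) `^ (n%:R + q * alpha))^-1)%:E)) `^ (p / q)))
        `^ p^-1
    | k in [set: int]].

Definition JNQ_dyadic p q alpha : set (Rn -> \bar R) :=
  [set f | ae_finite_measurable f /\ JNQ_dyadic_norm p q alpha f < +oo].

End JNQ.

Arguments JNQ {R} n p q alpha.
Arguments JNcon {R} n p q.
Arguments JNQ_dyadic {R} n p q alpha.

(* Main.v *)
Require Import Defs.
From HB Require Import structures.
From mathcomp Require Import all_boot all_order all_algebra.
From mathcomp Require Import all_classical all_reals all_analysis.
From mathcomp Require Import measurable_realfun ring lra zify.

(** Write [s = n + q * alpha] and [osc q u x y = `|u x - u y| `^ q], where [u] is a
    real-valued representative of [f]. Each of the three norms is, up to a power, the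
    supremum of sums of terms attached to single cubes ([eucl_term], [delta_term] and
    [mean_term]), so that the theorem follows from comparisons of these terms with
    constants that depend on the exponents and the dimension only.

    The first inclusion is a comparison cube by cube. Dyadic cubes of one level form an
    admissible family. If [s >= 0], then [eucl (x - y)] is at most a multiple of
    [delta x y] on a dyadic cube, and it is at most a multiple of the edge on any cube;
    if [s < 0], the double integral of [osc] is first bounded by the part over pairs far
    from the diagonal, by means of a third point ([osc_le_far]). This gives
    [delta_le_eucl_term] and, with Jensen's inequality, [mean_le_eucl_term]. Finiteness
    of a single term forces [u] to be integrable on the cube ([integrable_of_osc]), so
    [f] is locally integrable.

    For the converse, a cube of edge [l], with [2 ^ (- m) <= l <= 2 * 2 ^ (- m)], lies in a
    block of 3 ^ n dyadic cells of level [m], and the heart of the proof is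
    [block_energy_le]: the Euclidean energy of a block is bounded by its scaled
    oscillation plus the dyadic energies of its cells. For [s <= 0] the kernel is bounded
    on the block and the oscillation suffices. For [s > 0] the kernel is at most
    [r_0 ^ (- s)] plus the sum of [r_(k+1) ^ (- s)] over the scales [k] at which the two
    points are close ([eucl_kernel_le]), with [r_k = 2 ^ (- (m + k))]. At scale [k] the
    function is compared with its averages over the cells of edge [r_k], and those
    averages are built up by refining the block one level at a time. When cells of level
    [t] are introduced, two points at distance less than [r_k] acquire different averages
    only if they lie near a face of a cell, which concerns the fraction [2 ^ (- (k - t))]
    of the cell. Hence the energy of the averages grows by a factor [rho], arbitrarily
    close to 1, plus that fraction of the deviations of [u] from its averages of the
    levels [t] and [t + 1] ([gap_energyS_le]). Unrolled, this is a discounted sum with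
    ratio [rho / 2]; the weights [r_k ^ (n - s)] of the scales grow with ratio
    [2 ^ (s - n)], and the sum over the scales converges because
    [s - n = q * alpha < 1] ([sum_weighted_recursion]). What remains are deviations from
    averages over single cells, which by Jensen's inequality are integrals over pairs in
    a common cell, and the sum of [r_k ^ (- s)] over the scales at which two points share
    a cell is a geometric sum comparable to the power [- s] of [delta x y].

    It remains to sum over an admissible family ([eucl_sum_bound]). Different cubes have
    their corners in different cells, hence different blocks; the blocks whose indices
    agree modulo 3 are pairwise disjoint, so all blocks form at most 3 ^ n families
    admissible for the second norm, and each dyadic cell of level [m] is used at most
    3 ^ n times. *)

Set Implicit Arguments.
Unset Strict Implicit.
Unset Printing Implicit Defensive.
Import Order.TTheory GRing.Theory Num.Theory.
Import numFieldNormedType.Exports.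

Local Open Scope classical_set_scope.
Local Open Scope ring_scope.

(** * Lebesgue measure of boxes *)

Section PushforwardSigmaFinite.
Local Open Scope ereal_scope.
Context d1 d2 (T1 : measurableType d1) (T2 : measurableType d2).
Context d' (T' : measurableType d') (R : realType).
Variable m1 : {sigma_finite_measure set T1 -> \bar R}.
Variable m2 : {sigma_finite_measure set T2 -> \bar R}.
Variables (phi : T1 * T2 -> T') (psi : T' -> T1 * T2).
Hypotheses (mphi : measurable_fun setT phi).
Hypotheses (mpsi : measurable_fun setT psi) (phiK : cancel phi psi).

Let nu : set T' -> \bar R := pushforward (m1 \x m2) phi.

Let nu0 : nu set0 = 0. Proof. by rewrite /nu /pushforward preimage_set0 measure0. Qed.

Let nu_ge0 A : 0 <= nu A. Proof. exact: measure_ge0. Qed.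

Let nu_sigma_additive : semi_sigma_additive nu.
Proof.
move=> F mF tF mUF; rewrite /nu /pushforward preimage_bigcup.
apply: measure_semi_sigma_additive.
- by move=> n; rewrite -[X in measurable X]setTI; exact: mphi.
- apply/trivIsetP => /= i j _ _ ij; rewrite -preimage_setI.
  by move/trivIsetP : tF => /(_ _ _ _ _ ij) ->//; rewrite preimage_set0.
- by rewrite -preimage_bigcup -[X in measurable X]setTI; exact: mphi.
Qed.

HB.instance Definition _ := isMeasure.Build _ _ _ nu
  nu0 nu_ge0 nu_sigma_additive.

Let nu_sigma_finite : sigma_finite setT nu.
Proof.
have /sigma_finiteP[F [TF ndF Foo]] := sigma_finiteT m1.
have /sigma_finiteP[G [TG ndG Goo]] := sigma_finiteT m2.
exists (fun k => psi @^-1` (F k `*` G k)).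
  apply/esym/seteqP; split => // x _.
  have : [set: T1] (psi x).1 by [].
  have : [set: T2] (psi x).2 by [].
  rewrite TF TG => -[k _ Gk] [j _ Fj]; exists (maxn k j) => //; split.
    by move: Fj; exact/subsetPset/ndF/leq_maxr.
  by move: Gk; exact/subsetPset/ndG/leq_maxl.
move=> k; have [? ?] := Foo k; have [? ?] := Goo k; split.
  by rewrite -[X in measurable X]setTI; apply: mpsi => //; apply: measurableX.
rewrite /nu /= /pushforward -comp_preimage.
rewrite (_ : psi \o phi = id); last by apply/funext => z /=; exact: phiK.
by rewrite preimage_id product_measure1E// lte_mul_pinfty// ge0_fin_numE.
Qed.

HB.instance Definition _ :=
  Measure_isSigmaFinite.Build _ _ _ nu nu_sigma_finite.

(** Sigma-finiteness of each stage is what lets the recursive definition of the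
    product measure be iterated and Tonelli's theorem be used. *)
Lemma pushforward_sigma_finite :
  exists m' : {sigma_finite_measure set T' -> \bar R}, pushforward (m1 \x m2) phi = m'.
Proof. by exists nu. Qed.

End PushforwardSigmaFinite.

Section LebesgueMeasure.
Local Open Scope ereal_scope.
Context (R : realType).
Local Notation mT := (measurableTypeR R).

Lemma lebesgue_tuple_measure n :
  exists m : {sigma_finite_measure set (n.-tuple mT) -> \bar R},
    @lebesgue_tuple R n = m.
Proof.
elim: n => [|n [m mE]].
  by exists (\d_ ([tuple] : 0.-tuple mT)).
pose phi (z : mT * n.-tuple mT) := [the n.+1.-tuple mT of z.1 :: z.2].
have mphi : measurable_fun setT phi by apply: measurable_cons.
pose psi (t : n.+1.-tuple mT) := (thead t, [tuple of behead t]).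
have phiK : cancel phi psi by move=> [x t]; congr pair; exact: val_inj.
have mpsi : measurable_fun setT psi.
  apply: measurable_fun_pair; first exact: measurable_tnth.
  exact: measurable_behead.
rewrite /= mE.
pose L : {sigma_finite_measure set mT -> \bar R} := @lebesgue_measure R.
have := @pushforward_sigma_finite _ _ _ _ _ _ _ L m phi psi mphi mpsi phiK.
by [].
Qed.

Lemma lebesgue_tuple_box n (I : 'I_n -> set mT) :
  (forall i, measurable (I i)) ->
  @lebesgue_tuple R n [set t | forall i, I i (tnth t i)] =
  \prod_(i < n) @lebesgue_measure R (I i).
Proof.
elim: n I => [|n IH] I mI.
  rewrite big_ord0 /= diracE mem_set//; by move=> [].
rewrite big_ord_recl /= /pushforward.
have [m mE] := lebesgue_tuple_measure n.
rewrite mE.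
rewrite (_ : _ @^-1` _ = I ord0 `*` [set t | forall i, I (lift ord0 i) (tnth t i)]).
  rewrite product_measure1E//.
    congr (_ * _); rewrite -mE; exact: IH.
  rewrite (_ : mkset _ = \bigcap_(i in [set: 'I_n]) ((@tnth n mT)^~ i @^-1` I (lift ord0 i))).
    apply: fin_bigcap_measurable => // i _.
    by rewrite -[X in measurable X]setTI; apply: measurable_tnth.
  by apply/seteqP; split => t /= H i; [move=> _|]; apply: H.
apply/seteqP; split => -[x t] /=.
  move=> H; split; first exact: (H ord0).
  by move=> i; have := H (lift ord0 i); rewrite tnthS.
move=> [H0 H] i; have [->|] := eqVneq i ord0; first exact: H0.
by case: (unliftP ord0 i) => [j ->|->]; rewrite ?eqxx// tnthS.
Qed.

(** A Borel set is Caratheodory measurable and the outer measure agrees on it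
    with the product measure it extends; measures of concrete sets are computed
    there. *)
Lemma measurable_lebesgueRn n (A : set 'rV[R]_n) :
  measurable ((fun t : n.-tuple mT => \row_i tnth t i) @^-1` A) ->
  measurable (A : set (lebesgueRn R n)) /\
  leb A = @lebesgue_tuple R n ((fun t => \row_i tnth t i) @^-1` A).
Proof.
set h := fun t : n.-tuple mT => \row_i tnth t i : 'rV[R]_n.
have [m mE] := lebesgue_tuple_measure n.
move=> mA; split; last first.
  by rewrite /leb /lebesgue_outer mE measurable_mu_extE.
have := @caratheodory_measurable_mu_ext _ _ _ m _ mA.
rewrite /measurable/= => H X.
rewrite /lebesgue_outer mE.
by rewrite (H (h @^-1` X)).
Qed.

Lemma measurable_coord n (i : 'I_n) :
  measurable_fun setT (fun x : lebesgueRn R n => (x : 'rV[R]_n) ord0 i : mT).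
Proof.
move=> _ Y mY; rewrite setTI; apply: (measurable_lebesgueRn _).1.
rewrite -comp_preimage (_ : _ \o _ = (@tnth n mT)^~ i).
  by rewrite -[X in measurable X]setTI; apply: measurable_tnth.
by apply/funext => t /=; rewrite mxE.
Qed.

Definition box n (I : 'I_n -> set mT) : set (lebesgueRn R n) :=
  [set x : 'rV[R]_n | forall i, I i (x ord0 i)].

Lemma measurable_box n (I : 'I_n -> set mT) :
  (forall i, measurable (I i)) -> measurable (box I).
Proof.
move=> mI; rewrite (_ : box I = \bigcap_(i in [set: 'I_n])
   ((fun x : lebesgueRn R n => (x : 'rV[R]_n) ord0 i : mT) @^-1` I i)).
  apply: fin_bigcap_measurable => // i _.
  by rewrite -[X in measurable X]setTI; apply: measurable_coord.
by apply/seteqP; split => t /= H i; [move=> _|]; apply: H.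
Qed.

Lemma leb_box n (I : 'I_n -> set mT) : (forall i, measurable (I i)) ->
  leb (box I) = \prod_(i < n) @lebesgue_measure R (I i).
Proof.
move=> mI; rewrite -lebesgue_tuple_box//.
have E : (fun t : n.-tuple mT => \row_i tnth t i) @^-1` box I =
   [set t | forall i, I i (tnth t i)].
  by apply/seteqP; split => t /= H i; have := H i; rewrite mxE.
rewrite -E; apply: (measurable_lebesgueRn _).2; rewrite E.
rewrite (_ : mkset _ = \bigcap_(i in [set: 'I_n]) ((@tnth n mT)^~ i @^-1` I i)).
  apply: fin_bigcap_measurable => // i _.
  by rewrite -[X in measurable X]setTI; apply: measurable_tnth.
by apply/seteqP; split => t /= H i; [move=> _|]; apply: H.
Qed.

Lemma leb_sigma_finite n : sigma_finite setT (@leb R n).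
Proof.
exists (fun k : nat => box (fun i : 'I_n => [set` `[(- k%:R)%R, (k%:R : R)]])).
  apply/esym/seteqP; split => // x _.
  exists (\max_i Num.bound ((x : 'rV[R]_n) ord0 i))%N => // i /=.
  rewrite in_itv /= -ler_norml (le_trans (ltW (unstable.ltr_norm_bound _))) // ler_nat.
  exact: (@leq_bigmax _ (fun i => Num.bound ((x : 'rV[R]_n) ord0 i))).
move=> k; split; first by apply: measurable_box => i; exact: measurable_itv.
rewrite leb_box; last by move=> i; exact: measurable_itv.
under eq_bigr do rewrite lebesgue_measure_itv /= lte_fin -EFinB.
rewrite (_ : \prod_(_ < _) _ = \prod_(i < n)
  (if (- k%:R < k%:R :> R)%R then k%:R - - k%:R else 0)%R%:E).
  by rewrite prodEFin ltry.
by apply: eq_bigr => i _; case: ifP.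
Qed.

HB.instance Definition _ n := Measure_isSigmaFinite.Build _ (lebesgueRn R n) R
  (@leb R n) (@leb_sigma_finite n).

End LebesgueMeasure.

(** * Dyadic cells and the dyadic distance *)

Section DyadicCells.
Context (R : realType) (n : nat).
Local Notation Rn := 'rV[R]_n.
Implicit Types (x y : Rn) (k : int) (v : 'rV[int]_n).

Definition cell_index k x : 'rV[int]_n := \row_i Num.floor (2 ^ k * x 0 i).

Definition cell k v : set Rn := [set x | cell_index k x = v].

Lemma pow2_gt0 k : 0 < (2 : R) ^ k.
Proof. exact: exprz_gt0. Qed.

Lemma pow2N k : (2 : R) ^ (- k) = (2 ^ k)^-1.
Proof. by rewrite invr_expz. Qed.

Lemma pow2D k k' : (2 : R) ^ (k + k') = 2 ^ k * 2 ^ k'.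
Proof. by rewrite expfzDr ?pnatr_eq0. Qed.

Lemma cell_indexP k x v :
  cell_index k x = v <->
  forall i, (v 0 i)%:~R <= 2 ^ k * x 0 i < (v 0 i + 1)%:~R.
Proof.
split=> [<- i|H].
  by rewrite mxE; exact: floor_itv.
by apply/rowP => i; rewrite mxE; apply: floor_def; exact: H.
Qed.

Lemma cellE k v : cell k v = box (fun i => [set` `[2 ^ (- k) * (v 0 i)%:~R,
   2 ^ (- k) * (v 0 i)%:~R + 2 ^ (- k)[ ]).
Proof.
apply/seteqP; split=> x /=.
  move=> /cell_indexP H i /=; have := H i.
  rewrite in_itv /= pow2N ler_pdivrMl ?pow2_gt0// => /andP[-> /=].
  by rewrite -{2}(mulr1 (2 ^ k)^-1) -mulrDr ltr_pdivlMl ?pow2_gt0// intrD.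
move=> H; apply/cell_indexP => i; have := H i.
rewrite /= in_itv /= pow2N ler_pdivrMl ?pow2_gt0// => /andP[-> /=].
by rewrite -{2}(mulr1 (2 ^ k)^-1) -mulrDr ltr_pdivlMl ?pow2_gt0// intrD.
Qed.

Lemma dyadicE k : dyadic k = range (cell k).
Proof.
have E v : [set 2 ^ (- k) *: (map_mx intr v + u)
    | u in [set u : Rn | forall i, u 0 i \in `[0, 1[]] = cell k v.
  apply/seteqP; split => x.
    move=> [u Hu <-]; apply/cell_indexP => i; have := Hu i.
    rewrite !mxE mulrA pow2N divff ?gt_eqF ?pow2_gt0// mul1r in_itv /= intrD.
    by move=> /andP[? ?]; lra.
  move=> /cell_indexP H; exists (2 ^ k *: x - map_mx intr v).
    move=> i; have := H i; rewrite !mxE in_itv /= intrD => /andP[? ?]; lra.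
  by rewrite addrCA subrr addr0 scalerA pow2N mulVf ?scale1r// gt_eqF ?pow2_gt0.
by apply/seteqP; split => [Q [v ->]|Q [v _ <-]]; exists v.
Qed.

(** Nesting of the dyadic cubes: measured in cells of the finer mesh, the
    endpoints of the coarser intervals are multiples of 2 ^ d, which no finer
    cell crosses. *)
Lemma cell_index_coarser k k' x y : k' <= k ->
  cell_index k x = cell_index k y -> cell_index k' x = cell_index k' y.
Proof.
move=> kk /esym/cell_indexP H; apply/esym/cell_indexP => i.
have := H i; rewrite !mxE.
set v := Num.floor _; set w := Num.floor _ => /andP[vy yv].
have vx : v%:~R <= 2 ^ k * x 0 i < (v + 1)%:~R by exact: floor_itv.
have wx : w%:~R <= 2 ^ k' * x 0 i < (w + 1)%:~R by exact: floor_itv.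
have [d dE] : exists d : nat, k = k' + d%:Z.
  by exists `|k - k'|%N; rewrite gez0_abs ?subr_ge0// addrCA subrr addr0.
have E (z : R) : 2 ^ k * z = (2 ^ d)%:R * (2 ^ k' * z).
  by rewrite dE pow2D -exprnP natrX -mulrA mulrCA.
have d0 : 0 < (2 ^ d)%:R :> R by rewrite ltr0n expn_gt0.
move: vy yv vx; rewrite !E => vy yv /andP[vx xv].
move: wx => /andP[wx xw].
have H1 : (2 ^ d)%:Z * w <= v.
  rewrite -ltzD1 -(ltr_int R); apply: le_lt_trans xv.
  by rewrite intrM ler_pM2l.
have H2 : v + 1 <= (2 ^ d)%:Z * (w + 1).
  rewrite lezD1 -(ltr_int R); apply: (le_lt_trans vx).
  by rewrite intrM ltr_pM2l.
move: H1 H2; rewrite -!(ler_int R) !intrM => H1 H2.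
rewrite -(ler_pM2l d0) -[X in _ && X](ltr_pM2l d0).
by rewrite (le_trans H1 vy) (lt_le_trans yv H2).
Qed.

Lemma cell_index_dist k x y i : cell_index k x = cell_index k y ->
  `|x 0 i - y 0 i| < 2 ^ (- k).
Proof.
move=> H; have [Hx Hy] : cell k (cell_index k y) x /\ cell k (cell_index k y) y.
  by split.
rewrite cellE in Hx Hy; have := Hx i; have := Hy i.
rewrite /= !in_itv /= => /andP[? ?] /andP[? ?].
by rewrite ltr_norml; apply/andP; split; lra.
Qed.

Definition delta_scales x y : set int :=
  [set k | cell_index k x = cell_index k y].

Lemma deltaE x y :
  delta x y = ereal_inf [set ((2 : R) ^ (- k))%:E | k in delta_scales x y].
Proof.
rewrite /delta; congr (ereal_inf _); apply/seteqP; split => _ [k H <-];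
  exists k => //=.
  case: H => I; rewrite dyadicE => -[v _ <-] [] /= Ix Iy.
  by rewrite /delta_scales /= Ix Iy.
exists (cell k (cell_index k x)); first by rewrite dyadicE; exists (cell_index k x).
by split => //=; rewrite /cell/= H.
Qed.

Local Open Scope ereal_scope.

Lemma delta_ge0 x y : 0 <= delta x y.
Proof.
rewrite deltaE; apply: le_ereal_inf_tmp => _ [k _ <-].
by rewrite lee_fin ltW ?pow2_gt0.
Qed.

Lemma delta_le k x y : cell_index k x = cell_index k y ->
  delta x y <= ((2 : R) ^ (- k))%:E.
Proof. by move=> H; rewrite deltaE; apply: ereal_inf_lbound; exists k. Qed.

Lemma delta_fin_num k x y : cell_index k x = cell_index k y ->
  delta x y \is a fin_num.
Proof.
by move=> H; rewrite ge0_fin_numE ?delta_ge0// (le_lt_trans (delta_le H)) ?ltry.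
Qed.

Lemma fine_delta_ge0 x y : (0 <= fine (delta x y))%R.
Proof. by rewrite fine_ge0 ?delta_ge0. Qed.

Lemma fine_delta_le k x y : cell_index k x = cell_index k y ->
  (fine (delta x y) <= 2 ^ (- k))%R.
Proof.
by move=> H; rewrite -lee_fin fineK ?(delta_fin_num H)// delta_le.
Qed.

(** The infimum in [delta] ranges over cells that contain both points, and each
    of them bounds the coordinate distances by its edge. *)
Lemma dist_le_delta k x y i : cell_index k x = cell_index k y ->
  (`|x 0 i - y 0 i| <= fine (delta x y))%R.
Proof.
move=> H; rewrite -lee_fin fineK ?(delta_fin_num H)// deltaE.
apply: le_ereal_inf_tmp => _ [k' /cell_index_dist H' <-].
by rewrite lee_fin ltW.
Qed.

Local Close Scope ereal_scope.

Lemma eucl_ge0 x : 0 <= eucl x.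
Proof. exact: sqrtr_ge0. Qed.

Lemma coord_le_eucl x i : `|x 0 i| <= eucl x.
Proof.
rewrite -sqrtr_sqr /eucl ler_wsqrtr// (bigD1 i)//= lerDl.
by apply: sumr_ge0 => j _; exact: sqr_ge0.
Qed.

Lemma eucl_le x (r : R) : (forall i, `|x 0 i| <= r) -> 0 <= r ->
  eucl x <= Num.sqrt n%:R * r.
Proof.
move=> H r0; rewrite -{1}(ger0_norm r0) -sqrtr_sqr -sqrtrM// /eucl ler_wsqrtr//.
have -> : n%:R * r ^+ 2 = \sum_(i < n) r ^+ 2.
  by rewrite sumr_const card_ord mulr_natl.
apply: ler_sum => i _.
by rewrite -[x 0 i ^+ 2]real_normK ?num_real// lerXn2r.
Qed.

Lemma eucl_gt0 x : x != 0 -> 0 < eucl x.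
Proof.
move=> x0; have [i xi] : exists i, x 0 i != 0.
  apply/existsP; apply: contraNT x0 => /existsPn H.
  by apply/eqP/rowP => i; rewrite mxE; apply/eqP; have := H i; rewrite negbK.
by apply: lt_le_trans (coord_le_eucl x i); rewrite normr_gt0.
Qed.

Lemma delta_gt0 k x y : x != y -> cell_index k x = cell_index k y ->
  0 < fine (delta x y).
Proof.
move=> xy H; rewrite -subr_eq0 in xy; have [i xi] : exists i, (x - y) 0 i != 0.
  apply/existsP; apply: contraNT xy => /existsPn K.
  by apply/eqP/rowP => i; rewrite mxE [RHS]mxE; apply/eqP; have := K i;
    rewrite negbK mxE.
apply: lt_le_trans (dist_le_delta i H).
by rewrite normr_gt0; rewrite !mxE in xi.
Qed.

Lemma eucl_le_delta k x y : cell_index k x = cell_index k y ->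
  eucl (x - y) <= Num.sqrt n%:R * fine (delta x y).
Proof.
move=> H; apply: eucl_le; last exact: fine_delta_ge0.
by move=> i; rewrite !mxE; exact: dist_le_delta H.
Qed.

End DyadicCells.

(** * Geometric sums of kernels *)

Section Scales.
Context (R : realType) (n : nat).
Local Notation Rn := 'rV[R]_n.
Implicit Types (x y : Rn) (m : int) (k : nat).

(** Relative levels: [m] is attached to the cube under study and [k] counts the
    halvings of the mesh from there. *)
Definition scale m k : R := 2 ^ (- (m + k%:Z)).

Lemma scale_gt0 m k : 0 < scale m k.
Proof. exact: pow2_gt0. Qed.

Lemma scaleE m k : scale m k = (2 ^ m)^-1 / 2 ^+ k.
Proof. by rewrite /scale pow2N pow2D -exprnP invfM. Qed.

Lemma scaleS m k : scale m k.+1 = scale m k / 2.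
Proof. by rewrite !scaleE exprSr invfM mulrA. Qed.

Lemma scale_powR m k (s : R) : scale m k `^ s = scale m 0 `^ s * (2 `^ (- s)) ^+ k.
Proof.
elim: k => [|k IH]; first by rewrite mulr1.
rewrite scaleS powRM ?invr_ge0// ?(ltW (scale_gt0 _ _))// IH exprSr mulrA.
by rewrite -powR_inv1// -powRrM mulN1r.
Qed.

Lemma scale_powRV m k (s : R) :
  (scale m k.+1 `^ s)^-1 = 2 `^ s * (scale m k `^ s)^-1.
Proof.
rewrite (scale_powR m k.+1) (scale_powR m k) exprSr mulrA invfM mulrC; congr (_ * _).
by rewrite powRN invrK.
Qed.

Lemma powR2_gt1 (s : R) : 0 < s -> 1 < (2 : R) `^ s.
Proof.
move=> s0; have := @gt0_ltr_powR R s s0 1 2.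
by rewrite powR1 => -> //; rewrite ?nnegrE// ltr1n.
Qed.

Lemma subr1_powR2N_gt0 (s : R) : 0 < s -> 0 < 1 - (2 : R) `^ (- s).
Proof. by move=> /powR2_gt1 g; rewrite subr_gt0 powRN invf_lt1// (lt_trans ltr01). Qed.

Lemma sum_scale_le m (s : R) N : 0 < s ->
  \sum_(k < N.+1) (scale m k `^ s)^-1 <=
  (1 - 2 `^ (- s))^-1 * (scale m N `^ s)^-1.
Proof.
move=> s0; have g1 := powR2_gt1 s0; have h1 := subr1_powR2N_gt0 s0.
have g0 : 0 < (2 : R) `^ s by rewrite powR_gt0.
elim: N => [|N IH].
  rewrite big_ord1 ler_peMl ?invr_ge0 ?powR_ge0//.
  by rewrite invf_ge1// lerBlDr lerDl powR_ge0.
rewrite big_ord_recr /= (le_trans (lerD IH (lexx _)))// scale_powRV.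
set a := (_ `^ _)^-1; set C := (1 - _)^-1.
have -> : C * (2 `^ s * a) = C * a + 2 `^ s * a; last by [].
rewrite -mulrDl mulrA; congr (_ * a); rewrite /C powRN.
by field; apply/andP; split; rewrite gt_eqF// subr_gt0.
Qed.

(** The terms grow geometrically with [k], so the last admissible one dominates;
    for it the cell containing both points has edge at least [delta x y]. This
    is how the contributions of all scales are reassembled into the dyadic
    kernel. *)
Lemma sum_scale_le_delta m (s : R) x y N : 0 < s -> x != y ->
  \sum_(k < N | cell_index (m + k%:Z) x == cell_index (m + k%:Z) y)
     (scale m k `^ s)^-1 <=
  (1 - 2 `^ (- s))^-1 * (fine (delta x y) `^ s)^-1.
Proof.
move=> s0 xy; have h1 := subr1_powR2N_gt0 s0.
elim: N => [|N IH].
  by rewrite big_ord0 mulr_ge0// invr_ge0 ?powR_ge0// ltW.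
rewrite big_mkcond big_ord_recr /= -big_mkcond /=.
case: ifPn => [/eqP H|_]; last by rewrite addr0.
apply: (@le_trans _ _ (\sum_(k < N.+1) (scale m k `^ s)^-1)).
  rewrite [leRHS]big_ord_recr /= lerD2r [leLHS]big_mkcond.
  by apply: ler_sum => i _; case: ifP => // _; rewrite invr_ge0 powR_ge0.
rewrite (le_trans (sum_scale_le _ _ s0))// ler_wpM2l ?invr_ge0 ?(ltW h1)//.
rewrite lef_pV2 ?posrE ?powR_gt0 ?scale_gt0 ?(delta_gt0 xy H)//.
apply: ge0_ler_powR; rewrite ?nnegrE ?fine_delta_ge0 ?(ltW s0)//.
  exact: ltW (scale_gt0 _ _).
exact: fine_delta_le H.
Qed.

Definition sup_close (r : R) x y := [forall i, `|x 0 i - y 0 i| < r].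

Lemma eucl_ge_not_close r x y : ~~ sup_close r x y -> r <= eucl (x - y).
Proof.
move=> /forallPn[i]; rewrite -leNgt => H.
by apply: (le_trans H); have := coord_le_eucl (x - y) i; rewrite !mxE.
Qed.

Lemma exists_not_close m x y : x != y -> exists k, ~~ sup_close (scale m k) x y.
Proof.
move=> xy; have [i xi] : exists i, x 0 i != y 0 i.
  apply/existsP; apply: contraNT xy => /existsPn H.
  by apply/eqP/rowP => i; apply/eqP; have := H i; rewrite negbK.
set d := `|x 0 i - y 0 i|; have d0 : 0 < d by rewrite normr_gt0 subr_eq0.
have [k kP] : exists k, scale m k <= d.
  exists (Num.bound (scale m 0 / d)).
  set k := Num.bound _; have kb : scale m 0 / d < 2 ^+ k.
    apply: upper_nthrootP; exact: leqnn.
  rewrite ltr_pdivrMr// in kb.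
  have -> : scale m k = scale m 0 / 2 ^+ k by rewrite !scaleE expr0 divr1.
  by rewrite ler_pdivrMr ?exprn_gt0// mulrC ltW.
by exists k; apply/forallPn; exists i; rewrite -leNgt.
Qed.

(** Layer-cake bound of the Euclidean kernel. A threshold on the number of terms
    is needed because two points are separated only from some scale on. *)
Lemma eucl_kernel_le m (s : R) x y : 0 < s -> x != y -> exists N0, forall N,
  (N0 <= N)%N -> (eucl (x - y) `^ s)^-1 <= (scale m 0 `^ s)^-1 +
    \sum_(k < N | sup_close (scale m k) x y) (scale m k.+1 `^ s)^-1.
Proof.
move=> s0 xy.
have H k : ~~ sup_close (scale m k) x y ->
    (eucl (x - y) `^ s)^-1 <= (scale m k `^ s)^-1.
  move=> /eucl_ge_not_close H; have k0 := scale_gt0 m k.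
  rewrite lef_pV2 ?posrE ?powR_gt0// ?(lt_le_trans k0)//.
  by apply: ge0_ler_powR; rewrite ?nnegrE ?(ltW s0) ?(ltW k0) ?eucl_ge0.
(* K is the first scale at which the points are no longer close: the kernel is
   bounded there, and they are still close at the scale before. *)
have [K nK minK] := ex_minnP (exists_not_close m xy).
exists K => N KN; case: K => [|K] in nK minK KN *.
  by rewrite (le_trans (H _ nK))// lerDl sumr_ge0// => i _; rewrite invr_ge0 powR_ge0.
have nearK : sup_close (scale m K) x y.
  by apply/negPn/negP => /minK; rewrite ltnn.
rewrite (le_trans (H _ nK))// (bigD1 (Ordinal KN))//= addrCA lerDl.
rewrite addr_ge0 ?invr_ge0 ?powR_ge0// sumr_ge0// => i _.
by rewrite invr_ge0 powR_ge0.
Qed.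

End Scales.

(** * Double integrals of nonnegative functions *)

Section IntegralTools.
Local Open Scope ereal_scope.

(** The integral of a nonnegative function is a supremum over simple functions,
    hence monotone for arbitrary functions; this covers the kernel with [delta]. *)
Lemma le_integral_nonneg d (T : measurableType d) (R : realType)
    (m : {measure set T -> \bar R}) (D : set T) (f g : T -> \bar R) :
  (forall x, D x -> 0 <= f x) -> (forall x, D x -> f x <= g x) ->
  \int[m]_(x in D) f x <= \int[m]_(x in D) g x.
Proof.
move=> f0 fg.
have g0 x : D x -> 0 <= g x by move=> Dx; rewrite (le_trans (f0 _ Dx)) ?fg.
rewrite !ge0_integralE//; apply: ge_ereal_sup => _ [h /= hf <-].
apply: ereal_sup_ubound; exists h => //= x.
apply: (le_trans (hf x)); rewrite /patch; case: ifPn => // xD.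
by apply: fg; rewrite inE in xD.
Qed.

Lemma measurable_natr_bool d (T : measurableType d) (R : realType)
    (b : T -> bool) : measurable [set x | b x] ->
  measurable_fun setT (fun x => (b x)%:R : R).
Proof.
move=> mb; rewrite (_ : (fun x => _) = \1_[set x | b x] :> (T -> R)).
  exact: measurable_indic.
apply/funext => x; rewrite indicE; congr ((nat_of_bool _)%:R).
by apply/idP/idP; rewrite inE.
Qed.

End IntegralTools.

Section PairIntegral.
Local Open Scope ereal_scope.
Context (R : realType) (n : nat).
Local Notation T := (lebesgueRn R n).
Local Notation mu := (@leb R n).
Implicit Types (Q : set T) (F G : T -> T -> R).

Definition jmeasurable F := measurable_fun setT (fun z : T * T => F z.1 z.2).

Definition dint Q F : \bar R := \int[mu]_(x in Q) \int[mu]_(y in Q) (F x y)%:E.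

Lemma jmeasurable_inner Q F : measurable Q -> jmeasurable F ->
  (forall x y, (0 <= F x y)%R) ->
  measurable_fun setT (fun x => \int[mu]_(y in Q) (F x y)%:E).
Proof.
move=> mQ mF F0.
pose f (z : T * T) := (F z.1 z.2 * (\1_Q z.2))%:E.
have mf : measurable_fun setT f.
  apply/measurable_EFinP; apply: measurable_funM => //.
  apply: (measurableT_comp (measurable_indic _)) => //.
have := @measurable_fun_fubini_tonelli_F _ _ _ _ _ mu f mf.
rewrite (_ : fubini_F _ _ = fun x => \int[mu]_(y in Q) (F x y)%:E).
  by apply => z; rewrite lee_fin mulr_ge0.
apply/funext => x; rewrite /fubini_F [RHS]integral_mkcond.
apply: eq_integral => y _; rewrite /f /= patchE indicE.
by case: ifP; rewrite ?mulr1 ?mulr0.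
Qed.

Lemma jmeasurable_right F x : jmeasurable F -> measurable_fun setT (F x).
Proof.
move=> mF.
exact: (measurableT_comp mF (measurable_pair1 x)).
Qed.

Lemma dint_ge0 Q F : (forall x y, (0 <= F x y)%R) -> 0 <= dint Q F.
Proof.
by move=> F0; do 2 apply: integral_ge0 => ? _; rewrite lee_fin.
Qed.

Lemma le_dint Q F G : (forall x y, Q x -> Q y -> (0 <= F x y)%R) ->
  (forall x y, Q x -> Q y -> (F x y <= G x y)%R) -> dint Q F <= dint Q G.
Proof.
move=> F0 FG; apply: le_integral_nonneg => x Qx.
  by apply: integral_ge0 => y Qy; rewrite lee_fin F0.
by apply: le_integral_nonneg => y Qy; rewrite lee_fin ?F0 ?FG.
Qed.

Lemma measurable_inner Q F x : measurable Q -> jmeasurable F ->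
  measurable_fun Q (fun y => (F x y)%:E).
Proof.
move=> mQ mF; apply: measurable_funTS; apply/measurable_EFinP.
exact: jmeasurable_right.
Qed.

Lemma measurable_outer Q F : measurable Q -> jmeasurable F ->
  (forall x y, (0 <= F x y)%R) ->
  measurable_fun Q (fun x => \int[mu]_(y in Q) (F x y)%:E).
Proof. by move=> mQ mF F0; apply: measurable_funTS; exact: jmeasurable_inner. Qed.

Lemma inner_ge0 Q F x : (forall x y, (0 <= F x y)%R) ->
  0 <= \int[mu]_(y in Q) (F x y)%:E.
Proof. by move=> F0; apply: integral_ge0 => y _; rewrite lee_fin. Qed.

Lemma dintD Q F G : measurable Q -> jmeasurable F -> jmeasurable G ->
  (forall x y, (0 <= F x y)%R) -> (forall x y, (0 <= G x y)%R) ->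
  dint Q (fun x y => F x y + G x y)%R = dint Q F + dint Q G.
Proof.
move=> mQ mF mG F0 G0.
have E x : \int[mu]_(y in Q) (F x y + G x y)%:E =
    \int[mu]_(y in Q) (F x y)%:E + \int[mu]_(y in Q) (G x y)%:E.
  apply: (@ge0_integralD _ _ _ mu Q mQ (fun y => (F x y)%:E) (fun y => (G x y)%:E)).
  - by move=> y _; rewrite lee_fin.
  - exact: (measurable_inner _ mQ mF).
  - by move=> y _; rewrite lee_fin.
  - exact: (measurable_inner _ mQ mG).
transitivity (\int[mu]_(x in Q) (\int[mu]_(y in Q) (F x y)%:E + \int[mu]_(y in Q) (G x y)%:E)).
  by apply: eq_integral => x _; exact: E.
apply: ge0_integralD.
- exact: mQ.
- by move=> x _; exact: inner_ge0.
- exact: (measurable_outer mQ mF F0).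
- by move=> x _; exact: inner_ge0.
- exact: (measurable_outer mQ mG G0).
Qed.

Lemma dintZ Q F (k : R) : measurable Q -> jmeasurable F ->
  (forall x y, (0 <= F x y)%R) -> (0 <= k)%R ->
  dint Q (fun x y => k * F x y)%R = k%:E * dint Q F.
Proof.
move=> mQ mF F0 k0.
transitivity (\int[mu]_(x in Q) (k%:E * \int[mu]_(y in Q) (F x y)%:E)).
  apply: eq_integral => x _.
  apply: (@ge0_integralZl_EFin _ _ _ mu Q mQ (fun y => (F x y)%:E)).
  - by move=> y _; rewrite lee_fin.
  - exact: (measurable_inner _ mQ mF).
  - exact: k0.
apply: ge0_integralZl_EFin.
- exact: mQ.
- by move=> x _; exact: inner_ge0.
- exact: (measurable_outer mQ mF F0).
- exact: k0.
Qed.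

Lemma dint_sum Q (I : Type) (s : seq I) (P : pred I) (F : I -> T -> T -> R) :
  measurable Q ->
  (forall i, jmeasurable (F i)) -> (forall i x y, (0 <= F i x y)%R) ->
  dint Q (fun x y => \sum_(i <- s | P i) F i x y)%R =
  \sum_(i <- s | P i) dint Q (F i).
Proof.
move=> mQ mF F0; elim: s => [|i s IH].
  rewrite big_nil /dint; apply: integral0_eq => x _; apply: integral0_eq => y _.
  by rewrite big_nil.
rewrite big_cons; case: ifPn => Pi; last first.
  by rewrite -IH; congr (dint Q _); apply/funext => x; apply/funext => y;
    rewrite big_cons (negbTE Pi).
have mS : jmeasurable (fun x y => \sum_(i <- s | P i) F i x y)%R.
  rewrite /jmeasurable; under eq_fun do rewrite big_mkcond.
  by apply: measurable_sum => j; case: (P j) => //; exact: mF.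
have S0 x y : (0 <= \sum_(i <- s | P i) F i x y)%R by rewrite sumr_ge0.
rewrite -IH -(dintD mQ (mF i) mS (F0 i) S0).
by congr (dint Q _); apply/funext => x; apply/funext => y; rewrite big_cons Pi.
Qed.

Lemma dint_swap Q F : measurable Q -> jmeasurable F ->
  (forall x y, (0 <= F x y)%R) ->
  dint Q F = dint Q (fun x y => F y x).
Proof.
move=> mQ mF F0.
pose f (z : T * T) := (F z.1 z.2 * (\1_Q z.1 * \1_Q z.2))%:E.
have mf : measurable_fun setT f.
  apply/measurable_EFinP; apply: measurable_funM => //; apply: measurable_funM;
    exact: (measurableT_comp (measurable_indic _)).
have := @fubini_tonelli _ _ _ _ _ mu mu f mf.
have E (G : T -> T -> R) : dint Q G =
    \int[mu]_x \int[mu]_y (G x y * (\1_Q x * \1_Q y))%:E.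
  rewrite /dint [LHS]integral_mkcond; apply: eq_integral => x _.
  rewrite patchE; case: ifPn => Qx.
    rewrite integral_mkcond; apply: eq_integral => y _.
    by rewrite patchE !indicE Qx mul1r; case: ifP; rewrite ?mulr1 ?mulr0.
  rewrite integral0_eq// => y _.
  by rewrite !indicE (negbTE Qx) mul0r mulr0.
rewrite !E => ->; last by move=> z; rewrite lee_fin !mulr_ge0.
apply: eq_integral => x _; apply: eq_integral => y _.
by rewrite /f /= [(\1_Q y * _)%R]mulrC.
Qed.

(** Monotone convergence, with a pointwise hypothesis on finite partial sums so
    that no infinite sum of kernels has to be manipulated. *)
Lemma dint_series_le Q F (G : nat -> T -> T -> R) (M : \bar R) :
  measurable Q -> (forall k, jmeasurable (G k)) ->
  (forall k x y, (0 <= G k x y)%R) ->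
  (forall x y, Q x -> Q y -> (0 <= F x y)%R) ->
  (forall x y, Q x -> Q y -> exists N0, forall N, (N0 <= N)%N ->
     (F x y <= \sum_(k < N) G k x y)%R) ->
  (forall N, \sum_(k < N) dint Q (G k) <= M) -> dint Q F <= M.
Proof.
move=> mQ mG G0 F0 FG GM.
apply: (@le_trans _ _ (\sum_(k <oo) dint Q (G k))); last first.
  apply: lime_le; first by apply: is_cvg_nneseries => k _ _; exact: dint_ge0.
  by apply: nearW => N; rewrite big_mkord.
rewrite /dint -integral_nneseries; last 3 first.
- exact: mQ.
- by move=> k; exact: (measurable_outer mQ (mG k) (G0 k)).
- by move=> k x _; apply: integral_ge0 => y _; rewrite lee_fin.
apply: le_integral_nonneg => x Qx.
  by apply: integral_ge0 => y Qy; rewrite lee_fin F0.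
rewrite -integral_nneseries; last 3 first.
- exact: mQ.
- by move=> k; exact: (measurable_inner _ mQ (mG k)).
- by move=> k y _; rewrite lee_fin.
apply: le_integral_nonneg => y Qy; first by rewrite lee_fin F0.
have [N0 /(_ N0 (leqnn _)) H] := FG x y Qx Qy.
apply: (@le_trans _ _ (\sum_(0 <= k < N0) (G k x y)%:E)).
  by rewrite big_mkord sumEFin lee_fin.
by apply: nneseries_lim_ge => k _; rewrite lee_fin.
Qed.

End PairIntegral.

(** * Inequalities for powers *)

Section PowerInequalities.
Context (R : realType).
Implicit Types (a b t q rho lam : R).

(** Young's inequality, read as the tangent line inequality for the power at
    [b]. *)
Lemma powR_tangent q t b : 1 <= q -> 0 <= t -> 0 <= b ->
  q * b `^ (q - 1) * t <= t `^ q + (q - 1) * b `^ q.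
Proof.
move=> q1 t0 b0; have q0 : 0 < q by lra.
have [->|qn1] := eqVneq q 1.
  by rewrite subrr powRr0 !mul1r mul0r addr0 powRr1.
have qm : 0 < q - 1 by rewrite subr_gt0 lt_neqAle eq_sym qn1.
(* The exponents q and q / (q - 1) are conjugate and the power of b is raised to
   the second one. *)
have := @conjugate_powR R t (b `^ (q - 1)) q (q / (q - 1)) t0 (powR_ge0 _ _) q0.
rewrite divr_gt0// => /(_ isT).
have -> : q^-1 + (q / (q - 1))^-1 = 1.
  by rewrite invf_div; field; rewrite gt_eqF.
move=> /(_ erefl); rewrite -powRrM.
have -> : (q - 1) * (q / (q - 1)) = q by field; rewrite gt_eqF.
move=> H; have : q * (t * b `^ (q - 1)) <=
    q * (t `^ q / q + b `^ q / (q / (q - 1))) by rewrite ler_pM2l.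
suff -> : q * (t `^ q / q + b `^ q / (q / (q - 1))) = t `^ q + (q - 1) * b `^ q.
  by rewrite [t * _]mulrC mulrA.
by field; apply/andP; split; rewrite gt_eqF.
Qed.

Lemma powR_convex q lam a b : 1 <= q -> 0 <= lam <= 1 -> 0 <= a -> 0 <= b ->
  (lam * a + (1 - lam) * b) `^ q <= lam * a `^ q + (1 - lam) * b `^ q.
Proof.
move=> q1 /andP[l0 l1] a0 b0; set m := _ + _.
have m0 : 0 <= m by rewrite addr_ge0// mulr_ge0// subr_ge0.
have Ha := powR_tangent q1 a0 m0; have Hb := powR_tangent q1 b0 m0.
have mE : m `^ q = m * m `^ (q - 1) by rewrite mulr_powRB1//; lra.
have : lam * (q * m `^ (q - 1) * a) + (1 - lam) * (q * m `^ (q - 1) * b) <=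
    lam * (a `^ q + (q - 1) * m `^ q) + (1 - lam) * (b `^ q + (q - 1) * m `^ q).
  by apply: lerD; apply: ler_wpM2l => //; rewrite subr_ge0.
have -> : lam * (q * m `^ (q - 1) * a) + (1 - lam) * (q * m `^ (q - 1) * b) =
    q * m `^ q.
  transitivity (q * (lam * a + (1 - lam) * b) * m `^ (q - 1)); first by ring.
  by rewrite -/m mE mulrA.
move=> H; lra.
Qed.

(** Convexity with weights [lam] and [1 - lam]. The factor [rho] of the first
    term can be taken as close to 1 as desired, at the cost of a large [M]; that
    freedom is what admits every [s < n + 1] in the block estimate. *)
Lemma powRD_weighted q rho : 1 <= q -> 1 < rho -> exists2 M, 0 <= M &
  forall a b, 0 <= a -> 0 <= b ->
    (a + b) `^ q <= rho * a `^ q + M * b `^ q.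
Proof.
move=> q1 rho1; have rho0 : 0 < rho by lra.
(* With this weight the first coefficient lam `^ (1 - q) equals rho `^ (1 - q^-1),
   which is at most rho. *)
set lam := rho `^ (- q^-1).
have l0 : 0 < lam by rewrite powR_gt0.
have l1 : lam < 1.
  rewrite /lam powRN invf_lt1 ?powR_gt0//.
  have := @gt0_ltr_powR R q^-1 _ 1 rho; rewrite powR1 => -> //.
  - by rewrite invr_gt0; lra.
  - by rewrite nnegrE.
  - by rewrite nnegrE ltW.
have l1' : 0 < 1 - lam by rewrite subr_gt0.
exists ((1 - lam) `^ (1 - q)); first exact: powR_ge0.
move=> a b a0 b0.
have := @powR_convex q lam (a / lam) (b / (1 - lam)) q1.
rewrite (ltW l0) (ltW l1) !divr_ge0 ?(ltW l0) ?(ltW l1')// => /(_ isT isT isT).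
have -> : lam * (a / lam) + (1 - lam) * (b / (1 - lam)) = a + b.
  by field; apply/andP; split; rewrite gt_eqF.
have E c d : 0 < c -> 0 <= d -> c * (d / c) `^ q = c `^ (1 - q) * d `^ q.
  move=> c0 d0; rewrite powRM ?invr_ge0 ?(ltW c0)// -[c^-1]powR_inv1 ?(ltW c0)//.
  have -> : c `^ (1 - q) = c * c `^ (- q).
    by rewrite powRD ?powRr1 ?(ltW c0)// (gt_eqF c0) implybT.
  by rewrite -powRrM mulN1r; ring.
rewrite !E// => /le_trans; apply; rewrite lerD2r ler_wpM2r ?powR_ge0//.
rewrite /lam -powRrM -[leRHS]powRr1 ?(ltW rho0)// ler_powR ?(ltW rho1)//.
have -> : - q^-1 * (1 - q) = 1 - q^-1 by field; rewrite gt_eqF; lra.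
by rewrite lerBlDr lerDl invr_ge0; lra.
Qed.

Lemma powRD_le q a b : 1 <= q -> 0 <= a -> 0 <= b ->
  (a + b) `^ q <= 2 `^ q * (a `^ q + b `^ q).
Proof.
move=> q1 a0 b0; have q0 : 0 <= q by lra.
have H x y : 0 <= x -> x <= y -> (x + y) `^ q <= 2 `^ q * y `^ q.
  move=> x0 xy; rewrite -powRM ?(le_trans x0 xy)//.
  by apply: ge0_ler_powR => //; rewrite ?nnegrE; lra.
have [ab|/ltW ba] := leP a b.
  by rewrite (le_trans (H _ _ a0 ab))// ler_wpM2l ?powR_ge0// lerDr powR_ge0.
by rewrite addrC (le_trans (H _ _ b0 ba))// ler_wpM2l ?powR_ge0// lerDl powR_ge0.
Qed.

Lemma powR_distD q a b c : 1 <= q ->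
  `|a - c| `^ q <= 2 `^ q * (`|a - b| `^ q + `|b - c| `^ q).
Proof.
move=> q1; apply: le_trans (powRD_le q1 _ _) => //.
by apply: ge0_ler_powR; rewrite ?nnegrE ?addr_ge0 ?ler_distD//; lra.
Qed.

End PowerInequalities.

(** * Measurability and measure of cells, slabs and kernels *)

Section MeasureOfCells.
Local Open Scope ereal_scope.
Context (R : realType) (n : nat).
Local Notation T := (lebesgueRn R n).
Local Notation mu := (@leb R n).
Implicit Types (x y : 'rV[R]_n) (k : int) (v : 'rV[int]_n).

Lemma lebesgue_measure_itv_fin (a b : R) (ba bb : bool) : (a <= b)%R ->
  @lebesgue_measure R [set` Interval (BSide ba a) (BSide bb b)] = (b - a)%:E.
Proof.
move=> ab; rewrite lebesgue_measure_itv /= lte_fin -EFinB.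
by case: ltgtP ab => // -> _; rewrite subrr.
Qed.

Lemma leb_itv_box (a b : 'I_n -> R) (ba bb : 'I_n -> bool) :
  (forall i, (a i <= b i)%R) ->
  let Q := box (fun i => [set` Interval (BSide (ba i) (a i)) (BSide (bb i) (b i))]) in
  measurable Q /\ mu Q = (\prod_i (b i - a i))%:E.
Proof.
move=> ab Q; split; first by apply: measurable_box => i; exact: measurable_itv.
rewrite leb_box; last by move=> i; exact: measurable_itv.
by rewrite -prodEFin; apply: eq_bigr => i _; rewrite lebesgue_measure_itv_fin.
Qed.

Lemma measurable_cell k v : measurable (cell k v : set T).
Proof. by rewrite cellE; apply: measurable_box => i; exact: measurable_itv. Qed.

Lemma leb_cell k v : mu (cell k v) = (((2 : R) ^ (- k)) ^+ n)%:E.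
Proof.
rewrite cellE.
have ab i : (2 ^ (- k) * (v 0 i)%:~R <= 2 ^ (- k) * (v 0 i)%:~R + 2 ^ (- k) :> R)%R.
  by rewrite lerDl ltW ?pow2_gt0.
have [_ ->] := leb_itv_box (fun=> true) (fun=> true) ab.
congr EFin; rewrite (eq_bigr (fun=> (2 : R) ^ (- k))).
  by rewrite prodr_const card_ord.
by move=> i _; ring.
Qed.

Definition close_set (r : R) x : set T := [set y : 'rV[R]_n | sup_close r x y].

Lemma leb_close_set (r : R) x : (0 <= r)%R ->
  measurable (close_set r x) /\ mu (close_set r x) = ((2 * r) ^+ n)%:E.
Proof.
move=> r0.
have -> : close_set r x = box (fun i => [set` Interval (BSide false (x 0%R i - r)%R)
    (BSide true (x 0%R i + r)%R)]).
  apply/seteqP; split => y /=.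
    move=> /forallP H i /=; have := H i; rewrite ltr_norml in_itv /= => /andP[? ?].
    by apply/andP; split; lra.
  move=> H; apply/forallP => i; have := H i.
  rewrite /= in_itv /= ltr_norml => /andP[? ?].
  by apply/andP; split; lra.
have ab i : (x 0%R i - r <= x 0%R i + r)%R by lra.
have [? ->] := leb_itv_box (fun=> false) (fun=> true) ab; split => //.
congr EFin; rewrite (eq_bigr (fun=> (2 * r)%R)); last by move=> i _; ring.
by rewrite prodr_const card_ord.
Qed.

(** The points of the cell within the fraction [e] of the edge length from the
    lower ([b = true]) or upper face orthogonal to the direction [i]. *)
Definition slab (k : int) v (e : R) (b : bool) (i : 'I_n) : set T :=
  box (fun j => if j == i then
    if b then [set` `[2 ^ (- k) * (v 0%R j)%:~R,
                      2 ^ (- k) * (v 0%R j)%:~R + e * 2 ^ (- k)[%R]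
    else [set` `[2 ^ (- k) * (v 0%R j)%:~R + 2 ^ (- k) - e * 2 ^ (- k),
                 2 ^ (- k) * (v 0%R j)%:~R + 2 ^ (- k)[%R]
    else [set` `[2 ^ (- k) * (v 0%R j)%:~R, 2 ^ (- k) * (v 0%R j)%:~R + 2 ^ (- k)[%R]).

Lemma leb_slab k v (e : R) b i : (0 <= e)%R ->
  measurable (slab k v e b i) /\
  mu (slab k v e b i) = (e * ((2 : R) ^ (- k)) ^+ n)%:E.
Proof.
move=> e0; have p0 := pow2_gt0 R (- k).
pose A j : R := (2 ^ (- k) * (v 0 j)%:~R)%R.
pose a j := (if (j == i) && ~~ b then A j + 2 ^ (- k) - e * 2 ^ (- k) else A j)%R.
pose c j := (if (j == i) && b then A j + e * 2 ^ (- k) else A j + 2 ^ (- k))%R.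
have -> : slab k v e b i = box (fun j => [set` `[a j, c j[%R]).
  by congr box; apply/funext => j; rewrite /a /c /A; case: eqP => //= _; case: (b).
have ac j : (a j <= c j)%R.
  rewrite /a /c; move: (A j) p0 => Aj; move: (2 ^ (- k) : R) => P p0.
  have ? : (0 <= e * P)%R by rewrite mulr_ge0// ltW.
  by case: eqP => _ /=; case: (b) => /=; lra.
have [? ->] := leb_itv_box (fun=> true) (fun=> true) ac; split => //.
congr EFin; rewrite (bigD1 i)//= (eq_bigr (fun=> (2 : R) ^ (- k))); last first.
  by move=> j /negbTE ji; rewrite /a /c ji /=; ring.
have -> : (c i - a i = e * 2 ^ (- k))%R.
  by rewrite /a /c eqxx /=; case: (b) => /=; ring.
rewrite prodr_const -mulrA -exprS; congr (_ * _ ^+ _)%R.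
by rewrite cardC1 card_ord prednK// (leq_ltn_trans _ (ltn_ord i)).
Qed.

(** Functions of the cell index take countably many values, so only cells have
    to be measurable. *)
Lemma countable_fibre_measurable d (X : measurableType d) (I : countType)
    (f : X -> I) (A : set I) :
  (forall i, measurable (f @^-1` [set i])) -> measurable (f @^-1` A).
Proof.
move=> mf; rewrite (_ : f @^-1` A =
    \bigcup_i (if i \in A then f @^-1` [set i] else set0)).
  apply: countable_bigcupT_measurable => [|i]; first exact: countableP.
  by case: ifP.
apply/seteqP; split => x /=.
  by move=> Afx; exists (f x) => //=; rewrite ifT ?inE.
by move=> [i _]; case: ifPn => //=; rewrite inE => Ai ->.
Qed.

Lemma measurable_cell_index_fun k (h : 'rV[int]_n -> R) :
  measurable_fun setT (fun x : T => h (cell_index k x)).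
Proof.
move=> _ Y mY; rewrite setTI.
apply: (@countable_fibre_measurable _ T 'rV[int]_n
  (fun x : T => cell_index k x) (fun v => Y (h v))) => v.
exact: measurable_cell.
Qed.

Lemma jmeasurable_cell_index k (h : 'rV[int]_n -> 'rV[int]_n -> R) :
  jmeasurable (fun x y : T => h (cell_index k x) (cell_index k y)).
Proof.
move=> _ Y mY; rewrite setTI.
pose f (z : T * T) := (cell_index k z.1, cell_index k z.2).
suff H vw : measurable (f @^-1` [set vw]).
  exact: (countable_fibre_measurable (fun v : _ * _ => Y (h v.1 v.2)) H).
case: vw => v w.
rewrite (_ : _ @^-1` _ = cell k v `*` cell k w).
  by apply: measurableX; exact: measurable_cell.
by apply/seteqP; split => -[x y]; rewrite /f /cell /= => -[<- <-].
Qed.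

Lemma measurable_coord1 i : measurable_fun setT (fun z : T * T => (z.1 : 'rV[R]_n) 0%R i : R).
Proof.
exact: (@measurableT_comp _ _ _ _ _ _ (fun x : T => (x : 'rV[R]_n) 0%R i : R) _ fst
  (measurable_coord i) measurable_fst).
Qed.

Lemma measurable_coord2 i : measurable_fun setT (fun z : T * T => (z.2 : 'rV[R]_n) 0%R i : R).
Proof.
exact: (@measurableT_comp _ _ _ _ _ _ (fun x : T => (x : 'rV[R]_n) 0%R i : R) _ snd
  (measurable_coord i) measurable_snd).
Qed.

Lemma measurable_coordB i :
  measurable_fun setT (fun z : T * T => (z.1 : 'rV[R]_n) 0%R i - (z.2 : 'rV[R]_n) 0%R i : R)%R.
Proof. by apply: measurable_funB; [exact: measurable_coord1|exact: measurable_coord2]. Qed.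

Lemma jmeasurable_eucl (s : R) :
  jmeasurable (fun x y : T => (eucl ((x : 'rV[R]_n) - y) `^ s)^-1)%R.
Proof.
rewrite /jmeasurable.
rewrite (_ : (fun z : T * T => _) = (fun z : T * T =>
   (\sum_i ((z.1 : 'rV[R]_n) 0 i - (z.2 : 'rV[R]_n) 0 i) ^+ 2) `^ (2^-1 * - s))%R).
  apply: (measurableT_comp (measurable_powR _)).
  apply: measurable_sum => i.
  apply: (measurableT_comp (exprn_measurable _)); exact: measurable_coordB.
apply/funext => z; rewrite powRrM -powRN; congr (_ `^ _)%R.
rewrite powR12_sqrt; last by apply: sumr_ge0 => i _; exact: sqr_ge0.
by congr Num.sqrt; apply: eq_bigr => i _; rewrite !mxE.
Qed.

Lemma jmeasurable_close (r : R) : jmeasurable (fun x y : T => (sup_close r x y)%:R%R).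
Proof.
apply: measurable_natr_bool.
rewrite (_ : mkset _ = \bigcap_(i in [set: 'I_n])
  ((fun z : T * T => `|(z.1 : 'rV[R]_n) 0 i - (z.2 : 'rV[R]_n) 0 i|)%R @^-1` [set` `]-oo, r[%R])).
  apply: fin_bigcap_measurable => // i _.
  rewrite -[X in measurable X]setTI.
  have mD := measurable_coordB i.
  have mN : measurable_fun setT (fun z : T * T =>
      `|(z.1 : 'rV[R]_n) 0 i - (z.2 : 'rV[R]_n) 0 i|)%R.
    by apply: measurableT_comp mD.
  by apply: mN => //; exact: measurable_itv.
apply/seteqP; split => z /=.
  by move=> /forallP H i _ /=; rewrite in_itv /=; exact: H.
by move=> H; apply/forallP => i; have := H i Logic.I; rewrite /= in_itv.
Qed.

End MeasureOfCells.

(** * Averages and oscillation *)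

Section Averages.
Local Open Scope ereal_scope.
Context (R : realType) (n : nat) (q : R) (q1 : (1 <= q)%R).
Local Notation T := (lebesgueRn R n).
Local Notation mu := (@leb R n).
Variables (u : T -> R) (mu_u : measurable_fun setT u).
Implicit Types A Q : set T.

Definition avg A : R := ((vol A)^-1 * fine (\int[mu]_(y in A) (u y)%:E))%R.

Definition osc (x y : T) : R := (`|u x - u y| `^ q)%R.

Lemma osc_ge0 x y : (0 <= osc x y)%R. Proof. exact: powR_ge0. Qed.

Lemma oscC x y : osc x y = osc y x. Proof. by rewrite /osc distrC. Qed.

Lemma measurable_powR_norm (h : T -> R) : measurable_fun setT h ->
  measurable_fun setT (fun x => `|h x| `^ q)%R.
Proof.
by move=> mh; apply: (measurableT_comp (measurable_powR _));
  apply: measurableT_comp mh.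
Qed.

Lemma jmeasurable_osc : jmeasurable osc.
Proof.
rewrite /jmeasurable /osc; apply: (measurableT_comp (measurable_powR _)).
have m1 : measurable_fun setT (fun z : T * T => u z.1) by exact: measurableT_comp.
have m2 : measurable_fun setT (fun z : T * T => u z.2) by exact: measurableT_comp.
have mB : measurable_fun setT (fun z : T * T => u z.1 - u z.2)%R.
  exact: measurable_funB.
by apply: measurableT_comp mB.
Qed.

Lemma mu_vol A : mu A < +oo -> mu A = (vol A)%:E.
Proof. by move=> Af; rewrite /vol fineK// ge0_fin_numE. Qed.

Lemma integral_cst_leb A (c : R) : measurable A -> mu A < +oo ->
  \int[mu]_(x in A) c%:E = (c * vol A)%:E.
Proof. by move=> mA /mu_vol H; rewrite EFinM -H; exact: integral_cst. Qed.

(** Jensen's inequality, obtained by integrating the tangent line inequality at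
    [`|t - avg A|]. *)
Lemma jensen_powR A (t : R) : measurable A -> mu A < +oo -> (0 < vol A)%R ->
  mu.-integrable A (EFin \o u) ->
  (vol A * `|t - avg A| `^ q)%:E <= \int[mu]_(y in A) (`|t - u y| `^ q)%:E.
Proof.
move=> mA Af a0 iu.
have muA := mu_vol Af.
have mtu : measurable_fun setT (fun y => t - u y)%R.
  by apply: measurable_funB => //; exact: measurable_cst.
have m1 : measurable_fun A (fun y => `|t - u y|%:E).
  by apply: measurable_funTS; apply/measurable_EFinP; apply: measurableT_comp mtu.
have m2 : measurable_fun A (fun y => (`|t - u y| `^ q)%:E).
  by apply: measurable_funTS; apply/measurable_EFinP; exact: measurable_powR_norm.
have ic : mu.-integrable A (cst t%:E).
  apply/integrableP; split; first exact: measurable_cst.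
  by rewrite /= integral_cst_leb// ltry.
set b := `|t - avg A|%R.
have b0 : (0 <= b)%R by exact: normr_ge0.
have H1 : (vol A * b)%:E <= \int[mu]_(y in A) `|t - u y|%:E.
  have -> : (vol A * b)%:E = `|\int[mu]_(y in A) (t - u y)%:E|.
    have fu : \int[mu]_(y in A) (u y)%:E \is a fin_num.
      exact: (integrable_fin_num mA iu).
    have -> : \int[mu]_(y in A) (t - u y)%:E =
        \int[mu]_(y in A) t%:E - \int[mu]_(y in A) (u y)%:E.
      rewrite -(integralB mA ic iu); apply: eq_integral => y _.
      by rewrite EFinB.
    rewrite (integral_cst_leb t mA Af) -(fineK fu) -EFinB abse_EFin; congr EFin.
    set I := fine _; have -> : (t * vol A - I = vol A * (t - avg A))%R.
      by rewrite /avg -/I; field; rewrite gt_eqF.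
    by rewrite normrM gtr0_norm.
  apply: (le_trans (le_abse_integral _ mA _)).
    by apply: measurable_funTS; apply/measurable_EFinP.
  by apply: le_integral_nonneg => y _; rewrite ?abse_EFin.
set X := \int[mu]_(y in A) (`|t - u y| `^ q)%:E.
have qb0 : (0 <= q * b `^ (q - 1))%R.
  by apply: mulr_ge0; [exact: le_trans q1|exact: powR_ge0].
have H2 : (q * b `^ (q - 1))%:E * \int[mu]_(y in A) `|t - u y|%:E <=
    X + ((q - 1) * b `^ q * vol A)%:E.
  have -> : ((q - 1) * b `^ q * vol A)%:E =
      \int[mu]_(y in A) ((q - 1) * b `^ q)%:E.
    by rewrite (integral_cst_leb _ mA Af).
  rewrite /X -ge0_integralD; first last.
  - exact: measurable_cst.
  - by move=> y _; rewrite lee_fin mulr_ge0 ?powR_ge0// subr_ge0.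
  - exact: m2.
  - by move=> y _; rewrite lee_fin powR_ge0.
  - exact: mA.
  rewrite -ge0_integralZl_EFin; first last.
  - exact: qb0.
  - exact: m1.
  - by move=> y _; rewrite lee_fin.
  - exact: mA.
  apply: le_integral_nonneg => y _.
    by rewrite -EFinM lee_fin; apply: mulr_ge0 => //.
  by rewrite -EFinM -EFinD lee_fin powR_tangent.
have H3 : (q * b `^ q * vol A)%:E <= X + ((q - 1) * b `^ q * vol A)%:E.
  apply: le_trans H2.
  have -> : (q * b `^ q * vol A)%:E = (q * b `^ (q - 1))%:E * (vol A * b)%:E.
    rewrite -EFinM -(@mulr_powRB1 _ b q)//; last exact: lt_le_trans q1.
    by congr EFin; ring.
  by rewrite lee_wpmul2l.
have -> : (vol A * b `^ q)%:E = (q * b `^ q * vol A)%:E - ((q - 1) * b `^ q * vol A)%:E.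
  by rewrite -EFinB; congr EFin; ring.
by rewrite leeBlDr.
Qed.

Lemma meanE A : mu.-integrable A (EFin \o u) -> measurable A ->
  mean (EFin \o u) A = (avg A)%:E.
Proof.
move=> iu mA; rewrite /mean /avg EFinM fineK//.
exact: (integrable_fin_num mA iu).
Qed.

Lemma avg_osc_le A : measurable A -> mu A < +oo -> (0 < vol A)%R ->
  mu.-integrable A (EFin \o u) ->
  (vol A)%:E * \int[mu]_(x in A) (`|u x - avg A| `^ q)%:E <= dint A osc.
Proof.
move=> mA Af a0 iu.
rewrite -ge0_integralZl_EFin; first last.
- exact: ltW.
- apply: measurable_funTS; apply/measurable_EFinP; apply: measurable_powR_norm.
  by apply: measurable_funB => //; exact: measurable_cst.
- by move=> x _; rewrite lee_fin powR_ge0.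
- exact: mA.
apply: le_integral_nonneg => x _.
  by rewrite -EFinM lee_fin mulr_ge0 ?powR_ge0// ltW.
rewrite -EFinM; exact: jensen_powR.
Qed.

(** Converse to [avg_osc_le], for an arbitrary constant in place of the average,
    by the quasi-triangle inequality through [c]. *)
Lemma osc_avg_le A c : measurable A -> mu A < +oo -> (0 < vol A)%R ->
  dint A osc <=
  (2 `^ q * 2 * vol A)%:E * \int[mu]_(x in A) (`|u x - c| `^ q)%:E.
Proof.
move=> mA Af a0; set h := fun x => (`|u x - c| `^ q)%R.
have mh : measurable_fun setT h.
  apply: measurable_powR_norm.
  by apply: measurable_funB => //; exact: measurable_cst.
have m1 : jmeasurable (fun x y => h x) by exact: measurableT_comp mh _.
have m2 : jmeasurable (fun x y => h y) by exact: measurableT_comp mh _.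
have h0 x : (0 <= h x)%R by exact: powR_ge0.
apply: (@le_trans _ _ (dint A (fun x y => 2 `^ q * (h x + h y))%R)).
  apply: le_dint => x y _ _; first exact: osc_ge0.
  by rewrite /h [`|u y - c|%R]distrC; exact: powR_distD.
rewrite dintZ ?powR_ge0//; last 2 first.
- exact: measurable_funD.
- by move=> x y; rewrite addr_ge0.
rewrite (dintD mA m1 m2)//.
have E1 : dint A (fun x y => h x) = (vol A)%:E * \int[mu]_(x in A) (h x)%:E.
  rewrite -ge0_integralZl_EFin; first last.
  - exact: ltW.
  - by apply: measurable_funTS; apply/measurable_EFinP.
  - by move=> x _; rewrite lee_fin.
  - exact: mA.
  by apply: eq_integral => x _; rewrite (integral_cst_leb _ mA Af) mulrC EFinM.
rewrite (dint_swap mA m2)// E1.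
set I := \int[mu]_(x in A) _.
have I0 : 0 <= (vol A)%:E * I.
  rewrite mule_ge0 ?lee_fin ?(ltW a0)//.
  by apply: integral_ge0 => x _; rewrite lee_fin.
by rewrite -mulrA EFinM -muleA [(2 * vol A)%:E]EFinM -muleA mule_natl mule2n.
Qed.

(** If the double integral is finite then for some [x] the function [u x - u]
    has a finite q-th power integral, hence is integrable on the bounded set
    [A]. *)
Lemma integrable_of_osc A : measurable A -> mu A < +oo -> (0 < vol A)%R ->
  dint A osc < +oo -> mu.-integrable A (EFin \o u).
Proof.
move=> mA Af a0 If.
have mI := measurable_outer mA jmeasurable_osc osc_ge0.
set h := fun x => \int[mu]_(y in A) (osc x y)%:E.
have h0 x : 0 <= h x by apply: inner_ge0 => *; exact: osc_ge0.
(* Otherwise the outer integrand is infinite on a set of positive measure. *)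
have [x hx] : exists x, h x < +oo.
  apply: contrapT => /forallNP H.
  have : dint A osc = +oo.
    rewrite /dint (eq_integral (cst +oo)).
      rewrite integral_cst//; apply: gt0_mulye.
      by rewrite [ltRHS](mu_vol Af) lte_fin.
    move=> x _; apply/eqP; rewrite -leye_eq leNgt; apply/negP; exact: H.
  by move=> E; rewrite E in If.
apply/integrableP; split; first by apply: measurable_funTS; apply/measurable_EFinP.
apply: (@le_lt_trans _ _ (\int[mu]_(y in A) ((`|u x| + 1)%:E + (osc x y)%:E))).
  apply: le_integral_nonneg => y _; first exact: abse_ge0.
  rewrite /= -EFinD lee_fin /osc.
  have H : (`|u x - u y| <= 1 + `|u x - u y| `^ q)%R.
    have [l1|l1] := leP `|u x - u y|%R 1%R.
      by rewrite (le_trans l1)// lerDl powR_ge0.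
    by rewrite (@le_trans _ _ (`|u x - u y| `^ q))%R ?lerDr// le1r_powR// ltW.
  by have := ler_distD (u x) (u y) 0%R; rewrite !subr0 distrC => ?; lra.
rewrite ge0_integralD; first last.
- exact: (measurable_inner _ mA jmeasurable_osc).
- by move=> y _; rewrite lee_fin osc_ge0.
- exact: measurable_cst.
- by move=> y _; rewrite lee_fin addr_ge0.
- exact: mA.
by rewrite (integral_cst_leb _ mA Af); apply: lte_add_pinfty => //; rewrite ltry.
Qed.

End Averages.

(** * Comparison of the Euclidean and dyadic kernels with the mean oscillation *)

Section KernelComparison.
Local Open Scope ereal_scope.
Context (R : realType) (n : nat) (q : R) (q1 : (1 <= q)%R).
Local Notation T := (lebesgueRn R n).
Local Notation mu := (@leb R n).
Implicit Types (Q S : set T) (l r s : R).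

Lemma cube_measure l Q : (0 <= l)%R -> cube l Q ->
  measurable Q /\ mu Q = (l ^+ n)%:E.
Proof.
move=> l0 [a [bl [br ->]]].
have ab i : (a 0%R i <= a 0%R i + l)%R by rewrite lerDl.
have [mQ ->] := leb_itv_box bl br ab; split; first exact: mQ.
congr EFin; rewrite (eq_bigr (fun=> l)); last by move=> i _; ring.
by rewrite prodr_const card_ord.
Qed.

Lemma cube_dist l Q (x y : 'rV[R]_n) i : cube l Q -> Q x -> Q y ->
  (`|x 0%R i - y 0%R i| <= l)%R.
Proof.
move=> [a [bl [br ->]]] /= /(_ i) + /(_ i); rewrite !itv_boundlr /=.
move=> /andP[/lteifW ax /lteifW xb] /andP[/lteifW ay /lteifW yb].
by rewrite ler_norml; apply/andP; split; lra.
Qed.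

Lemma cell_cube (k : int) (v : 'rV[int]_n) : cube ((2 : R) ^ (- k))%R (cell k v).
Proof.
exists (\row_i (2 ^ (- k) * (v 0 i)%:~R))%R, (fun=> true), (fun=> true).
by rewrite cellE; apply/seteqP; split => x /= H i; have := H i; rewrite /= !mxE.
Qed.

Lemma integral_cst_fin Q (c : \bar R) (m : R) : measurable Q -> mu Q = m%:E ->
  \int[mu]_(x in Q) c = c * m%:E.
Proof. by move=> mQ <-; exact: integral_cst. Qed.

Lemma integral_bool_le Q S (b : T -> bool) : measurable Q -> measurable S ->
  (forall z, Q z -> b z -> S z) ->
  \int[mu]_(z in Q) ((b z)%:R)%:E <= mu S.
Proof.
move=> mQ mS bS.
apply: (@le_trans _ _ (\int[mu]_(z in Q) (\1_S z)%:E)).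
  apply: le_integral_nonneg => z Qz; first by rewrite lee_fin.
  rewrite lee_fin indicE; case: (boolP (b z)) => // bz.
  by rewrite mem_set//; exact: bS.
rewrite integral_indic//; apply: le_measure; rewrite ?inE//.
exact: measurableI.
Qed.

Lemma integral_close_le Q r x : measurable Q -> (0 <= r)%R ->
  \int[mu]_(z in Q) ((sup_close r x z)%:R)%:E <= ((2 * r) ^+ n)%:E.
Proof.
move=> mQ r0; have [mS <-] := @leb_close_set R n r x r0.
by apply: integral_bool_le.
Qed.

Variables (u : T -> R) (mu_u : measurable_fun setT u).

Definition eucl_energy s Q := dint Q (fun x y : T =>
  (osc q u x y * (eucl ((x : 'rV[R]_n) - y) `^ s)^-1)%R).

Definition delta_energy s Q := dint Q (fun x y : T =>
  (osc q u x y * (fine (delta x y) `^ s)^-1)%R).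

Lemma osc_diag x : osc q u x x = 0%R.
Proof. by rewrite /osc subrr normr0 powR0// gt_eqF// (lt_le_trans _ q1). Qed.

Lemma jmeasurable_osc_eucl s : jmeasurable (fun x y : T =>
  (osc q u x y * (eucl ((x : 'rV[R]_n) - y) `^ s)^-1)%R).
Proof.
apply: measurable_funM; first exact: jmeasurable_osc.
exact: jmeasurable_eucl.
Qed.

Lemma osc_eucl_ge0 s (x y : T) :
  (0 <= osc q u x y * (eucl ((x : 'rV[R]_n) - y) `^ s)^-1)%R.
Proof. by rewrite mulr_ge0 ?osc_ge0// invr_ge0 powR_ge0. Qed.

(** A third point [z] is inserted between [x] and [y] and averaged over the
    points of the cube far from both, which fill at least half of it. *)
Lemma osc_le_far l Q : (0 < n)%N -> (0 < l)%R -> cube l Q ->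
  dint Q (osc q u) <= (4 * 2 `^ q)%:E *
    dint Q (fun x z => osc q u x z * (~~ sup_close (l / 8) x z)%:R)%R.
Proof.
move=> n0 l0 cQ; have [mQ muQ] := cube_measure (ltW l0) cQ.
have volQ : vol Q = (l ^+ n)%R by rewrite /vol [mu Q]muQ.
have fQ : mu Q < +oo by rewrite [ltLHS]muQ ltry.
have ln0 : (0 < l ^+ n)%R by rewrite exprn_gt0.
set h := fun x z => (osc q u x z * (~~ sup_close (l / 8) x z)%:R)%R.
have h0 x z : (0 <= h x z)%R by rewrite mulr_ge0 ?osc_ge0.
have mc : jmeasurable (fun x z : T => (sup_close (l / 8) x z)%:R%R).
  exact: jmeasurable_close.
have mh : jmeasurable h.
  apply: measurable_funM; first exact: jmeasurable_osc.
  rewrite (_ : (fun z : T * T => _) =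
     (fun z : T * T => 1 - (sup_close (l / 8) z.1 z.2)%:R)%R).
    by apply: measurable_funB => //; exact: measurable_cst.
  by apply/funext => z; case: sup_close => /=; rewrite ?subrr ?subr0.
pose H x := \int[mu]_(z in Q) (h x z)%:E.
have H0 x : 0 <= H x by exact: inner_ge0.
have K (x y : T) : ((l ^+ n / 2) * osc q u x y)%:E <= (2 `^ q)%:E * (H x + H y).
  set A := osc q u x y; have A0 : (0 <= A)%R by exact: osc_ge0.
  (* The cube of half-edge l / 8 around w has volume (l / 4) ^ n, at most a quarter of
     the volume of Q, so at most half of Q is close to x or to y. *)
  have small (w : T) : \int[mu]_(z in Q) ((sup_close (l / 8) w z)%:R)%:E <=
      (l ^+ n / 4)%:E.
    apply: (le_trans (integral_close_le _ mQ _)); first by rewrite divr_ge0 ?ltW.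
    rewrite lee_fin.
    have -> : (2 * (l / 8) = l * 4^-1)%R by field.
    rewrite exprMn ler_wpM2l ?(ltW ln0)// -[leRHS]expr1 ler_wiXn2l//.
    by rewrite invf_le1// ler1n.
  have m1 (w : T) : measurable_fun Q (fun z => (A * (sup_close (l / 8) w z)%:R)%:E).
    apply: measurable_funTS; apply/measurable_EFinP; apply: measurable_funM.
      exact: measurable_cst.
    exact: jmeasurable_right mc.
  have I1 : (A * l ^+ n)%:E <= (A * (l ^+ n / 2))%:E + (2 `^ q)%:E * (H x + H y).
    apply: (@le_trans _ _ (\int[mu]_(z in Q)
       (((A * (sup_close (l / 8) x z)%:R)%:E + (A * (sup_close (l / 8) y z)%:R)%:E) +
        (2 `^ q)%:E * ((h x z)%:E + (h y z)%:E)))).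
      rewrite -volQ -(integral_cst_leb A mQ fQ).
      apply: le_integral_nonneg => z _; first by rewrite lee_fin.
      rewrite -[leRHS]/((A * (sup_close (l / 8) x z)%:R + A * (sup_close (l / 8) y z)%:R
        + 2 `^ q * (h x z + h y z))%:E) lee_fin /h.
      have [cx|cx] := boolP (sup_close _ x z).
        rewrite mulr1 -addrA lerDl addr_ge0 ?mulr_ge0 ?powR_ge0 ?addr_ge0//.
        - by rewrite mulr0.
        - by rewrite mulr_ge0 ?osc_ge0.
      have [cy|cy] := boolP (sup_close _ y z).
        rewrite mulr1 mulr0 add0r lerDl mulr_ge0 ?powR_ge0// addr_ge0//.
        - by rewrite mulr_ge0 ?osc_ge0.
        - by rewrite mulr0.
      rewrite !mulr0 !mulr1 !add0r /A (oscC _ _ y z); exact: powR_distD.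
    rewrite ge0_integralD; first last.
    - apply: measurable_funeM; apply: emeasurable_funD;
        exact: (measurable_inner _ mQ mh).
    - by move=> z _; rewrite -EFinD -EFinM lee_fin mulr_ge0 ?powR_ge0 ?addr_ge0.
    - by apply: emeasurable_funD; exact: m1.
    - by move=> z _; rewrite -EFinD lee_fin addr_ge0 ?mulr_ge0.
    - exact: mQ.
    apply: leeD.
      rewrite ge0_integralD; first last.
      - exact: m1.
      - by move=> z _; rewrite lee_fin mulr_ge0.
      - exact: m1.
      - by move=> z _; rewrite lee_fin mulr_ge0.
      - exact: mQ.
      have half (w : T) : \int[mu]_(z in Q) (A * (sup_close (l / 8) w z)%:R)%:E <=
          (A * (l ^+ n / 4))%:E.
        rewrite EFinM; apply: (le_trans _ (lee_wpmul2l _ (small w))); last by rewrite lee_fin.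
        rewrite -ge0_integralZl_EFin; first last.
        - exact: A0.
        - exact: (measurable_inner _ mQ mc).
        - by move=> z _; rewrite lee_fin.
        - exact: mQ.
        by apply: le_integral_nonneg => z _; rewrite ?EFinM// lee_fin mulr_ge0.
      apply: (le_trans (leeD (half x) (half y))).
      by rewrite -EFinD lee_fin le_eqVlt; apply/orP; left; apply/eqP; field.
    rewrite ge0_integralZl_EFin; first last.
    - exact: powR_ge0.
    - by apply: emeasurable_funD; exact: (measurable_inner _ mQ mh).
    - by move=> z _; rewrite -EFinD lee_fin addr_ge0.
    - exact: mQ.
    rewrite ge0_integralD; first last.
    - exact: (measurable_inner _ mQ mh).
    - by move=> z _; rewrite lee_fin.
    - exact: (measurable_inner _ mQ mh).
    - by move=> z _; rewrite lee_fin.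
    - exact: mQ.
    by [].
  have -> : (l ^+ n / 2 * A)%:E = (A * l ^+ n)%:E - (A * (l ^+ n / 2))%:E.
    by rewrite -EFinB; congr EFin; field.
  by rewrite leeBlDl.
have mH : measurable_fun Q H by exact: (measurable_outer mQ mh h0).
have HI : \int[mu]_(x in Q) H x = dint Q h by [].
have c0 : (0 <= l ^+ n / 2)%R by rewrite divr_ge0 ?ltW.
suff E : (l ^+ n / 2)%:E * dint Q (osc q u) <=
    (l ^+ n / 2)%:E * ((4 * 2 `^ q)%:E * dint Q h).
  by move: E; rewrite lee_pmul2l// lte_fin divr_gt0.
rewrite -dintZ//; last 2 first.
- exact: jmeasurable_osc.
- by move=> x y; exact: osc_ge0.
have -> : (l ^+ n / 2)%:E * ((4 * 2 `^ q)%:E * dint Q h) =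
    \int[mu]_(x in Q) \int[mu]_(y in Q) ((2 `^ q)%:E * (H x + H y)).
  have E1 x : \int[mu]_(y in Q) ((2 `^ q)%:E * (H x + H y)) =
      (2 `^ q)%:E * ((l ^+ n)%:E * H x + dint Q h).
    rewrite ge0_integralZl_EFin; first last.
    - exact: powR_ge0.
    - by apply: emeasurable_funD; [exact: measurable_cst|exact: mH].
    - by move=> z _; rewrite adde_ge0.
    - exact: mQ.
    rewrite ge0_integralD; first last.
    - exact: mH.
    - by move=> z _.
    - exact: measurable_cst.
    - by move=> z _.
    - exact: mQ.
    by rewrite HI (integral_cst_fin _ mQ muQ) [H x * _]muleC.
  under [RHS]eq_integral do rewrite E1.
  rewrite ge0_integralZl_EFin; first last.
  - exact: powR_ge0.
  - by apply: emeasurable_funD; [exact: measurable_funeM|exact: measurable_cst].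
  - by move=> z _; rewrite adde_ge0 ?mule_ge0 ?lee_fin ?(ltW ln0)//; exact: dint_ge0.
  - exact: mQ.
  rewrite ge0_integralD; first last.
  - exact: measurable_cst.
  - by move=> z _; exact: dint_ge0.
  - exact: measurable_funeM.
  - by move=> z _; rewrite mule_ge0 ?lee_fin ?(ltW ln0).
  - exact: mQ.
  rewrite ge0_integralZl_EFin; first last.
  - exact: ltW.
  - exact: mH.
  - by move=> z _.
  - exact: mQ.
  rewrite HI (integral_cst_fin _ mQ muQ) [dint Q h * _]muleC.
  rewrite -mule2n -mule_natl !muleA -!EFinM.
  by congr (_%:E * _); field.
apply: le_integral_nonneg => x Qx.
  by apply: integral_ge0 => y _; rewrite lee_fin mulr_ge0 ?osc_ge0.
apply: le_integral_nonneg => y Qy; first by rewrite lee_fin mulr_ge0 ?osc_ge0.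
exact: K.
Qed.

(** For [s >= 0] the kernel is bounded below because the cube is bounded. For [s
    < 0] it vanishes on the diagonal, and [osc_le_far] discards the pairs near
    the diagonal. *)
Lemma osc_le_eucl s : (0 < n)%N -> exists2 K : R, (0 < K)%R &
  forall l Q, (0 < l)%R -> cube l Q ->
    dint Q (osc q u) <= (K * l `^ s)%:E * eucl_energy s Q.
Proof.
move=> n0; have [s0|s0] := leP 0%R s.
  have K0 : (0 < Num.sqrt n%:R :> R)%R by rewrite sqrtr_gt0 ltr0n.
  exists (Num.sqrt n%:R `^ s)%R; first exact: powR_gt0.
  move=> l Q l0 cQ; have [mQ muQ] := cube_measure (ltW l0) cQ.
  rewrite -(powRM _ (ltW K0) (ltW l0)) /eucl_energy -dintZ ?powR_ge0//; last 2 first.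
  - exact: jmeasurable_osc_eucl.
  - by move=> x y; exact: osc_eucl_ge0.
  apply: le_dint => x y Qx Qy; first exact: osc_ge0.
  have [->|xy] := eqVneq x y; first by rewrite osc_diag mul0r mulr0.
  have e0 : (0 < eucl ((x : 'rV[R]_n) - y))%R by rewrite eucl_gt0// subr_eq0.
  rewrite mulrCA ler_peMr ?osc_ge0// ler_pdivlMr ?powR_gt0// mul1r.
  apply: ge0_ler_powR; rewrite ?nnegrE ?eucl_ge0 ?mulr_ge0 ?(ltW K0) ?(ltW l0)//.
  apply: eucl_le; last exact: ltW.
  by move=> i; rewrite !mxE; exact: cube_dist cQ Qx Qy.
have K0 : (0 < 4 * 2 `^ q * 8^-1 `^ s :> R)%R by rewrite !mulr_gt0 ?powR_gt0.
exists (4 * 2 `^ q * 8^-1 `^ s)%R => // l Q l0 cQ.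
have [mQ muQ] := cube_measure (ltW l0) cQ.
apply: (le_trans (osc_le_far n0 l0 cQ)).
have E : (4 * 2 `^ q * 8^-1 `^ s * l `^ s = 4 * 2 `^ q * (8^-1 * l) `^ s)%R.
  by rewrite (powRM _ _ (ltW l0)) ?invr_ge0// mulrA.
rewrite E (EFinM _ ((8^-1 * l) `^ s)) -[leRHS]muleA.
apply: lee_wpmul2l; first by rewrite lee_fin mulr_ge0 ?powR_ge0.
rewrite /eucl_energy -dintZ ?powR_ge0//; last 2 first.
- exact: jmeasurable_osc_eucl.
- by move=> x y; exact: osc_eucl_ge0.
apply: le_dint => x y Qx Qy; first by rewrite mulr_ge0 ?osc_ge0.
case: (boolP (sup_close _ x y)) => [_|/eucl_ge_not_close H]; rewrite /= ?mulr0 ?mulr1.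
  by rewrite mulr_ge0 ?powR_ge0 ?osc_eucl_ge0.
have l8 : (0 < 8^-1 * l)%R by rewrite mulr_gt0.
rewrite mulrCA ler_peMr ?osc_ge0// ler_pdivlMr; last first.
  by rewrite powR_gt0// (lt_le_trans l8)// mulrC.
rewrite mul1r -(opprK s) powRN [leRHS]powRN lef_pV2 ?posrE ?powR_gt0//; last first.
  by rewrite (lt_le_trans l8)// mulrC.
apply: ge0_ler_powR; rewrite ?nnegrE ?eucl_ge0 ?(ltW l8) ?oppr_ge0 ?(ltW s0)//.
by rewrite mulrC.
Qed.

(** For [s >= 0] since the Euclidean distance is at most a multiple of the
    dyadic one. For [s < 0] the dyadic kernel is bounded by a power of the edge
    length, and the remaining mean oscillation is controlled by [osc_le_eucl]. *)
Lemma delta_le_eucl s : (0 < n)%N -> exists2 K : R, (0 < K)%R &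
  forall (k : int) (v : 'rV[int]_n),
    delta_energy s (cell k v) <= K%:E * eucl_energy s (cell k v).
Proof.
move=> n0; have [s0|s0] := leP 0%R s.
  have K0 : (0 < Num.sqrt n%:R :> R)%R by rewrite sqrtr_gt0 ltr0n.
  exists (Num.sqrt n%:R `^ s)%R; first exact: powR_gt0.
  move=> k v; rewrite /eucl_energy -dintZ ?powR_ge0//; last 3 first.
  - exact: measurable_cell.
  - exact: jmeasurable_osc_eucl.
  - by move=> x y; exact: osc_eucl_ge0.
  apply: le_dint => x y Qx Qy.
    by rewrite mulr_ge0 ?osc_ge0// invr_ge0 powR_ge0.
  have [->|xy] := eqVneq x y; first by rewrite osc_diag !mul0r mulr0.
  have xyk : cell_index k x = cell_index k y by rewrite Qx Qy.
  have e0 : (0 < eucl ((x : 'rV[R]_n) - y))%R by rewrite eucl_gt0// subr_eq0.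
  have d0 := delta_gt0 xy xyk.
  rewrite mulrCA ler_wpM2l ?osc_ge0// ler_pdivlMr ?powR_gt0// mulrC.
  rewrite ler_pdivrMr ?powR_gt0// -(powRM _ (ltW K0) (ltW d0)).
  apply: ge0_ler_powR; rewrite ?nnegrE ?eucl_ge0 ?mulr_ge0 ?(ltW K0) ?(ltW d0)//.
  exact: eucl_le_delta xyk.
have [K K0 HK] := osc_le_eucl s n0.
exists K => // k v; set Q := cell k v.
have l0 := pow2_gt0 R (- k).
have cQ : cube (2 ^ (- k)) Q by exact: cell_cube.
have [mQ _] := cube_measure (ltW l0) cQ.
apply: (@le_trans _ _ (((2 ^ (- k)) `^ s)^-1%:E * dint Q (osc q u))).
  rewrite -dintZ ?invr_ge0 ?powR_ge0//; last 2 first.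
  - exact: jmeasurable_osc.
  - by move=> x y; exact: osc_ge0.
  apply: le_dint => x y Qx Qy.
    by rewrite mulr_ge0 ?osc_ge0// invr_ge0 powR_ge0.
  rewrite mulrC ler_wpM2r ?osc_ge0//.
  have xyk : cell_index k x = cell_index k y by rewrite Qx Qy.
  rewrite -!powRN; apply: ge0_ler_powR;
    rewrite ?nnegrE ?fine_delta_ge0 ?oppr_ge0 ?(ltW s0) ?(ltW l0)//.
  exact: fine_delta_le.
apply: (le_trans (lee_wpmul2l _ (HK _ _ l0 cQ))).
  by rewrite lee_fin invr_ge0 powR_ge0.
rewrite muleA -EFinM mulrCA mulVf ?mulr1//.
by rewrite gt_eqF// powR_gt0.
Qed.

End KernelComparison.

(** * A weighted recursion *)

Section WeightedRecursion.
Context (R : realType) (v b Z : nat -> R) (rho gamma : R).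
Hypotheses (v0 : forall k, 0 <= v k) (b0 : forall k, 0 <= b k).
Hypotheses (Z0 : forall k, 0 <= Z k) (rho0 : 0 <= rho) (gamma0 : 0 <= gamma).
Hypotheses (bS : forall k, b k.+1 = gamma * b k).
Hypotheses (Z0E : Z 0 = v 0%N + v 1%N).
Hypotheses (ZS : forall k, Z k.+1 = rho / 2 * Z k + (v k.+1 + v k.+2)).
Hypothesis theta1 : rho / 2 * gamma < 1.

(** [Z] is a discounted sum of past values of [v] with ratio [rho / 2], while
    the weights grow with ratio [gamma]; the weighted sum is controlled when the
    product of the two ratios is less than 1. *)
Lemma sum_weighted_recursion N :
  \sum_(k < N) b k * (v k.+1 + Z k) <=
  (1 + (1 - rho / 2 * gamma)^-1 * (1 + gamma)) *
  (b 0 * v 0 + \sum_(k < N) b k * v k.+1).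
Proof.
set theta := rho / 2 * gamma.
have t0 : 0 <= theta by rewrite !mulr_ge0.
have t1 : 0 < 1 - theta by rewrite subr_gt0; exact: theta1.
set S := \sum_(k < N) b k * v k.+1.
have S0 : 0 <= S by rewrite sumr_ge0// => k _; rewrite mulr_ge0.
have bv0 : 0 <= b 0%N * v 0%N by rewrite mulr_ge0.
have zle : (1 - theta) * \sum_(k < N) b k * Z k <=
    \sum_(k < N) b k * (v k + v k.+1).
  rewrite mulrBl mul1r lerBlDl; case: N @S S0 => [|N] S S0.
    by rewrite !big_ord0 mulr0 addr0.
  rewrite [X in X <= _]big_ord_recl [X in _ <= _ + X]big_ord_recl Z0E addrCA lerD2l.
  apply: (@le_trans _ _ (theta * \sum_(k < N) b k * Z k +
    \sum_(k < N) b k.+1 * (v k.+1 + v k.+2))).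
    rewrite mulr_sumr -big_split /=; apply: ler_sum => k _.
    by rewrite /bump /= add1n ZS bS /theta; rewrite le_eqVlt; apply/orP; left; apply/eqP; ring.
  rewrite lerD2r ler_wpM2l// big_ord_recr /=.
  by rewrite lerDl mulr_ge0.
have sle : \sum_(k < N) b k * v k <= b 0%N * v 0%N + gamma * S.
  rewrite /S; case: N @S S0 zle => [|N] S S0 zle.
    by rewrite !big_ord0 mulr0 addr0.
  rewrite big_ord_recl lerD2l big_ord_recr /= mulrDr mulr_sumr.
  rewrite -[leLHS]addr0 lerD ?mulr_ge0//.
  by apply: ler_sum => k _; rewrite /bump /= add1n bS mulrA.
have -> : \sum_(k < N) b k * (v k.+1 + Z k) = S + \sum_(k < N) b k * Z k.
  by rewrite -big_split /=; apply: eq_bigr => k _; rewrite mulrDr.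
have wE : \sum_(k < N) b k * (v k + v k.+1) = \sum_(k < N) b k * v k + S.
  by rewrite -big_split /=; apply: eq_bigr => k _; rewrite mulrDr.
have zle2 : \sum_(k < N) b k * Z k <=
    (1 - theta)^-1 * (b 0%N * v 0%N + gamma * S + S).
  rewrite ler_pdivlMl// (le_trans zle)// wE lerD2r//.
rewrite mulrDl mul1r lerD ?lerDr//; apply: (le_trans zle2).
rewrite -mulrA ler_wpM2l ?invr_ge0 ?(ltW t1)//.
have := mulr_ge0 gamma0 bv0; rewrite mulrDl mul1r mulrDr; lra.
Qed.

End WeightedRecursion.

Lemma lty_of_pmule (R : realType) (a : R) (x : \bar R) : 0 < a ->
  (a%:E * x < +oo -> x < +oo)%E.
Proof. by move=> a0; case: x => [x| |]//; rewrite ?ltry// gt0_muley ?lte_fin. Qed.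

Lemma powR_dist3 (R : realType) (q a b c d : R) : 1 <= q ->
  `|a - d| `^ q <= 2 `^ q * 2 `^ q * (`|a - b| `^ q + `|d - c| `^ q + `|b - c| `^ q).
Proof.
move=> q1; have H1 := powR_distD a b d q1; have H2 := powR_distD b c d q1.
have H0 : 1 <= 2 `^ q :> R by apply/ltW/powR2_gt1; exact: lt_le_trans q1.
apply: (le_trans H1); rewrite -mulrA ler_wpM2l ?powR_ge0//.
rewrite [`|d - c|]distrC.
have H3 : `|a - b| `^ q <= 2 `^ q * `|a - b| `^ q by rewrite ler_peMl ?powR_ge0.
by apply: (le_trans (lerD H3 H2)); rewrite -mulrDr ler_wpM2l ?powR_ge0//; lra.
Qed.

Local Opaque avg.

(** * The energy of a block of cells *)

Section Block.
Local Open Scope ereal_scope.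
Context (R : realType) (n : nat) (n0 : (0 < n)%N) (q : R) (q1 : (1 <= q)%R).
Local Notation T := (lebesgueRn R n).
Local Notation mu := (@leb R n).
Variables (m : int) (v : 'rV[int]_n).
Local Notation r k := (scale R m k).

(** The union of 3 ^ n cells of level [m]. It contains every cube of edge at
    most two cells whose lower corner lies in the cell of index [v]. *)
Definition block : set T :=
  [set x : 'rV[R]_n | forall i, (v 0 i <= cell_index m x 0 i < v 0 i + 3)%R].
Local Notation B := block.

Lemma blockE : B = [set x : 'rV[R]_n | forall i, x 0%R i \in
  Interval (BSide true ((\row_j (r 0 * (v 0 j)%:~R)) 0 i)%R)
           (BSide true ((\row_j (r 0 * (v 0 j)%:~R)) 0 i + 3 * r 0)%R)].
Proof.
have E : ((2 ^ m)^-1 = r 0 :> R)%R by rewrite scaleE divr1.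
have p0 := pow2_gt0 R m.
have F (a : int) (z : R) :
    ((a <= Num.floor z < a + 3) = (a%:~R <= z < a%:~R + 3%:R))%R.
  by rewrite ltNge !floor_ge_int -ltNge intrD.
apply/seteqP; split => x /= H i; have := H i;
  by rewrite !mxE F in_itv /= -E [(3 * _)%R]mulrC -mulrDr ler_pdivrMl// ltr_pdivlMl.
Qed.

Lemma block_cube : cube (3 * r 0)%R B.
Proof. by rewrite blockE; exists (\row_j (r 0 * (v 0 j)%:~R))%R, (fun=> true), (fun=> true). Qed.

Lemma block_len_gt0 : (0 < 3 * r 0)%R.
Proof. by rewrite mulr_gt0// scale_gt0. Qed.

Lemma measurable_block : measurable B.
Proof. exact: (cube_measure (ltW block_len_gt0) block_cube).1. Qed.

Lemma leb_block : mu B = ((3 * r 0) ^+ n)%:E.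
Proof. exact: (cube_measure (ltW block_len_gt0) block_cube).2. Qed.

Lemma block_fin : mu B < +oo.
Proof. by rewrite leb_block ltry. Qed.

Lemma vol_block : vol B = ((3 * r 0) ^+ n)%R.
Proof. by rewrite /vol leb_block. Qed.

Lemma cell_sub_block k x : B x -> cell (m + k%:Z) (cell_index (m + k%:Z) x) `<=` B.
Proof.
move=> Bx y yx i; have -> : cell_index m y = cell_index m x; last exact: Bx.
by apply: cell_index_coarser yx; rewrite lerDl.
Qed.

Variables (u : T -> R) (mu_u : measurable_fun setT u).
Hypothesis osc_fin : dint B (osc q u) < +oo.

Let iuB : mu.-integrable B (EFin \o u).
Proof.
apply: (integrable_of_osc q1 mu_u measurable_block block_fin _ osc_fin).
by rewrite vol_block exprn_gt0// block_len_gt0.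
Qed.

(** Stage 0 averages over the whole block and stage [k + 1] over the cells of
    level [m + k], so that the first passage joins the cells of the block. *)
Definition stage_avg (t : nat) (x : T) : R :=
  if t is k.+1 then avg u (cell (m + k%:Z) (cell_index (m + k%:Z) x)) else avg u B.

Definition same_stage (t : nat) (x y : T) : bool :=
  if t is k.+1 then cell_index (m + k%:Z) x == cell_index (m + k%:Z) y else true.

Lemma stage_avg_same t x y : same_stage t x y -> stage_avg t x = stage_avg t y.
Proof. by case: t => //= t /eqP ->. Qed.

Lemma same_stageC t x y : same_stage t x y = same_stage t y x.
Proof. by case: t => //= t; rewrite eq_sym. Qed.

Lemma measurable_stage_avg t : measurable_fun setT (stage_avg t).
Proof.
case: t => [|t]; first exact: measurable_cst.
exact: (@measurable_cell_index_fun _ _ _ (fun w => avg u (cell (m + t%:Z) w))).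
Qed.

Lemma jmeasurable_same_stage t : jmeasurable (fun x y => (same_stage t x y)%:R%R).
Proof.
case: t => [|t]; first exact: measurable_cst.
exact: (@jmeasurable_cell_index R n (m + t%:Z) (fun w w' => (w == w')%:R%R)).
Qed.

Lemma jmeasurable_not_same_stage t :
  jmeasurable (fun x y => (~~ same_stage t x y)%:R%R).
Proof.
case: t => [|t]; first exact: measurable_cst.
exact: (@jmeasurable_cell_index R n (m + t%:Z) (fun w w' => (w != w')%:R%R)).
Qed.

Definition stage_dev t : \bar R :=
  \int[mu]_(x in B) (`|u x - stage_avg t x| `^ q)%:E.

Lemma measurable_stage_dev t :
  measurable_fun setT (fun x => `|u x - stage_avg t x| `^ q)%R.
Proof.
apply: measurable_powR_norm; apply: measurable_funB; first exact: mu_u.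
exact: measurable_stage_avg.
Qed.

Lemma stage_dev_ge0 t : 0 <= stage_dev t.
Proof. by apply: integral_ge0 => x _; rewrite lee_fin powR_ge0. Qed.

Lemma stage_dev0_le : ((3 * r 0) ^+ n)%:E * stage_dev 0 <= dint B (osc q u).
Proof.
rewrite -vol_block; apply: avg_osc_le => //.
- exact: measurable_block.
- exact: block_fin.
- by rewrite vol_block exprn_gt0// block_len_gt0.
Qed.

(** Jensen's inequality on each cell; it ties the deviation from the averages to
    pairs that lie in a common cell, that is to the dyadic kernel. *)
Lemma stage_devS_le t : ((r t) ^+ n)%:E * stage_dev t.+1 <=
  dint B (fun x y => osc q u x y * (same_stage t.+1 x y)%:R)%R.
Proof.
have rt0 : (0 < r t ^+ n)%R by rewrite exprn_gt0// scale_gt0.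
rewrite -ge0_integralZl_EFin; first last.
- exact: ltW.
- by apply: measurable_funTS; apply/measurable_EFinP; exact: measurable_stage_dev.
- by move=> x _; rewrite lee_fin powR_ge0.
- exact: measurable_block.
apply: le_integral_nonneg => x Bx.
  by rewrite -EFinM lee_fin mulr_ge0 ?powR_ge0// ltW.
pose A : set T := cell (m + t%:Z) (cell_index (m + t%:Z) x).
have AB : A `<=` B by exact: cell_sub_block.
have mA : measurable (A : set T) by exact: measurable_cell.
have muA : mu A = (r t ^+ n)%:E by exact: leb_cell.
have Af : mu A < +oo by rewrite muA ltry.
have volA : vol A = (r t ^+ n)%R by rewrite /vol muA.
have iuA : mu.-integrable A (EFin \o u).
  exact: integrableS measurable_block mA AB iuB.
rewrite -EFinM -volA /=.
apply: (le_trans (@jensen_powR R n q q1 u mu_u A (u x) mA Af _ iuA)).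
  by rewrite volA.
rewrite integral_mkcond [leRHS]integral_mkcond.
apply: le_integral_nonneg => y _; rewrite !patchE.
  by case: ifP => // _; rewrite lee_fin powR_ge0.
case: ifPn => yA.
  rewrite ifT; last by rewrite inE; apply: AB; rewrite inE in yA.
  rewrite inE in yA; rewrite lee_fin /osc.
  by have -> : cell_index (m + t%:Z) x == cell_index (m + t%:Z) y;
    [rewrite yA|rewrite mulr1].
by case: ifP => // _; rewrite lee_fin mulr_ge0 ?osc_ge0.
Qed.

Definition in_slab (t : nat) (e : R) (bi : bool * 'I_n) (x : T) : bool :=
  x \in slab (m + t%:Z) (cell_index (m + t%:Z) x) e bi.1 bi.2.

Lemma measurable_in_slab t e bi : (0 <= e)%R ->
  measurable_fun setT (fun x => (in_slab t e bi x)%:R : R).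
Proof.
move=> e0; apply: measurable_natr_bool.
rewrite (_ : mkset _ = \bigcup_w (cell (m + t%:Z) w `&` slab (m + t%:Z) w e bi.1 bi.2)).
  apply: countable_bigcupT_measurable => [|w]; first exact: countableP.
  apply: measurableI; first exact: measurable_cell.
  exact: (leb_slab _ _ _ _ e0).1.
apply/seteqP; split => x /=.
  by rewrite /in_slab inE => H; exists (cell_index (m + t%:Z) x).
by move=> [w _ [/= <-]]; rewrite /in_slab inE.
Qed.

(** Two close points in different cells have a face of the cell of [x] between
    them. The ratio of the two scales is the relative thickness of the slab. *)
Lemma in_slab_of_close (t k : nat) x y : (t <= k)%N ->
  sup_close (r k) x y -> ~~ same_stage t.+1 x y ->
  exists bi, in_slab t ((2^-1) ^+ (k - t))%R bi x.
Proof.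
move=> tk /forallP cxy /= Nsame.
have [i Hi] : exists i, cell_index (m + t%:Z) x 0%R i != cell_index (m + t%:Z) y 0%R i.
  apply/existsP; apply: contraNT Nsame => /existsPn H.
  by apply/eqP/rowP => i; apply/eqP; have := H i; rewrite negbK.
set e := (_ ^+ _)%R.
have re : (r k = e * r t)%R.
  rewrite !scaleE /e mulrCA; congr (_ * _)%R.
  by rewrite exprVn -invfM -exprD subnK.
have rtE : (2 ^ (- (m + t%:Z)) = r t :> R)%R by [].
have p0 : (0 < r t)%R by exact: scale_gt0.
have Hx : cell (m + t%:Z) (cell_index (m + t%:Z) x) x by [].
have Hy : cell (m + t%:Z) (cell_index (m + t%:Z) y) y by [].
have := cxy i; rewrite re.
move: Hi Hx Hy; rewrite !cellE; set w := cell_index _ x; set w' := cell_index _ y.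
move=> wi Hx Hy ci.
have := Hx i; have := Hy i; rewrite /= !in_itv /= !rtE.
have e1 : (e <= 1)%R by rewrite exprn_ile1// ?invr_ge0// invf_le1// ler1n.
have slabP b : (if b then x 0%R i < r t * (w 0 i)%:~R + e * r t
    else r t * (w 0 i)%:~R + r t - e * r t <= x 0%R i)%R ->
    x \in slab (m + t%:Z) w e b i.
  move=> Hb; rewrite inE => j; have := Hx j; rewrite /= !in_itv /= !rtE.
  case: eqP => [->|_]; last by rewrite /= in_itv.
  by move=> /andP[H1 H2]; case: b Hb => /= Hb; rewrite in_itv /= ?H1 ?H2 ?Hb.
move=> /andP[y1 y2] /andP[x1 x2].
move: ci; rewrite ltr_norml => /andP[c1 c2].
have [ww|ww|E] := ltgtP (w 0%R i) (w' 0%R i); last by rewrite E eqxx in wi.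
- exists (false, i); apply: slabP.
  have H : (r t * (w 0 i)%:~R + r t <= r t * (w' 0 i)%:~R)%R.
    rewrite -{2}(mulr1 (r t)) -mulrDr ler_pM2l//.
    by rewrite -[1%R]/(1%:~R)%R -intrD ler_int -ltzD1 ltrD2r.
  by move=> /=; lra.
- exists (true, i); apply: slabP.
  have H : (r t * (w' 0 i)%:~R + r t <= r t * (w 0 i)%:~R)%R.
    rewrite -{2}(mulr1 (r t)) -mulrDr ler_pM2l//.
    by rewrite -[1%R]/(1%:~R)%R -intrD ler_int -ltzD1 ltrD2r.
  by move=> /=; lra.
Qed.

(** On each cell [g] is constant, so the slab receives the fraction [e] of the
    integral. Tonelli's theorem with the kernel of pairs in a common cell avoids
    summing over the cells. *)
Lemma slab_share t e bi (g : T -> R) : (0 <= e)%R ->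
  measurable_fun setT g -> (forall x, 0 <= g x)%R ->
  (forall x y, same_stage t.+1 x y -> g x = g y) ->
  \int[mu]_(x in B) (g x * (in_slab t e bi x)%:R)%:E <=
  e%:E * \int[mu]_(x in B) (g x)%:E.
Proof.
move=> e0 mg g0 gsame.
have rt0 : (0 < r t ^+ n)%R by rewrite exprn_gt0// scale_gt0.
have mB := measurable_block.
have mS := measurable_in_slab t bi e0.
have mJ := jmeasurable_same_stage t.+1.
(* For x in the slab the integral over z returns g x times the volume of a cell;
   for fixed z the integral over x is the volume of a slab. *)
pose F x z := (g z * ((in_slab t e bi x)%:R * (same_stage t.+1 x z)%:R))%R.
have F0 x z : (0 <= F x z)%R by rewrite !mulr_ge0.
have mF : jmeasurable F.
  apply: measurable_funM; first exact: (measurableT_comp mg measurable_snd).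
  apply: measurable_funM; last exact: mJ.
  exact: (measurableT_comp mS measurable_fst).
suff H : ((r t) ^+ n)%:E * \int[mu]_(x in B) (g x * (in_slab t e bi x)%:R)%:E <=
    ((r t) ^+ n)%:E * (e%:E * \int[mu]_(x in B) (g x)%:E).
  by move: H; rewrite lee_pmul2l.
apply: (@le_trans _ _ (dint B F)).
  rewrite -ge0_integralZl_EFin; first last.
  - exact: ltW.
  - by apply: measurable_funTS; apply/measurable_EFinP; exact: measurable_funM.
  - by move=> x _; rewrite lee_fin mulr_ge0.
  - exact: mB.
  apply: le_integral_nonneg => x Bx.
    by rewrite -EFinM lee_fin !mulr_ge0// ltW.
  pose A : set T := cell (m + t%:Z) (cell_index (m + t%:Z) x).
  have AB : A `<=` B by exact: cell_sub_block.
  have mA : measurable (A : set T) by exact: measurable_cell.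
  have muA : mu A = (r t ^+ n)%:E by exact: leb_cell.
  rewrite muleC -(integral_cst_fin _ mA muA) integral_mkcond [leRHS]integral_mkcond.
  apply: le_integral_nonneg => z _; rewrite !patchE.
    by case: ifP => // _; rewrite lee_fin mulr_ge0.
  case: ifPn => zA; last by case: ifP => // _; rewrite lee_fin.
  rewrite inE in zA; rewrite ifT; last by rewrite inE; exact: AB.
  have sxz : same_stage t.+1 x z by rewrite /= zA.
  by rewrite lee_fin /F sxz mulr1 (gsame _ _ sxz).
rewrite (dint_swap mB mF F0) -!ge0_integralZl_EFin; first last.
- exact: e0.
- by apply: measurable_funTS; apply/measurable_EFinP.
- by move=> x _; rewrite lee_fin.
- exact: mB.
- exact: ltW.
- apply: measurable_funeM; by apply: measurable_funTS; apply/measurable_EFinP.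
- by move=> x _; rewrite -EFinM lee_fin mulr_ge0.
- exact: mB.
apply: le_integral_nonneg => z Bz.
  by apply: integral_ge0 => x _; rewrite lee_fin; exact: F0.
set w := cell_index (m + t%:Z) z.
have [mSl muSl] := @leb_slab R n (m + t%:Z) w e bi.1 bi.2 e0.
apply: (@le_trans _ _ ((g z)%:E * mu (slab (m + t%:Z) w e bi.1 bi.2))); last first.
  have -> : mu (slab (m + t%:Z) w e bi.1 bi.2) = (e * r t ^+ n)%:E by exact: muSl.
  by rewrite -!EFinM lee_fin le_eqVlt; apply/orP; left; apply/eqP; ring.
rewrite /F.
have mb x : measurable_fun B (fun y =>
      ((in_slab t e bi y)%:R * (same_stage t.+1 y x)%:R : R)%:E).
  apply: measurable_funTS; apply/measurable_EFinP; apply: measurable_funM.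
    exact: mS.
  rewrite (_ : (fun y => _) = (fun y => (same_stage t.+1 x y)%:R : R)).
    exact: (jmeasurable_right x mJ).
  by apply/funext => y; rewrite same_stageC.
under eq_integral do rewrite EFinM.
rewrite ge0_integralZl_EFin; first last.
- exact: g0.
- exact: mb.
- by move=> x _; rewrite lee_fin mulr_ge0.
- exact: mB.
apply: lee_wpmul2l; first by rewrite lee_fin.
rewrite (eq_integral (fun y => ((in_slab t e bi y && same_stage t.+1 y z)%:R)%:E)).
  apply: integral_bool_le => // x Bx /andP[]; rewrite /in_slab inE => + /eqP sxz.
  by rewrite sxz.
by move=> x _; rewrite -natrM mulnb.
Qed.

(** The decay in [k - t] is the point: a difference of averages over coarse
    cells is seen at a fine scale only near the faces, of which a cell has [2 *
    n]. *)
Lemma close_boundary_le (t k : nat) (g : T -> R) : (t <= k)%N ->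
  measurable_fun setT g -> (forall x, 0 <= g x)%R ->
  (forall x y, same_stage t.+1 x y -> g x = g y) ->
  dint B (fun x y => g x * ((~~ same_stage t.+1 x y)%:R * (sup_close (r k) x y)%:R))%R
  <= ((2 * r k) ^+ n * ((2 * n)%:R * (2^-1) ^+ (k - t)))%:E *
     \int[mu]_(x in B) (g x)%:E.
Proof.
move=> tk mg g0 gsame; set e := ((2^-1) ^+ (k - t) : R)%R.
have e0 : (0 <= e)%R by rewrite exprn_ge0// invr_ge0.
have mB := measurable_block.
have rk0 : (0 <= r k)%R by rewrite ltW// scale_gt0.
have c0 : (0 <= (2 * r k) ^+ n)%R by rewrite exprn_ge0// mulr_ge0.
have mC : jmeasurable (fun x y : T => (sup_close (r k) x y)%:R%R).
  exact: jmeasurable_close.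
pose G bi x y := (g x * (in_slab t e bi x)%:R * (sup_close (r k) x y)%:R)%R.
have G0 bi x y : (0 <= G bi x y)%R by rewrite !mulr_ge0.
have mgS bi : measurable_fun setT (fun x => g x * (in_slab t e bi x)%:R)%R.
  by apply: measurable_funM; [exact: mg|exact: measurable_in_slab].
have mG bi : jmeasurable (G bi).
  apply: measurable_funM; last exact: mC.
  exact: (measurableT_comp (mgS bi) measurable_fst).
apply: (@le_trans _ _ (dint B (fun x y => \sum_bi G bi x y)%R)).
  apply: le_dint => x y Bx By; first by rewrite !mulr_ge0.
  have [sxy|sxy] := boolP (same_stage t.+1 x y); rewrite ?mul0r ?mulr0 ?mul1r.
    by rewrite sumr_ge0.
  have [cxy|] := boolP (sup_close (r k) x y); last by rewrite mulr0 sumr_ge0.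
  have [bi Hbi] := in_slab_of_close tk cxy sxy.
  apply: (@le_trans _ _ (G bi x y)); first by rewrite /G Hbi cxy /= !mulr1.
  by rewrite (bigD1 bi)//= lerDl sumr_ge0.
rewrite (dint_sum _ _ mB mG G0).
apply: (@le_trans _ _ (\sum_(bi : bool * 'I_n) ((2 * r k) ^+ n * e)%:E *
    \int[mu]_(x in B) (g x)%:E)); last first.
  rewrite -ge0_sume_distrl; last by move=> bi _; rewrite lee_fin mulr_ge0.
  rewrite sumEFin sumr_const card_prod card_bool card_ord.
  rewrite le_eqVlt; apply/orP; left; apply/eqP; congr (_%:E * _).
  by rewrite -[LHS]mulr_natr -mulrA [(e * _)%R]mulrC.
apply: lee_sum => bi _.
rewrite EFinM -muleA; apply: (@le_trans _ _ (((2 * r k) ^+ n)%:E *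
   \int[mu]_(x in B) (g x * (in_slab t e bi x)%:R)%:E)); last first.
  by apply: lee_wpmul2l; [rewrite lee_fin|exact: slab_share].
rewrite -ge0_integralZl_EFin; first last.
- exact: c0.
- by apply: measurable_funTS; apply/measurable_EFinP.
- by move=> x _; rewrite lee_fin mulr_ge0.
- exact: mB.
apply: le_integral_nonneg => x Bx.
  by apply: integral_ge0 => y _; rewrite lee_fin; exact: G0.
rewrite /G; under eq_integral do rewrite EFinM.
rewrite ge0_integralZl_EFin; first last.
- by rewrite mulr_ge0.
- exact: (measurable_inner _ mB mC).
- by move=> y _; rewrite lee_fin.
- exact: mB.
rewrite muleC; apply: lee_wpmul2r; first by rewrite lee_fin mulr_ge0.
exact: integral_close_le.
Qed.

Variables (s rho M : R).
Hypotheses (s0 : (0 < s)%R) (rho0 : (0 <= rho)%R) (M0 : (0 <= M)%R).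
Hypothesis powRD_rho : forall a b : R, (0 <= a -> 0 <= b ->
  (a + b) `^ q <= rho * a `^ q + M * b `^ q)%R.

Definition stage_jump (t : nat) (x : T) : R :=
  (`|stage_avg t.+1 x - stage_avg t x| `^ q)%R.

Definition stage_gap (t : nat) (x y : T) : R :=
  (`|stage_avg t x - stage_avg t y| `^ q)%R.

Lemma same_stageS t x y : same_stage t.+1 x y -> same_stage t x y.
Proof.
case: t => //= t /eqP H; apply/eqP; apply: cell_index_coarser H.
by rewrite lerD2l lez_nat.
Qed.

Lemma stage_jump_same t x y : same_stage t.+1 x y -> stage_jump t x = stage_jump t y.
Proof.
move=> sxy; rewrite /stage_jump (stage_avg_same sxy).
by rewrite (stage_avg_same (same_stageS sxy)).
Qed.

Lemma measurable_stage_jump t : measurable_fun setT (stage_jump t).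
Proof.
apply: measurable_powR_norm.
by apply: measurable_funB; exact: measurable_stage_avg.
Qed.

Lemma jmeasurable_stage_gap t : jmeasurable (stage_gap t).
Proof.
apply: (measurableT_comp (measurable_powR _)).
have m1 : measurable_fun setT (fun z : T * T => stage_avg t z.1).
  exact: (measurableT_comp (measurable_stage_avg t) measurable_fst).
have m2 : measurable_fun setT (fun z : T * T => stage_avg t z.2).
  exact: (measurableT_comp (measurable_stage_avg t) measurable_snd).
have mB : measurable_fun setT (fun z : T * T => stage_avg t z.1 - stage_avg t z.2)%R.
  exact: measurable_funB m1 m2.
by apply: measurableT_comp mB.
Qed.

Lemma integral_stage_jump_le t :
  \int[mu]_(x in B) (stage_jump t x)%:E <=
  (2 `^ q)%:E * (stage_dev t + stage_dev t.+1).
Proof.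
have mV k : measurable_fun B (fun x => (`|u x - stage_avg k x| `^ q)%:E).
  by apply: measurable_funTS; apply/measurable_EFinP; exact: measurable_stage_dev.
rewrite /stage_dev -ge0_integralD; first last.
- exact: mV.
- by move=> x _; rewrite lee_fin powR_ge0.
- exact: mV.
- by move=> x _; rewrite lee_fin powR_ge0.
- exact: measurable_block.
rewrite -ge0_integralZl_EFin; first last.
- exact: powR_ge0.
- by apply: emeasurable_funD; exact: mV.
- by move=> x _; rewrite -EFinD lee_fin addr_ge0 ?powR_ge0.
- exact: measurable_block.
apply: le_integral_nonneg => x _; first by rewrite lee_fin powR_ge0.
rewrite -EFinD -EFinM lee_fin /stage_jump distrC.
by rewrite [X in (_ * (X `^ _ + _))%R]distrC; exact: powR_distD.
Qed.

(** Inside a cell the averages coincide; across cells the new gap is the old one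
    plus two jumps, and the old gap is charged with the factor [rho] only. *)
Lemma stage_gapS_le t x y :
  (stage_gap t.+1 x y <= (~~ same_stage t.+1 x y)%:R *
     (rho * stage_gap t x y + M * 2 `^ q * (stage_jump t x + stage_jump t y)))%R.
Proof.
have [sxy|sxy] := boolP (same_stage t.+1 x y).
  rewrite /stage_gap (stage_avg_same sxy) subrr normr0 powR0 ?mul0r//.
  by rewrite gt_eqF// (lt_le_trans _ q1).
rewrite mul1r /stage_gap; set a := stage_avg t.+1 x; set b := stage_avg t.+1 y.
set c := stage_avg t x; set d := stage_avg t y.
apply: (@le_trans _ _ ((`|c - d| + (`|a - c| + `|b - d|)) `^ q)%R).
  apply: ge0_ler_powR; rewrite ?nnegrE ?addr_ge0 ?(le_trans _ q1)//.
  have := ler_distD c a b; have := ler_distD d c b.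
  by rewrite [`|d - b|%R]distrC; lra.
apply: (le_trans (powRD_rho _ _)); rewrite ?addr_ge0//.
rewrite lerD2l -mulrA ler_wpM2l//.
exact: powRD_le.
Qed.

Definition gap_energy (k t : nat) : \bar R :=
  dint B (fun x y => stage_gap t x y * (sup_close (r k) x y)%:R)%R.

Definition gap_const : R := (M * 2 `^ q * 2 * 2 ^+ n * (2 * n)%:R * 2 `^ q)%R.

Lemma gap_const_ge0 : (0 <= gap_const)%R.
Proof. by rewrite !mulr_ge0 ?powR_ge0 ?exprn_ge0. Qed.

(** Integrated form of [stage_gapS_le]: the jumps are carried by pairs separated
    by a face, and [close_boundary_le] shows that these are few. *)
Lemma gap_energyS_le k t : (t <= k)%N ->
  gap_energy k t.+1 <= rho%:E * gap_energy k t +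
    (gap_const * r k ^+ n * (2^-1) ^+ (k - t))%:E * (stage_dev t + stage_dev t.+1).
Proof.
move=> tk.
have mB := measurable_block.
have rk0 : (0 <= r k)%R by rewrite ltW// scale_gt0.
pose C (x y : T) : R := (sup_close (r k) x y)%:R.
have C0 x y : (0 <= C x y)%R by [].
have CC x y : C x y = C y x.
  by rewrite /C; congr (nat_of_bool _)%:R; apply: eq_forallb => i; rewrite distrC.
have mC : jmeasurable C by exact: jmeasurable_close.
have mN := jmeasurable_not_same_stage t.+1.
have mj := measurable_stage_jump t.
have j0 x : (0 <= stage_jump t x)%R by exact: powR_ge0.
pose F1 x y := (stage_gap t x y * C x y)%R.
have mF1 : jmeasurable F1.
  by apply: measurable_funM; [exact: jmeasurable_stage_gap|exact: mC].
have F10 x y : (0 <= F1 x y)%R by rewrite mulr_ge0 ?powR_ge0.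
pose F2 x y := (stage_jump t x * ((~~ same_stage t.+1 x y)%:R * C x y))%R.
have mNC : jmeasurable (fun x y => (~~ same_stage t.+1 x y)%:R * C x y)%R.
  by apply: measurable_funM; [exact: mN|exact: mC].
have mF2 : jmeasurable F2.
  apply: measurable_funM; last exact: mNC.
  exact: (measurableT_comp mj measurable_fst).
have F20 x y : (0 <= F2 x y)%R by rewrite !mulr_ge0.
pose F3 x y := F2 y x.
have mF3 : jmeasurable F3.
  have -> : F3 = (fun x y => stage_jump t y * ((~~ same_stage t.+1 x y)%:R * C x y))%R.
    by apply/funext => x; apply/funext => y; rewrite /F3 /F2 same_stageC CC.
  apply: measurable_funM; last exact: mNC.
  exact: (measurableT_comp mj measurable_snd).
have F30 x y : (0 <= F3 x y)%R by exact: F20.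
pose K := (M * 2 `^ q)%R.
have K0 : (0 <= K)%R by rewrite mulr_ge0 ?powR_ge0.
have mF23 : jmeasurable (fun x y => F2 x y + F3 x y)%R.
  exact: measurable_funD mF2 mF3.
have F230 x y : (0 <= F2 x y + F3 x y)%R by exact: addr_ge0.
apply: (@le_trans _ _ (dint B (fun x y => rho * F1 x y + K * (F2 x y + F3 x y))%R)).
  apply: le_dint => x y Bx By; first by rewrite mulr_ge0 ?powR_ge0.
  apply: (le_trans (ler_wpM2r (C0 x y) (stage_gapS_le t x y))).
  rewrite /F1 /F3 /F2 (same_stageC _ y x) (CC y x) -/K.
  have g0 : (0 <= stage_gap t x y)%R by exact: powR_ge0.
  move: (same_stage t.+1 x y) (stage_gap t x y) (stage_jump t x) (stage_jump t y)
    (C x y) g0 (C0 x y) => sm g1 j1 j2 c g0 c0.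
  move: K K0 => K' K'0; case: sm => /=.
    by rewrite !mul0r !mulr0 !addr0 mulr0 addr0 !mulr_ge0.
  by rewrite le_eqVlt; apply/orP; left; apply/eqP; ring.
have mA : jmeasurable (fun x y => rho * F1 x y)%R.
  by apply: measurable_funM; [exact: measurable_cst|exact: mF1].
have mD : jmeasurable (fun x y => K * (F2 x y + F3 x y))%R.
  by apply: measurable_funM; [exact: measurable_cst|exact: mF23].
have A0 x y : (0 <= rho * F1 x y)%R by exact: mulr_ge0.
have D0 x y : (0 <= K * (F2 x y + F3 x y))%R by exact: mulr_ge0.
rewrite (dintD mB mA mD A0 D0) (dintZ mB mF1 F10 rho0).
apply: leeD; first exact: lexx.
rewrite (dintZ mB mF23 F230 K0) (dintD mB mF2 mF3 F20 F30).
rewrite -(dint_swap mB mF2 F20).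
have jI := integral_stage_jump_le t.
have bl := close_boundary_le tk mj j0 (@stage_jump_same t).
have {bl} : dint B F2 <= ((2 * r k) ^+ n * ((2 * n)%:R * (2^-1) ^+ (k - t)))%:E *
    ((2 `^ q)%:E * (stage_dev t + stage_dev t.+1)).
  apply: (le_trans bl); apply: lee_wpmul2l => //.
  by rewrite lee_fin !mulr_ge0 ?exprn_ge0 ?mulr_ge0// invr_ge0.
move: (dint B F2) => X HX.
have H2 : X + X <= 2%:E * (((2 * r k) ^+ n * ((2 * n)%:R * (2^-1) ^+ (k - t)))%:E *
    ((2 `^ q)%:E * (stage_dev t + stage_dev t.+1))).
  by rewrite -mule2n -mule_natl; apply: lee_wpmul2l.
apply: (le_trans (lee_wpmul2l _ H2)); first by rewrite lee_fin.
rewrite !muleA -!EFinM le_eqVlt; apply/orP; left; apply/eqP.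
by congr (_%:E * _); rewrite /gap_const /K exprMn; ring.
Qed.

(** The function is compared at both points with its average over the cells of
    the closeness scale. *)
Lemma osc_close_le k :
  dint B (fun x y => osc q u x y * (sup_close (r k) x y)%:R)%R <=
  (2 `^ q * 2 `^ q)%:E *
  ((2 * (2 * r k) ^+ n)%:E * stage_dev k.+1 + gap_energy k k.+1).
Proof.
have mB := measurable_block.
have rk0 : (0 <= r k)%R by rewrite ltW// scale_gt0.
pose C (x y : T) : R := (sup_close (r k) x y)%:R.
have C0 (x y : T) : (0 <= C x y)%R by [].
have CC (x y : T) : C x y = C y x.
  by rewrite /C; congr (nat_of_bool _)%:R; apply: eq_forallb => i; rewrite distrC.
have mC : jmeasurable C by exact: jmeasurable_close.
pose h x := (`|u x - stage_avg k.+1 x| `^ q)%R.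
have h0 x : (0 <= h x)%R by exact: powR_ge0.
have mh : measurable_fun setT h by exact: measurable_stage_dev.
pose F1 x y := (stage_gap k.+1 x y * C x y)%R.
have mF1 : jmeasurable F1.
  by apply: measurable_funM; [exact: jmeasurable_stage_gap|exact: mC].
have F10 x y : (0 <= F1 x y)%R by rewrite mulr_ge0 ?powR_ge0.
pose F2 x y := (h x * C x y)%R.
have mF2 : jmeasurable F2.
  by apply: measurable_funM; [exact: (measurableT_comp mh measurable_fst)|exact: mC].
have F20 x y : (0 <= F2 x y)%R by rewrite mulr_ge0.
pose F3 x y := F2 y x.
have mF3 : jmeasurable F3.
  have -> : F3 = (fun x y => h y * C x y)%R.
    by apply/funext => x; apply/funext => y; rewrite /F3 /F2 CC.
  by apply: measurable_funM; [exact: (measurableT_comp mh measurable_snd)|exact: mC].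
have F30 x y : (0 <= F3 x y)%R by exact: F20.
have mF23 : jmeasurable (fun x y => F2 x y + F3 x y)%R by exact: measurable_funD mF2 mF3.
have F230 x y : (0 <= F2 x y + F3 x y)%R.
  by apply: addr_ge0; [exact: F20|exact: F30].
have mF : jmeasurable (fun x y => F2 x y + F3 x y + F1 x y)%R.
  exact: measurable_funD mF23 mF1.
have F0 x y : (0 <= F2 x y + F3 x y + F1 x y)%R.
  by apply: addr_ge0; [exact: F230|exact: F10].
pose K := (2 `^ q * 2 `^ q : R)%R.
have K0 : (0 <= K)%R by rewrite mulr_ge0 ?powR_ge0.
apply: (@le_trans _ _ (dint B (fun x y => K * (F2 x y + F3 x y + F1 x y))%R)).
  apply: le_dint => x y Bx By; first by rewrite mulr_ge0 ?osc_ge0.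
  rewrite /F3 /F2 /F1 (CC y x) -!mulrDl mulrA; apply: ler_wpM2r (C0 x y) _ _ _.
  exact: powR_dist3.
rewrite (dintZ mB mF F0 K0) (dintD mB mF23 mF1 F230 F10) (dintD mB mF2 mF3 F20 F30).
rewrite -(dint_swap mB mF2 F20); apply: lee_wpmul2l; first by rewrite lee_fin.
apply: leeD; last exact: lexx.
have H : dint B F2 <= ((2 * r k) ^+ n)%:E * stage_dev k.+1.
  rewrite -ge0_integralZl_EFin; first last.
  - by rewrite exprn_ge0// mulr_ge0.
  - by apply: measurable_funTS; apply/measurable_EFinP; exact: mh.
  - by move=> x _; rewrite lee_fin h0.
  - exact: mB.
  apply: le_integral_nonneg => x Bx.
    by apply: integral_ge0 => y _; rewrite lee_fin; exact: F20.
  rewrite /F2; under eq_integral do rewrite EFinM.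
  rewrite ge0_integralZl_EFin; first last.
  - exact: h0.
  - exact: (measurable_inner _ mB mC).
  - by move=> y _; rewrite lee_fin.
  - exact: mB.
  rewrite muleC; apply: lee_wpmul2r; first by rewrite lee_fin h0.
  exact: integral_close_le.
apply: (le_trans (leeD H H)).
by rewrite -mule2n -mule_natl muleA -EFinM.
Qed.

Lemma stage_dev_fin t : stage_dev t \is a fin_num.
Proof.
rewrite ge0_fin_numE ?stage_dev_ge0//; case: t => [|t].
  apply: (@lty_of_pmule _ ((3 * r 0) ^+ n)%R); last exact: le_lt_trans stage_dev0_le osc_fin.
  by rewrite exprn_gt0// block_len_gt0.
apply: (@lty_of_pmule _ (r t ^+ n)%R); first by rewrite exprn_gt0// scale_gt0.
apply: le_lt_trans (stage_devS_le t) (le_lt_trans _ osc_fin).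
apply: le_dint => x y _ _; first by rewrite mulr_ge0 ?osc_ge0.
by case: same_stage; rewrite ?mulr1// mulr0 osc_ge0.
Qed.

Definition dev t : R := fine (stage_dev t).

Lemma devE t : stage_dev t = (dev t)%:E.
Proof. by rewrite /dev fineK// stage_dev_fin. Qed.

Lemma dev_ge0 t : (0 <= dev t)%R.
Proof. by rewrite fine_ge0// stage_dev_ge0. Qed.

(** The recursion of [gap_energyS_le] after division by [gap_const * r k ^+ n]. *)
Fixpoint gap_bound (k t : nat) : R :=
  if t is t'.+1 then
    (rho * gap_bound k t' + (2^-1) ^+ (k - t') * (dev t' + dev t'.+1))%R else 0%R.

Lemma gap_energy_le k t : (t <= k.+1)%N ->
  gap_energy k t <= (gap_const * r k ^+ n * gap_bound k t)%:E.
Proof.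
elim: t => [_|t IH tk].
  rewrite mulr0 /gap_energy /dint integral0_eq// => x _; rewrite integral0_eq// => y _.
  by rewrite /stage_gap /= subrr normr0 powR0 ?mul0r// gt_eqF// (lt_le_trans _ q1).
have tk' : (t <= k)%N by rewrite -ltnS.
have H := gap_energyS_le tk'; rewrite !devE -EFinD -EFinM in H.
have H2 : rho%:E * gap_energy k t <= rho%:E * (gap_const * r k ^+ n * gap_bound k t)%:E.
  by apply: lee_wpmul2l; [rewrite lee_fin|exact: IH (ltnW tk)].
apply: le_trans H _; apply: le_trans (leeD H2 (lexx _)) _.
rewrite -EFinM -EFinD lee_fin le_eqVlt; apply/orP; left; apply/eqP.
rewrite -[gap_bound k t.+1]/(rho * gap_bound k t + (2^-1) ^+ (k - t) * (dev t + dev t.+1))%R.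
move: (gap_bound k t) (dev t) (dev t.+1) (r k ^+ n)%R ((2^-1) ^+ (k - t))%R gap_const.
by move=> *; ring.
Qed.

Lemma gap_boundS k t : (t <= k.+1)%N -> gap_bound k.+1 t = (gap_bound k t / 2)%R.
Proof.
elim: t => [_|t IH tk]; first by rewrite mul0r.
have E j : gap_bound j t.+1 =
  (rho * gap_bound j t + (2^-1) ^+ (j - t) * (dev t + dev t.+1))%R by [].
rewrite !E (IH (ltnW tk)) subSn// exprS.
by move: (gap_bound k t) (dev t + dev t.+1)%R ((2^-1) ^+ (k - t))%R => *; field.
Qed.

Definition gap_total k : R := gap_bound k k.+1.

Lemma gap_total0 : gap_total 0 = (dev 0 + dev 1)%R.
Proof. by rewrite /gap_total /= mulr0 add0r expr0 mul1r. Qed.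

(** Passing from [k] to [k + 1] halves every boundary factor, whence the
    contraction by [rho / 2]. *)
Lemma gap_totalS k :
  gap_total k.+1 = (rho / 2 * gap_total k + (dev k.+1 + dev k.+2))%R.
Proof.
have -> : gap_total k.+1 = (rho * gap_bound k.+1 k.+1 +
  (2^-1) ^+ (k.+1 - k.+1) * (dev k.+1 + dev k.+2))%R by [].
rewrite gap_boundS// subnn expr0 mul1r; congr (_ + _)%R.
by rewrite mulrA mulrAC.
Qed.

Lemma gap_total_ge0 k : (0 <= gap_total k)%R.
Proof.
rewrite /gap_total; elim: (k.+1) => //= t IH.
by rewrite addr_ge0 ?mulr_ge0 ?addr_ge0 ?dev_ge0 ?exprn_ge0.
Qed.

Definition close_const : R := (2 `^ q * 2 `^ q * (2 * 2 ^+ n + gap_const))%R.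

Lemma osc_close_dev_le k :
  dint B (fun x y => osc q u x y * (sup_close (r k) x y)%:R)%R <=
  (close_const * r k ^+ n * (dev k.+1 + gap_total k))%:E.
Proof.
apply: (le_trans (osc_close_le k)).
have rk0 : (0 <= r k ^+ n)%R by rewrite exprn_ge0// ltW// scale_gt0.
have p0 : (0 <= 2 `^ q * 2 `^ q :> R)%R by rewrite mulr_ge0 ?powR_ge0.
apply: (le_trans (lee_wpmul2l _ (leeD (lexx _) (gap_energy_le (leqnn _))))).
  by rewrite lee_fin.
rewrite devE -[leLHS]/((2 `^ q * 2 `^ q * (2 * (2 * r k) ^+ n * dev k.+1 +
  gap_const * r k ^+ n * gap_total k))%:E) lee_fin /close_const.
have := gap_const_ge0; have := dev_ge0 k.+1; have := gap_total_ge0 k.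
move: (dev k.+1) (gap_total k) gap_const (2 `^ q * 2 `^ q)%R p0 => d g G p p0 g0 d0 G0.
rewrite exprMn.
move: (2 ^+ n : R)%R (@exprn_ge0 R n 2 (ler0n _ _)) (r k ^+ n)%R rk0 => P P0 Q Q0.
rewrite -subr_ge0.
rewrite [X in (0 <= X)%R](_ : _ = p * (2 * (P * (Q * g)) + G * (Q * d)))%R; last by ring.
by rewrite mulr_ge0// addr_ge0// !mulr_ge0.
Qed.

Let gamma : R := (2 `^ (s - n%:R))%R.

Hypothesis theta1 : (rho / 2 * gamma < 1)%R.

Let wt k : R := ((r k `^ s)^-1 * r k ^+ n)%R.

Let wt_ge0 k : (0 <= wt k)%R.
Proof. by rewrite mulr_ge0 ?invr_ge0 ?powR_ge0// exprn_ge0// ltW// scale_gt0. Qed.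

Let wtS k : wt k.+1 = (gamma * wt k)%R.
Proof.
rewrite /wt scale_powRV scaleS /gamma powRB ?implybT//; last first.
  by rewrite pnatr_eq0 implybT.
rewrite powR_mulrn// exprMn exprVn.
move: (2 `^ s)%R ((_ `^ s)^-1)%R (r k ^+ n)%R ((2 ^+ n)^-1 : R)%R => *; ring.
Qed.

Definition total_const : R :=
  (1 + (1 - rho / 2 * gamma)^-1 * (1 + gamma))%R.

Lemma total_const_ge0 : (0 <= total_const)%R.
Proof.
have g0 : (0 <= gamma)%R by exact: powR_ge0.
by rewrite addr_ge0// mulr_ge0 ?addr_ge0// invr_ge0 subr_ge0 ltW.
Qed.

Lemma close_const_ge0 : (0 <= close_const)%R.
Proof.
apply: mulr_ge0; first by rewrite mulr_ge0 ?powR_ge0.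
by apply: addr_ge0; [rewrite mulr_ge0 ?exprn_ge0|exact: gap_const_ge0].
Qed.

(** The weights [wt] grow with ratio [gamma], so [sum_weighted_recursion]
    applies and leaves only deviations of single stages, which [stage_devS_le]
    turns into pairs in a common cell. *)
Lemma close_sum_le N :
  \sum_(k < N) ((r k.+1 `^ s)^-1)%:E *
    dint B (fun x y => osc q u x y * (sup_close (r k) x y)%:R)%R <=
  (2 `^ s * close_const * total_const)%:E *
  (((r 0 `^ s)^-1)%:E * dint B (osc q u) + \sum_(k < N) ((r k `^ s)^-1)%:E *
    dint B (fun x y => osc q u x y * (same_stage k.+1 x y)%:R)%R).
Proof.
have cc0 := close_const_ge0; have tc0 := total_const_ge0.
have s2 : (0 <= 2 `^ s :> R)%R by exact: powR_ge0.
have inv0 k : (0 <= (r k `^ s)^-1)%R by rewrite invr_ge0 powR_ge0.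
apply: (@le_trans _ _ (\sum_(k < N) (2 `^ s * close_const *
    (wt k * (dev k.+1 + gap_total k)))%:E)).
  apply: lee_sum => k _.
  apply: (le_trans (lee_wpmul2l _ (osc_close_dev_le k))); first by rewrite lee_fin.
  rewrite -EFinM lee_fin scale_powRV /wt.
  move: (2 `^ s)%R ((r k `^ s)^-1)%R (r k ^+ n)%R (dev _) (gap_total _) close_const.
  by move=> *; rewrite le_eqVlt; apply/orP; left; apply/eqP; ring.
rewrite sumEFin -mulr_sumr.
apply: (@le_trans _ _ (2 `^ s * close_const * (total_const *
    (wt 0 * dev 0 + \sum_(k < N) wt k * dev k.+1)))%:E).
  rewrite lee_fin; apply: ler_wpM2l; first exact: mulr_ge0.
  apply: sum_weighted_recursion => //.
  - exact: dev_ge0.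
  - exact: gap_total_ge0.
  - exact: powR_ge0.
  - exact: gap_total0.
  - exact: gap_totalS.
rewrite mulrA EFinM; apply: lee_wpmul2l.
  by rewrite lee_fin; exact: mulr_ge0 (mulr_ge0 s2 cc0) tc0.
rewrite EFinD -sumEFin; apply: leeD.
  rewrite /wt -mulrA EFinM; apply: lee_wpmul2l; first by rewrite lee_fin.
  apply: le_trans stage_dev0_le; rewrite EFinM -devE.
  apply: lee_wpmul2r; first exact: stage_dev_ge0.
  have r0 := scale_gt0 R m 0.
  by rewrite lee_fin lerXn2r ?nnegrE ?mulr_ge0 ?(ltW r0)//; lra.
apply: lee_sum => k _.
rewrite /wt -mulrA EFinM; apply: lee_wpmul2l; first by rewrite lee_fin.
by rewrite EFinM -devE; exact: stage_devS_le.
Qed.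

Definition block_cell (e : {ffun 'I_n -> 'I_3}) : set T :=
  cell m (\row_i (v 0 i + (e i)%:Z)%R).

(** A function of pairs supported on pairs in a common cell of level [m] lives
    on the 3 ^ n squares of the cells of the block. *)
Lemma block_split (F : T -> T -> R) : jmeasurable F ->
  (forall x y, 0 <= F x y)%R ->
  (forall x y, ~~ same_stage 1 x y -> F x y = 0%R) ->
  dint B F <= \sum_e dint (block_cell e) F.
Proof.
move=> mF F0 Fs; have mB := measurable_block.
have mD e : measurable (block_cell e) by exact: measurable_cell.
pose G e x y := (F x y * (\1_(block_cell e) x * \1_(block_cell e) y))%R.
have G0 e x y : (0 <= G e x y)%R by rewrite !mulr_ge0.
have mG e : jmeasurable (G e).
  apply: measurable_funM; first exact: mF.
  by apply: measurable_funM;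
    [exact: (measurableT_comp (measurable_indic (mD e)) measurable_fst)|
     exact: (measurableT_comp (measurable_indic (mD e)) measurable_snd)].
apply: (@le_trans _ _ (dint B (fun x y => \sum_e G e x y)%R)).
  apply: le_dint => x y Bx By; first exact: F0.
  have [/= /eqP sxy|/Fs ->] := boolP (same_stage 1 x y); last by rewrite sumr_ge0.
  have sxy' : cell_index m x = cell_index m y by move: sxy; rewrite addr0.
  pose e : {ffun 'I_n -> 'I_3} :=
    [ffun i => inord `|cell_index m x 0%R i - v 0%R i|%N].
  have De : block_cell e x.
    apply/rowP => i; rewrite [RHS]mxE /e ffunE; have /andP[H1 H2] := Bx i.
    have d0 : (0 <= cell_index m x 0 i - v 0 i)%R by rewrite subr_ge0.
    rewrite inordK; first by rewrite gez0_abs// addrCA subrr addr0.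
    by rewrite -ltz_nat gez0_abs// ltrBlDl.
  have De' : block_cell e y by rewrite /block_cell /cell /= -sxy'; exact: De.
  apply: (@le_trans _ _ (G e x y)).
    by rewrite /G !indicE !mem_set// !mulr1.
  by rewrite (bigD1 e)//= lerDl sumr_ge0.
rewrite (dint_sum _ _ mB mG G0); apply: lee_sum => e _.
rewrite /dint [leLHS]integral_mkcond [leRHS]integral_mkcond.
apply: le_integral_nonneg => x _.
  by rewrite patchE; case: ifP => // _; apply: integral_ge0 => y _; rewrite lee_fin; exact: G0.
rewrite !patchE; case: (boolP (x \in block_cell e)) => xD; last first.
  case: ifP => // _; rewrite integral0_eq// => y _.
  by rewrite /G indicE (negbTE xD) mul0r mulr0.
case: ifP => _; last by apply: integral_ge0 => y _; rewrite lee_fin; exact: F0.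
rewrite [leLHS]integral_mkcond [leRHS]integral_mkcond.
apply: le_integral_nonneg => y _; rewrite !patchE.
  by case: ifP => // _; rewrite lee_fin; exact: G0.
rewrite /G !indicE xD mul1r; case: (boolP (y \in block_cell e)) => yD.
  by case: ifP => _; rewrite ?mulr1// lee_fin; exact: F0.
by case: ifP => _; rewrite ?mulr0.
Qed.

(** On each cell the sum of the kernels over the scales is a geometric sum
    bounded by the dyadic kernel. *)
Lemma same_sum_le N :
  \sum_(k < N) ((r k `^ s)^-1)%:E *
    dint B (fun x y => osc q u x y * (same_stage k.+1 x y)%:R)%R <=
  ((1 - 2 `^ (- s))^-1)%:E * \sum_e delta_energy q u s (block_cell e).
Proof.
have mB := measurable_block.
have C0 : (0 < (1 - 2 `^ (- s))^-1 :> R)%R by rewrite invr_gt0 subr1_powR2N_gt0.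
set C := (1 - _)^-1%R in C0 *.
have inv0 k : (0 <= (r k `^ s)^-1)%R by rewrite invr_ge0 powR_ge0.
pose G k x y := (osc q u x y * (same_stage k.+1 x y)%:R)%R.
have mG k : jmeasurable (G k).
  by apply: measurable_funM; [exact: jmeasurable_osc|exact: jmeasurable_same_stage].
have G0 k x y : (0 <= G k x y)%R by rewrite mulr_ge0 ?osc_ge0.
pose H k x y := ((r k `^ s)^-1 * G k x y)%R.
have mH k : jmeasurable (H k).
  by apply: measurable_funM; [exact: measurable_cst|exact: mG].
have H0 k x y : (0 <= H k x y)%R by exact: mulr_ge0.
pose F x y := (\sum_(k < N) H k x y)%R.
have F0 x y : (0 <= F x y)%R by rewrite sumr_ge0.
have mF : jmeasurable F by apply: measurable_sum => k; exact: mH.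
have -> : \sum_(k < N) ((r k `^ s)^-1)%:E * dint B (G k) = dint B F.
  rewrite /F (@dint_sum _ _ _ _ _ _ (fun k : 'I_N => H k) mB (fun k => mH k)
    (fun k => H0 k)).
  apply: eq_bigr => k _.
  by rewrite /H (dintZ mB (mG k) (G0 k) (inv0 k)).
apply: (le_trans (block_split mF F0 _)).
  move=> x y Nxy; rewrite /F big1// => k _; rewrite /H /G.
  case: (boolP (same_stage k.+1 x y)) => [sxy|_]; last by rewrite !mulr0.
  suff K : same_stage 1 x y by rewrite K in Nxy.
  move: sxy => /= /eqP sxy; apply/eqP; apply: cell_index_coarser sxy.
  by rewrite lerD2l lez_nat.
rewrite ge0_sume_distrr; last first.
  move=> e _; apply: dint_ge0 => x y.
  by rewrite mulr_ge0 ?osc_ge0// invr_ge0 powR_ge0.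
apply: lee_sum => e _.
have mD : measurable (block_cell e) by exact: measurable_cell.
have E : dint (block_cell e) F = C%:E * dint (block_cell e) (fun x y => C^-1 * F x y)%R.
  rewrite (dintZ mD mF F0); last by rewrite invr_ge0 ltW.
  by rewrite muleA -EFinM divff ?mul1e// gt_eqF.
rewrite E; apply: lee_wpmul2l; first by rewrite lee_fin ltW.
apply: le_dint => x y _ _; first by rewrite mulr_ge0// invr_ge0 ltW.
rewrite ler_pdivrMl//.
have [->|xy] := eqVneq x y.
  by rewrite /F big1 ?osc_diag ?mul0r ?mulr0// => k _; rewrite /H /G osc_diag// mul0r mulr0.
have := sum_scale_le_delta m N s0 xy => HS.
rewrite mulrCA; apply: le_trans (ler_wpM2l (osc_ge0 _ _ _ _) HS).
rewrite [X in (_ <= _ * X)%R]big_mkcond mulr_sumr; apply: ler_sum => k _.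
rewrite /H /G /=; case: ifP => _; rewrite ?mulr1 ?mulr0//.
by rewrite mulrC.
Qed.

Definition block_const : R :=
  (1 + 2 `^ s * close_const * total_const * (1 + (1 - 2 `^ (- s))^-1))%R.

(** The Euclidean kernel is cut into scales; scale by scale the close pairs are
    charged to pairs in common cells, and these add up to the dyadic kernel. *)
Lemma block_energy_le : eucl_energy q u s B <=
  block_const%:E * (((r 0 `^ s)^-1)%:E * dint B (osc q u) +
    \sum_e delta_energy q u s (block_cell e)).
Proof.
have mB := measurable_block.
have inv0 k : (0 <= (r k `^ s)^-1)%R by rewrite invr_ge0 powR_ge0.
have C0 : (0 < (1 - 2 `^ (- s))^-1 :> R)%R by rewrite invr_gt0 subr1_powR2N_gt0.
have K0 : (0 <= 2 `^ s * close_const * total_const)%R.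
  exact: mulr_ge0 (mulr_ge0 (powR_ge0 _ _) close_const_ge0) total_const_ge0.
pose G k x y := if k is k'.+1
  then ((r k `^ s)^-1 * (osc q u x y * (sup_close (r k') x y)%:R))%R
  else ((r 0 `^ s)^-1 * osc q u x y)%R.
have mo : jmeasurable (osc q u) by exact: jmeasurable_osc.
have mc k : jmeasurable (fun x y => osc q u x y * (sup_close (r k) x y)%:R)%R.
  by apply: measurable_funM; [exact: mo|exact: jmeasurable_close].
have c0 k x y : (0 <= osc q u x y * (sup_close (r k) x y)%:R)%R.
  by rewrite mulr_ge0 ?osc_ge0.
have mG k : jmeasurable (G k).
  by case: k => [|k]; apply: measurable_funM;
    [exact: measurable_cst|exact: mo|exact: measurable_cst|exact: mc].
have G0 k x y : (0 <= G k x y)%R.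
  by case: k => [|k]; apply: mulr_ge0 => //; exact: osc_ge0.
set e0 := dint B (osc q u); set S := \sum_e _.
have S0 : 0 <= S.
  apply: sume_ge0 => e _; apply: dint_ge0 => x y.
  by rewrite mulr_ge0 ?osc_ge0// invr_ge0 powR_ge0.
have e00 : 0 <= e0 by apply: dint_ge0 => x y; exact: osc_ge0.
have re0 : 0 <= ((r 0 `^ s)^-1)%:E * e0 by rewrite mule_ge0// lee_fin.
have bound N : \sum_(k < N.+1) dint B (G k) <=
    block_const%:E * (((r 0 `^ s)^-1)%:E * e0 + S).
  rewrite big_ord_recl (dintZ mB mo (osc_ge0 _ _) (inv0 0%N)).
  have -> : \sum_(k < N) dint B (G (lift ord0 k)) = \sum_(k < N)
     ((r k.+1 `^ s)^-1)%:E * dint B (fun x y => osc q u x y * (sup_close (r k) x y)%:R)%R.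
    by apply: eq_bigr => k _; rewrite -(dintZ mB (mc k) (c0 k) (inv0 k.+1)).
  rewrite -/e0.
  have H : \sum_(k < N) ((r k.+1 `^ s)^-1)%:E *
      dint B (fun x y => osc q u x y * (sup_close (r k) x y)%:R)%R <=
      (2 `^ s * close_const * total_const)%:E *
      (((r 0 `^ s)^-1)%:E * e0 + ((1 - 2 `^ (- s))^-1)%:E * S).
    apply: (le_trans (close_sum_le N)); apply: lee_wpmul2l; first by rewrite lee_fin.
    by apply: leeD; [exact: lexx|exact: same_sum_le].
  apply: (le_trans (leeD (lexx _) H)).
  set X := ((r 0 `^ s)^-1)%:E * e0 in re0 *.
  set C := ((1 - 2 `^ (- s))^-1)%R in C0 *.
  have -> : block_const = (1 + 2 `^ s * close_const * total_const * (1 + C))%R by [].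
  move: (2 `^ s * close_const * total_const)%R K0 => K K0.
  apply: (@le_trans _ _ ((X + S) + (K * (1 + C))%:E * (X + S))); last first.
    rewrite EFinD ge0_muleDl ?mul1e ?lee_fin ?mulr_ge0 ?addr_ge0// ?(ltW C0)//.
  apply: leeD; first by apply: leeDl.
  rewrite EFinM -muleA; apply: lee_wpmul2l; first by rewrite lee_fin.
  rewrite ge0_muleDr//; apply: leeD.
    by rewrite -[leLHS]mul1e lee_wpmul2r// lee_fin lerDl ltW.
  by rewrite lee_wpmul2r// lee_fin lerDr.
apply: (@dint_series_le _ _ _ _ G) => //.
- by move=> x y _ _; exact: osc_eucl_ge0.
- move=> x y _ _; have [->|xy] := eqVneq x y.
    by exists 0%N => N _; rewrite osc_diag// mul0r sumr_ge0.
  have [N0 HN] := eucl_kernel_le m s0 xy.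
  exists N0.+1 => -[//|N] N0N; rewrite big_ord_recl.
  apply: (le_trans (ler_wpM2l (osc_ge0 _ _ _ _) (HN N N0N))).
  rewrite mulrDr; apply: lerD; first by rewrite mulrC.
  rewrite big_mkcond mulr_sumr; apply: ler_sum => k _.
  rewrite /G /=; case: ifP => _; rewrite ?mulr0 ?mulr1 1?mulrC//.
- move=> [|N]; last exact: bound.
  rewrite big_ord0 mule_ge0 ?adde_ge0// lee_fin addr_ge0// mulr_ge0// addr_ge0//.
  exact: ltW.
Qed.

End Block.

(** [rho > 1] with [rho / 2 * 2 ^ (s - n) < 1] exists exactly because [s < n +
    1]. The constant depends on the exponents only, which makes the estimate
    summable over the blocks. *)
Lemma block_energy_bound_pos (R : realType) (n : nat) (q s : R) : (0 < n)%N ->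
  1 <= q -> 0 < s -> s < n%:R + 1 -> exists2 C : R, 0 <= C &
  forall (m : int) (v : 'rV[int]_n) (u : lebesgueRn R n -> R),
    measurable_fun setT u -> (dint (block (R := R) m v) (osc q u) < +oo)%E ->
    (eucl_energy q u s (block (R := R) m v) <= C%:E *
     (((scale R m 0 `^ s)^-1)%:E * dint (block (R := R) m v) (osc q u) +
      \sum_e delta_energy q u s (block_cell (R := R) m v e)))%E.
Proof.
move=> n0 q1 s0 sn; set g := (2 : R) `^ (s - n%:R).
have g0 : 0 < g by rewrite powR_gt0.
have g2 : g < 2.
  have H : 0 < 1 - (s - n%:R) by lra.
  have := powR2_gt1 H; rewrite powRB ?implybT ?pnatr_eq0 ?implybT// powRr1//.
  by rewrite ltr_pdivlMr ?mul1r ?powR_gt0.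
(* Midway between 1 and 2 / g, so that both rho > 1 and rho / 2 * g < 1 hold. *)
set rho := (1 + 2 / g) / 2.
have rg : 2 / g > 1 by rewrite ltr_pdivlMr// mul1r.
have rho1 : 1 < rho by rewrite /rho; lra.
have [M M0 HM] := powRD_weighted q1 rho1.
have t1 : rho / 2 * g < 1.
  rewrite -ltr_pdivlMr// mul1r.
  by rewrite /rho; have : 2 / g = 2 * g^-1 by []; lra.
have rho0 : 0 <= rho by rewrite ltW// (lt_trans ltr01).
exists (block_const n q s rho M) => [|m v u mu_u fin].
  apply: addr_ge0; first exact: ler01.
  apply: mulr_ge0; last by rewrite addr_ge0// invr_ge0 ltW// subr1_powR2N_gt0.
  apply: mulr_ge0; last exact: total_const_ge0.
  apply: mulr_ge0; first exact: powR_ge0.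
  exact: close_const_ge0.
exact: block_energy_le.
Qed.

(** * Sums over families of sets *)

Section SumTools.
Local Open Scope ereal_scope.
Context (R : realType).

Lemma le_esum_subset (I : choiceType) (A B : set I) (a : I -> \bar R) :
  A `<=` B -> \esum_(i in A) a i <= \esum_(i in B) a i.
Proof.
move=> AB; apply: ereal_sup_le => _ [X [fX XA] <-]; exists X => //.
by split => //; exact: subset_trans XA AB.
Qed.

(** The comparison is made on finite subfamilies, where multiplication by a real
    constant distributes. *)
Lemma esum_le_mul (I : choiceType) (A : set I) (a b : I -> \bar R) (K M : R) :
  (0 <= K)%R -> (forall i, 0 <= b i) ->
  (forall i, A i -> a i <= K%:E * b i) -> \esum_(i in A) b i <= M%:E ->
  \esum_(i in A) a i <= (K * M)%:E.
Proof.
move=> K0 b0 ab bM; apply: ge_ereal_sup => _ [X [fX XA] <-].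
apply: (@le_trans _ _ (\sum_(i \in X) K%:E * b i)).
  by apply: lee_fsum => // i Xi; apply: ab; exact: XA.
rewrite -ge0_mule_fsumr// EFinM; apply: lee_wpmul2l; first by rewrite lee_fin.
by apply: le_trans bM; apply: ereal_sup_ubound; exists X.
Qed.

Lemma esum_inj_le (I J : choiceType) (A : set I) (B : set J) (phi : I -> J)
    (a : J -> \bar R) : set_inj A phi -> (forall i, A i -> B (phi i)) ->
  \esum_(i in A) a (phi i) <= \esum_(j in B) a j.
Proof.
move=> inj AB; rewrite -esum_image//; apply: le_esum_subset => _ [i Ai <-].
exact: AB.
Qed.

Lemma poweR_le_mul (K t : R) (A B : \bar R) : (0 <= t)%R -> (0 <= K)%R ->
  0 <= A -> 0 <= B -> A <= K%:E * B -> A `^ t <= (K `^ t)%:E * B `^ t.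
Proof.
move=> t0 K0 A0 B0 AB; rewrite -poweR_EFin -poweRM//.
apply: gt0_ler_poweR => //; rewrite in_itv /= leey andbT//.
by rewrite mule_ge0.
Qed.

Lemma poweRD_le (t : R) (A B : \bar R) : (0 <= t)%R -> 0 <= A -> 0 <= B ->
  (A + B) `^ t <= (2 `^ t)%:E * (A `^ t + B `^ t).
Proof.
move=> t0; wlog AB : A B / A <= B.
  move=> H A0 B0; have [AB|/ltW BA] := leP A B; first exact: H.
  by rewrite addeC [A `^ t + _]addeC; exact: H.
move=> A0 B0; apply: (@le_trans _ _ ((2 `^ t)%:E * B `^ t)).
  apply: poweR_le_mul => //; first exact: adde_ge0.
  by rewrite mule_natl mule2n leeD2r.
by apply: lee_wpmul2l; rewrite ?lee_fin ?powR_ge0// leeDr// poweR_ge0.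
Qed.

Lemma poweR_sum_le (I : Type) (r : seq I) (t : R) (Y : I -> \bar R) : (0 < t)%R ->
  (forall i, 0 <= Y i) ->
  (\sum_(i <- r) Y i) `^ t <= ((2 `^ t) ^+ size r)%:E * \sum_(i <- r) Y i `^ t.
Proof.
move=> t0 Y0; elim: r => [|y r IH].
  by rewrite !big_nil mule0 poweR0r// gt_eqF.
have p1 : (1 <= (2 : R) `^ t)%R by apply/ltW/powR2_gt1.
rewrite !big_cons /= exprS.
have S0 : 0 <= \sum_(i <- r) Y i by exact: sume_ge0.
have T0 : 0 <= \sum_(i <- r) Y i `^ t by apply: sume_ge0 => i _; exact: poweR_ge0.
apply: (le_trans (poweRD_le (ltW t0) (Y0 y) S0)).
rewrite EFinM -muleA; apply: lee_wpmul2l; first by rewrite lee_fin powR_ge0.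
have K1 : (1 <= (2 `^ t) ^+ size r :> R)%R by exact: exprn_ege1.
rewrite ge0_muleDr ?poweR_ge0//; apply: leeD; last exact: IH.
by rewrite -[leLHS]mul1e; apply: lee_wpmul2r; rewrite ?poweR_ge0// lee_fin.
Qed.

Lemma sup_poweR_ltyP (I : Type) (X : set I) (g : I -> \bar R) (p : R) :
  (0 < p)%R -> (forall i, X i -> 0 <= g i) ->
  ereal_sup [set g i `^ p^-1 | i in X] < +oo <->
  exists2 M : R, (0 <= M)%R & forall i, X i -> g i <= M%:E.
Proof.
move=> p0 g0; have pN0 : p != 0%R by rewrite gt_eqF.
split=> [|[M M0 H]].
  set S := ereal_sup _ => Sy; exists ((fine S) `^ p)%R; first exact: powR_ge0.
  move=> i Xi; have H : g i `^ p^-1 <= S by apply: ereal_sup_ubound; exists i.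
  have S0 : 0 <= S by rewrite (le_trans _ H)// poweR_ge0.
  have -> : g i = (g i `^ p^-1) `^ p.
    by rewrite -poweRrM mulVf// poweRe1// g0.
  rewrite -poweR_EFin fineK ?ge0_fin_numE//.
  by apply: gt0_ler_poweR; rewrite ?(ltW p0)// in_itv /= leey andbT// poweR_ge0.
apply: (@le_lt_trans _ _ (M `^ p^-1)%:E); last by rewrite ltry.
apply: ge_ereal_sup => _ [i Xi <-]; rewrite -poweR_EFin.
by apply: gt0_ler_poweR; rewrite ?invr_ge0 ?(ltW p0)// ?H// in_itv /= leey andbT ?g0// lee_fin.
Qed.

End SumTools.

Import HBNNSimple.

Section AlmostEverywhere.
Local Open Scope ereal_scope.
Context d (T : measurableType d) (R : realType) (m : {measure set T -> \bar R}).

(** A simple function below [f] lies below [g] once it is set to zero on the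
    null set, and this does not change its integral; so [f] and [g] can be
    arbitrary, for instance given by inner integrals. *)
Lemma ae_le_integral_nonneg (D N : set T) (f g : T -> \bar R) :
  measurable N -> m N = 0 -> (forall x, D x -> 0 <= f x) ->
  (forall x, D x -> 0 <= g x) -> (forall x, D x -> ~ N x -> f x <= g x) ->
  \int[m]_(x in D) f x <= \int[m]_(x in D) g x.
Proof.
move=> mN N0 f0 g0 fg.
have g0' x : [set: T] x -> 0 <= (g \_ D) x by move=> _; apply: erestrict_ge0.
rewrite [leLHS]ge0_integralE// [leRHS]integral_mkcond.
apply: ge_ereal_sup => _ [h /= hf <-].
rewrite -integralT_nnsfun (ge0_negligible_integral mN)//; last 2 first.
- by apply/measurable_EFinP; exact: measurable_funPT.
- by move=> x _; rewrite lee_fin.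
rewrite integral_mkcond; apply: le_integral_nonneg => x _.
  by apply: erestrict_ge0 => y _; rewrite lee_fin.
rewrite patchE; case: ifPn => [|_]; last exact: g0'.
rewrite inE => -[_ Nx]; apply: (le_trans (hf x)); rewrite !patchE.
by case: ifPn => // /[1!inE] Dx; exact: fg.
Qed.

Lemma ae_eq_integral_nonneg (D N : set T) (f g : T -> \bar R) :
  measurable N -> m N = 0 -> (forall x, D x -> 0 <= f x) ->
  (forall x, D x -> 0 <= g x) -> (forall x, D x -> ~ N x -> f x = g x) ->
  \int[m]_(x in D) f x = \int[m]_(x in D) g x.
Proof.
move=> mN N0 f0 g0 fg; apply/eqP; rewrite eq_le; apply/andP; split;
  by apply: (ae_le_integral_nonneg mN N0) => // x Dx Nx; rewrite fg.
Qed.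

End AlmostEverywhere.

(** * Passage to a real-valued representative *)

Section RealRepresentative.
Local Open Scope ereal_scope.
Context (R : realType) (n : nat) (q : R) (q1 : (1 <= q)%R).
Local Notation T := (lebesgueRn R n).
Local Notation mu := (@leb R n).
Variable f : 'rV[R]_n -> \bar R.
Hypothesis af : ae_finite_measurable f.

Definition real_rep : T -> R := fine \o f.
Local Notation u := real_rep.

Lemma measurable_real_rep : measurable_fun setT u.
Proof. by case: af => mf _; apply: measurableT_comp mf; exact: fine_measurable. Qed.

Lemma real_rep_ae : exists N : set T, [/\ measurable N, mu N = 0 &
  forall x, ~ N x -> f x = (u x)%:E].
Proof.
case: af => _ [N [mN N0 H]]; exists N; split=> // x Nx; rewrite /u /= fineK//.
by apply: contrapT => fx; apply: Nx; apply: H.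
Qed.

(** The exceptional null set is removed in each variable in turn. *)
Lemma double_integral_real (Q : set T) (w : T -> T -> R) :
  (forall x y, 0 <= w x y)%R ->
  \int[mu]_(x in Q) \int[mu]_(y in Q) (`|f x - f y| `^ q * (w x y)%:E) =
  dint Q (fun x y => osc q u x y * w x y)%R.
Proof.
move=> w0; have [N [mN N0 fN]] := real_rep_ae.
have f0 x y : 0 <= `|f x - f y| `^ q * (w x y)%:E.
  by rewrite mule_ge0 ?poweR_ge0// lee_fin.
have o0 x y : (0 <= osc q u x y * w x y)%R by rewrite mulr_ge0 ?osc_ge0.
apply: (ae_eq_integral_nonneg mN N0).
- by move=> x _; apply: integral_ge0 => y _; exact: f0.
- by move=> x _; apply: integral_ge0 => y _; rewrite lee_fin; exact: o0.
- move=> x _ Nx; apply: (ae_eq_integral_nonneg mN N0).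
  + by move=> y _; exact: f0.
  + by move=> y _; rewrite lee_fin; exact: o0.
  + by move=> y _ Ny; rewrite (fN x Nx) (fN y Ny).
Qed.

Lemma integral_real (Q : set T) : measurable Q ->
  \int[mu]_(x in Q) f x = \int[mu]_(x in Q) (u x)%:E.
Proof.
move=> mQ; have [N [mN N0 fN]] := real_rep_ae.
apply: ae_eq_integral; first exact: mQ.
- by apply: measurable_funTS; case: af.
- by apply: measurable_funTS; apply/measurable_EFinP; exact: measurable_real_rep.
- by exists N; split => // x /= H; apply: contrapT => Nx; apply: H => _; exact: fN.
Qed.

Lemma integral_dev_real (Q : set T) : measurable Q ->
  mu.-integrable Q (EFin \o u) ->
  \int[mu]_(x in Q) `|f x - mean f Q| `^ q =
  \int[mu]_(x in Q) (`|u x - avg u Q| `^ q)%:E.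
Proof.
move=> mQ iu; have [N [mN N0 fN]] := real_rep_ae.
have -> : mean f Q = (avg u Q)%:E.
  by rewrite -meanE// /mean integral_real.
apply: (ae_eq_integral_nonneg mN N0).
- by move=> x _; exact: poweR_ge0.
- by move=> x _; rewrite lee_fin powR_ge0.
- by move=> x _ Nx; rewrite (fN x Nx).
Qed.

Lemma integrable_real (Q : set T) :
  mu.-integrable Q f -> mu.-integrable Q (EFin \o u).
Proof.
move=> /integrableP[_ If]; have [N [mN N0 fN]] := real_rep_ae.
apply/integrableP; split.
  by apply: measurable_funTS; apply/measurable_EFinP; exact: measurable_real_rep.
apply: le_lt_trans If; apply: (ae_le_integral_nonneg mN N0) => //.
by move=> x _ Nx; rewrite (fN x Nx).
Qed.

Lemma integrable_of_real (Q Q' : set T) : Q `<=` Q' ->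
  mu.-integrable Q' (EFin \o u) -> mu.-integrable Q f.
Proof.
move=> QQ /integrableP[_ Iu]; have [N [mN N0 fN]] := real_rep_ae.
apply/integrableP; split; first by apply: measurable_funTS; case: af.
apply: le_lt_trans Iu.
apply: (@le_trans _ _ (\int[mu]_(x in Q) `|(u x)%:E|)).
  by apply: (ae_le_integral_nonneg mN N0) => // x _ Nx; rewrite (fN x Nx).
rewrite integral_mkcond [leRHS]integral_mkcond; apply: le_integral_nonneg => x _.
  exact: erestrict_ge0.
rewrite !patchE; case: ifPn => [|_]; last by case: ifP => // _; exact: abse_ge0.
by rewrite inE => /QQ Qx; rewrite ifT// inE.
Qed.

End RealRepresentative.

(** * The terms of the three norms *)

Section Terms.
Local Open Scope ereal_scope.
Context (R : realType) (n : nat) (n0 : (0 < n)%N) (p q alpha : R).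
Hypotheses (q1 : (1 <= q)%R) (qp : (q <= p)%R) (qa : (q * alpha < 1)%R).
Local Notation T := (lebesgueRn R n).
Local Notation mu := (@leb R n).
Local Notation s := (n%:R + q * alpha)%R.
Local Notation t := (p / q)%R.
Variables (u : T -> R) (mu_u : measurable_fun setT u).
Implicit Types (Q : set T) (l : R).

Definition eucl_term Q : \bar R := (vol Q)%:E *
  ((vol Q `^ (q * alpha / n%:R - 1))%:E * eucl_energy q u s Q) `^ t.

Definition delta_term Q : \bar R := (vol Q)%:E *
  ((vol Q `^ (q * alpha / n%:R - 1))%:E * delta_energy q u s Q) `^ t.

Definition mean_term Q : \bar R := (vol Q)%:E *
  ((vol Q)^-1%:E * \int[mu]_(x in Q) (`|u x - avg u Q| `^ q)%:E) `^ t.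

Lemma q_gt0 : (0 < q)%R. Proof. exact: lt_le_trans q1. Qed.

Lemma t_gt0 : (0 < t)%R.
Proof. by rewrite divr_gt0 ?q_gt0// (lt_le_trans q_gt0). Qed.

Lemma vol_ge0 Q : (0 <= vol Q)%R. Proof. by rewrite fine_ge0. Qed.

Lemma eucl_energy_ge0 Q : 0 <= eucl_energy q u s Q.
Proof. by apply: dint_ge0 => x y; exact: osc_eucl_ge0. Qed.

Lemma delta_energy_ge0 Q : 0 <= delta_energy q u s Q.
Proof. by apply: dint_ge0 => x y; rewrite mulr_ge0 ?osc_ge0// invr_ge0 powR_ge0. Qed.

Lemma eucl_term_ge0 Q : 0 <= eucl_term Q.
Proof. by rewrite mule_ge0 ?poweR_ge0// lee_fin vol_ge0. Qed.

Lemma delta_term_ge0 Q : 0 <= delta_term Q.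
Proof. by rewrite mule_ge0 ?poweR_ge0// lee_fin vol_ge0. Qed.

Lemma mean_term_ge0 Q : 0 <= mean_term Q.
Proof. by rewrite mule_ge0 ?poweR_ge0// lee_fin vol_ge0. Qed.

Lemma cube_vol l Q : (0 <= l)%R -> cube l Q -> vol Q = (l ^+ n)%R.
Proof. by move=> l0 /(cube_measure l0)[_ muQ]; rewrite /vol [mu Q]muQ. Qed.

Lemma cube_vol_powR l Q : (0 <= l)%R -> cube l Q ->
  (vol Q `^ (q * alpha / n%:R - 1) = l `^ (q * alpha - n%:R))%R.
Proof.
move=> l0 cQ; rewrite (cube_vol l0 cQ) -powR_mulrn// -powRrM; congr (_ `^ _)%R.
by field; rewrite pnatr_eq0 -lt0n.
Qed.

(** Finiteness of a single term already gives integrability of the function on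
    the cube, through [integrable_of_osc]. *)
Lemma eucl_term_fin l Q : (0 < l)%R -> cube l Q -> eucl_term Q < +oo ->
  dint Q (osc q u) < +oo.
Proof.
move=> l0 cQ; have [K K0 HK] := osc_le_eucl q1 mu_u s n0.
move=> Hfin; apply: (le_lt_trans (HK _ _ l0 cQ)).
have v0 : (0 < vol Q)%R by rewrite (cube_vol (ltW l0) cQ) exprn_gt0.
have /lty_poweRy : ((vol Q `^ (q * alpha / n%:R - 1))%:E * eucl_energy q u s Q) `^ t < +oo.
  exact: lty_of_pmule Hfin.
rewrite gt_eqF ?t_gt0// => /(_ isT).
move=> /(lty_of_pmule (powR_gt0 _ v0)) H.
have eg := eucl_energy_ge0 Q.
by rewrite lte_mul_pinfty// ?lee_fin ?mulr_ge0 ?powR_ge0 ?(ltW K0)// ge0_fin_numE.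
Qed.

(** Jensen's inequality bounds the mean oscillation by the double one, and
    [osc_le_eucl] bounds the latter by the energy; the powers of the edge length
    cancel. *)
Lemma mean_le_eucl_term : exists2 K : R, (0 <= K)%R &
  forall l Q, (0 < l)%R -> cube l Q -> mu.-integrable Q (EFin \o u) ->
  mean_term Q <= K%:E * eucl_term Q.
Proof.
have [K K0 HK] := osc_le_eucl q1 mu_u s n0.
exists (K `^ t)%R => [|l Q l0 cQ iu]; first exact: powR_ge0.
have [mQ muQ] := cube_measure (ltW l0) cQ.
have volQ := cube_vol (ltW l0) cQ.
have v0 : (0 < vol Q)%R by rewrite volQ exprn_gt0.
have fQ : mu Q < +oo by rewrite [ltLHS]muQ ltry.
rewrite /mean_term /eucl_term muleCA; apply: lee_wpmul2l; first by rewrite lee_fin ltW.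
set I := \int[mu]_(x in Q) _.
have I0 : 0 <= I by apply: integral_ge0 => x _; rewrite lee_fin powR_ge0.
have w0 : (0 <= vol Q `^ (q * alpha / n%:R - 1))%R by exact: powR_ge0.
apply: poweR_le_mul; rewrite ?(ltW t_gt0) ?(ltW K0)//.
- by rewrite mule_ge0// lee_fin invr_ge0 ltW.
- by rewrite mule_ge0 ?eucl_energy_ge0// lee_fin.
have H1 : (vol Q)%:E * I <= dint Q (osc q u).
  exact: avg_osc_le.
have H2 := le_trans H1 (HK _ _ l0 cQ).
have -> : (vol Q)^-1%:E * I = (vol Q ^- 2)%:E * ((vol Q)%:E * I).
  by rewrite muleA -EFinM; congr (_%:E * _); field; rewrite gt_eqF.
apply: (le_trans (lee_wpmul2l _ H2)); first by rewrite lee_fin invr_ge0 exprn_ge0 ?ltW.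
rewrite !muleA -!EFinM; apply: lee_wpmul2r; first exact: eucl_energy_ge0.
rewrite lee_fin (cube_vol_powR (ltW l0) cQ) volQ.
rewrite mulrCA ler_wpM2l ?(ltW K0)//.
rewrite -exprM -powR_mulrn ?(ltW l0)// -powRN -powRD ?(gt_eqF l0) ?implybT//.
rewrite le_eqVlt; apply/orP; left; apply/eqP; congr (_ `^ _)%R.
by rewrite natrM; ring.
Qed.

Lemma delta_le_eucl_term : exists2 K : R, (0 <= K)%R &
  forall (k : int) (v : 'rV[int]_n),
  delta_term (cell k v) <= K%:E * eucl_term (cell k v).
Proof.
have [K K0 HK] := delta_le_eucl q1 mu_u s n0.
exists (K `^ t)%R => [|k v]; first exact: powR_ge0.
rewrite /delta_term /eucl_term muleCA; apply: lee_wpmul2l; first by rewrite lee_fin vol_ge0.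
have w0 : (0 <= vol (cell k v : set T) `^ (q * alpha / n%:R - 1))%R by exact: powR_ge0.
apply: poweR_le_mul; rewrite ?(ltW t_gt0) ?(ltW K0)//.
- by rewrite mule_ge0 ?delta_energy_ge0// lee_fin.
- by rewrite mule_ge0 ?eucl_energy_ge0// lee_fin.
by rewrite muleCA; apply: lee_wpmul2l; [rewrite lee_fin|exact: HK].
Qed.

End Terms.

Section BlockTerm.
Local Open Scope ereal_scope.
Context (R : realType) (n : nat) (n0 : (0 < n)%N) (p q alpha : R).
Hypotheses (q1 : (1 <= q)%R) (qp : (q <= p)%R) (qa : (q * alpha < 1)%R).
Local Notation T := (lebesgueRn R n).
Local Notation mu := (@leb R n).
Local Notation s := (n%:R + q * alpha)%R.
Local Notation t := (p / q)%R.
Local Notation block m v := (@block R n m v).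
Local Notation block_cell m v e := (@block_cell R n m v e).

Lemma dint_subset (Q Q' : set T) (F : T -> T -> R) : Q `<=` Q' ->
  (forall x y, 0 <= F x y)%R -> dint Q F <= dint Q' F.
Proof.
move=> QQ F0; have sub (G : T -> \bar R) : (forall x, 0 <= G x) ->
    \int[mu]_(x in Q) G x <= \int[mu]_(x in Q') G x.
  move=> G0; rewrite integral_mkcond [leRHS]integral_mkcond.
  apply: le_integral_nonneg => x _; first exact: erestrict_ge0.
  rewrite !patchE; case: ifPn => [|_]; last by case: ifP.
  by rewrite inE => /QQ Qx; rewrite ifT// inE.
apply: (@le_trans _ _ (\int[mu]_(x in Q) \int[mu]_(y in Q') (F x y)%:E)).
  apply: le_integral_nonneg => x _; first exact: inner_ge0.
  by apply: sub => y; rewrite lee_fin.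
by apply: sub => x; exact: inner_ge0.
Qed.

(** For [s <= 0] the kernel is a nonnegative power of the distance, bounded on
    the block, so the oscillation term alone dominates. *)
Lemma block_energy_bound : exists2 C : R, (0 <= C)%R &
  forall (m : int) (v : 'rV[int]_n) (u : T -> R),
    measurable_fun setT u -> dint (block m v) (osc q u) < +oo ->
    eucl_energy q u s (block m v) <= C%:E *
     (((scale R m 0 `^ s)^-1)%:E * dint (block m v) (osc q u) +
      \sum_e delta_energy q u s (block_cell m v e)).
Proof.
have [s0|s0] := ltP 0%R s; first by apply: block_energy_bound_pos => //; rewrite ltrD2l.
exists ((Num.sqrt n%:R * 3) `^ (- s))%R => [|m v u mu_u fin]; first exact: powR_ge0.
have r0 := scale_gt0 R m 0.
have o0 := osc_ge0 q u.
apply: (@le_trans _ _ (((Num.sqrt n%:R * 3) `^ (- s))%:E *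
    (((scale R m 0 `^ s)^-1)%:E * dint (block m v) (osc q u)))); last first.
  apply: lee_wpmul2l; first by rewrite lee_fin powR_ge0.
  apply: leeDl; apply: sume_ge0 => e _; exact: delta_energy_ge0.
have sn0 : (0 <= Num.sqrt n%:R * 3 :> R)%R by rewrite mulr_ge0// sqrtr_ge0.
rewrite -powRN muleA -EFinM -(powRM _ sn0 (ltW r0)).
rewrite -(dintZ (measurable_block _ _) (jmeasurable_osc q mu_u) o0 (powR_ge0 _ _)).
apply: le_dint => x y Bx By; first exact: osc_eucl_ge0.
have [->|xy] := eqVneq x y; first by rewrite osc_diag// mul0r mulr0.
rewrite mulrC -powRN; apply: ler_wpM2r; first exact: osc_ge0.
have H3 : (0 <= 3 * scale R m 0)%R by rewrite mulr_ge0// ltW.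
apply: ge0_ler_powR; rewrite ?nnegrE ?eucl_ge0 ?mulr_ge0 ?oppr_ge0 ?(ltW r0) ?sqrtr_ge0//.
rewrite -mulrA; apply: eucl_le => // i; rewrite !mxE.
exact: (cube_dist i (block_cube R m v) Bx By).
Qed.

Lemma powR_ratio_le (l r b : R) : (0 < r)%R -> (r <= l)%R -> (l <= 2 * r)%R ->
  (l `^ b <= 2 `^ `|b| * r `^ b)%R.
Proof.
move=> r0 rl l2; have l0 : (0 < l)%R by exact: lt_le_trans rl.
have x0 : (0 <= l / r)%R by rewrite divr_ge0 ?ltW.
have -> : (l = l / r * r)%R by rewrite divfK// gt_eqF.
rewrite (powRM _ x0 (ltW r0)); apply: ler_wpM2r; first exact: powR_ge0.
have x1 : (1 <= l / r)%R by rewrite ler_pdivlMr// mul1r.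
apply: (@le_trans _ _ ((l / r) `^ `|b|)%R); first by rewrite ler_powR// ler_norm.
by apply: ge0_ler_powR; rewrite ?nnegrE// ler_pdivrMr.
Qed.

Variables (u : T -> R) (mu_u : measurable_fun setT u).
Local Notation eucl_term := (eucl_term p q alpha u).
Local Notation delta_term := (delta_term p q alpha u).
Local Notation mean_term := (mean_term p q u).

(** The block estimate in terms of the summands of the three norms: the energy
    of [Q] is at most that of the block, and the oscillation over the block is a
    mean oscillation over a cube of edge [3 * scale R m 0]. *)
Lemma eucl_term_le_block : exists2 K : R, (0 <= K)%R &
  forall (m : int) (v : 'rV[int]_n) (l : R) (Q : set T),
    cube l Q -> (scale R m 0 <= l)%R -> (l <= 2 * scale R m 0)%R ->
    Q `<=` block m v -> dint (block m v) (osc q u) < +oo ->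
    eucl_term Q <= K%:E *
      (mean_term (block m v) + \sum_e delta_term (block_cell m v e)).
Proof.
have [C C0 HC] := block_energy_bound.
pose beta := (q * alpha - n%:R)%R.
pose K1 := (2 `^ `|beta| * C * (2 `^ q * 2 * (3 ^+ n * 3 ^+ n) + 1))%R.
have K10 : (0 <= K1)%R.
  by rewrite /K1 !mulr_ge0 ?powR_ge0// addr_ge0// !mulr_ge0 ?powR_ge0 ?exprn_ge0.
have t0 : (0 < t)%R by exact: t_gt0.
pose N := size (index_enum {ffun 'I_n -> 'I_3}).
pose G := (K1 `^ t * (2 `^ t * (2 `^ t) ^+ N))%R.
have G0 : (0 <= G)%R by rewrite /G !mulr_ge0 ?powR_ge0 ?exprn_ge0// powR_ge0.
have K0 : (0 <= 2 ^+ n * G)%R by rewrite mulr_ge0// exprn_ge0.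
exists (2 ^+ n * G)%R => // m v l Q cQ rl lr QB fin.
set r := scale R m 0 in rl lr *; have r0 : (0 < r)%R by exact: scale_gt0.
have l0 : (0 < l)%R by exact: lt_le_trans rl.
set B := block m v in QB fin *.
have cB : cube (3 * r) B by exact: block_cube.
have mB : measurable B by exact: measurable_block.
have fB : mu B < +oo by exact: block_fin.
have volB : vol B = ((3 * r) ^+ n)%R by exact: vol_block.
have vB0 : (0 < vol B)%R by rewrite volB exprn_gt0// mulr_gt0.
set X := (vol B)^-1%:E * \int[mu]_(x in B) (`|u x - avg u B| `^ q)%:E.
have X0 : 0 <= X.
  rewrite mule_ge0 ?lee_fin ?invr_ge0 ?(ltW vB0)//.
  by apply: integral_ge0 => x _; rewrite lee_fin powR_ge0.
have cD e : cube r (block_cell m v e).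
  have rE : (r = 2 ^ (- m) :> R)%R by rewrite /r /scale addr0.
  by rewrite rE; exact: cell_cube.
pose Y e := (vol (block_cell m v e) `^ (q * alpha / n%:R - 1))%:E *
  delta_energy q u s (block_cell m v e).
have Y0 e : 0 <= Y e by rewrite mule_ge0 ?delta_energy_ge0// lee_fin powR_ge0.
have YE e : Y e = (r `^ beta)%:E * delta_energy q u s (block_cell m v e).
  by rewrite /Y (cube_vol_powR n0 q alpha (ltW r0) (cD e)).
have inner : (vol Q `^ (q * alpha / n%:R - 1))%:E * eucl_energy q u s Q <=
    K1%:E * (X + \sum_e Y e).
  rewrite (cube_vol_powR n0 q alpha (ltW l0) cQ) -/beta.
  have H1 : eucl_energy q u s Q <= eucl_energy q u s B.
    by apply: dint_subset => // x y; exact: osc_eucl_ge0.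
  have H2 : dint B (osc q u) <= (2 `^ q * 2 * (vol B * vol B))%:E * X.
    apply: (le_trans (osc_avg_le q1 mu_u (avg u B) mB fB vB0)).
    rewrite /X muleA -EFinM le_eqVlt; apply/orP; left; apply/eqP.
    by congr (_%:E * _); field; rewrite gt_eqF.
  have bs0 : (0 <= l `^ beta)%R by exact: powR_ge0.
  have rs0 : (0 <= (r `^ s)^-1)%R by rewrite invr_ge0 powR_ge0.
  have rb0 : (0 <= r `^ beta)%R by exact: powR_ge0.
  have SY0 : 0 <= \sum_e Y e by exact: sume_ge0.
  apply: (le_trans (lee_wpmul2l _ (le_trans H1 (HC m v u mu_u fin)))).
    by rewrite lee_fin.
  apply: (@le_trans _ _ ((2 `^ `|beta| * r `^ beta)%:E * (C%:E *
     (((r `^ s)^-1)%:E * ((2 `^ q * 2 * (vol B * vol B))%:E * X) +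
      \sum_e delta_energy q u s (block_cell m v e))))).
    apply: lee_pmul.
    - by rewrite lee_fin.
    - rewrite mule_ge0 ?lee_fin// adde_ge0//.
        by apply: mule_ge0; [rewrite lee_fin|apply: dint_ge0 => x y; exact: osc_ge0].
      by apply: sume_ge0 => e _; exact: delta_energy_ge0.
    - by rewrite lee_fin; exact: powR_ratio_le.
    - apply: lee_wpmul2l; first by rewrite lee_fin.
      apply: leeD; last exact: lexx.
      by apply: lee_wpmul2l; [rewrite lee_fin|exact: H2].
  have SD0 : 0 <= \sum_e delta_energy q u s (block_cell m v e).
    by apply: sume_ge0 => e _; exact: delta_energy_ge0.
  have -> : \sum_e Y e = (r `^ beta)%:E * \sum_e delta_energy q u s (block_cell m v e).
    rewrite ge0_sume_distrr; first by apply: eq_bigr => e _; exact: YE.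
    by move=> e _; exact: delta_energy_ge0.
  clear H1 H2; clearbody X; move: (\sum_e _) SD0 => SD SD0.
  (* This is where the powers of the edge length cancel: -s + 2n + beta = 0. *)
  have E9 : ((r `^ s)^-1 * (vol B * vol B) * r `^ beta = 3 ^+ n * 3 ^+ n)%R.
    have rN (a b : R) : (r `^ a * r `^ b = r `^ (a + b))%R.
      by rewrite powRD// (gt_eqF r0) implybT.
    have E1 : (r `^ (- s) * (r ^+ n * r ^+ n) * r `^ beta = 1)%R.
      rewrite -exprD -powR_mulrn ?(ltW r0)// !rN -[RHS](powRr0 r).
      by congr (_ `^ _)%R; rewrite /beta natrD; ring.
    rewrite volB exprMn -powRN.
    move: (3 ^+ n : R)%R (r ^+ n)%R (r `^ (- s))%R (r `^ beta)%R E1 => a b c d E1.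
    by transitivity (a * a * (c * (b * b) * d))%R; [ring|rewrite E1 mulr1].
  rewrite ge0_muleDr//; last first.
    by rewrite mule_ge0// ?lee_fin// mule_ge0// lee_fin !mulr_ge0 ?powR_ge0 ?(ltW vB0).
  rewrite ge0_muleDr//; last 2 first.
  - rewrite mule_ge0 ?lee_fin// mule_ge0 ?lee_fin// mule_ge0// lee_fin.
    by rewrite !mulr_ge0 ?powR_ge0 ?(ltW vB0).
  - by rewrite mule_ge0 ?lee_fin.
  rewrite ge0_muleDr//; last by rewrite mule_ge0 ?lee_fin.
  apply: leeD.
    rewrite !muleA -!EFinM; apply: lee_wpmul2r => //; rewrite lee_fin.
    have -> : (2 `^ `|beta| * r `^ beta * C * (r `^ s)^-1 * (2 `^ q * 2 * (vol B * vol B)) =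
      2 `^ `|beta| * C * (2 `^ q * 2 * ((r `^ s)^-1 * (vol B * vol B) * r `^ beta)))%R by ring.
    rewrite E9 /K1; apply: ler_wpM2l; first by rewrite mulr_ge0 ?powR_ge0.
    by rewrite lerDl.
  rewrite !muleA -!EFinM; apply: lee_wpmul2r => //; rewrite lee_fin.
  have -> : (2 `^ `|beta| * r `^ beta * C = 2 `^ `|beta| * C * 1 * r `^ beta)%R by ring.
  apply: ler_wpM2r; first exact: powR_ge0.
  rewrite /K1; apply: ler_wpM2l; first by rewrite mulr_ge0 ?powR_ge0.
  by rewrite lerDr !mulr_ge0 ?powR_ge0 ?exprn_ge0.
have SY0 : 0 <= \sum_e Y e by exact: sume_ge0.
have SYt0 : 0 <= \sum_e Y e `^ t by apply: sume_ge0 => e _; exact: poweR_ge0.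
have Qin0 : 0 <= (vol Q `^ (q * alpha / n%:R - 1))%:E * eucl_energy q u s Q.
  by rewrite mule_ge0 ?eucl_energy_ge0// lee_fin powR_ge0.
have p1 : (1 <= (2 `^ t) ^+ N :> R)%R.
  by apply: exprn_ege1; apply/ltW/powR2_gt1.
have outer : ((vol Q `^ (q * alpha / n%:R - 1))%:E * eucl_energy q u s Q) `^ t <=
    G%:E * (X `^ t + \sum_e Y e `^ t).
  apply: (le_trans (poweR_le_mul (ltW t0) K10 Qin0 (adde_ge0 X0 SY0) inner)).
  rewrite EFinM -muleA; apply: lee_wpmul2l; first by rewrite lee_fin powR_ge0.
  apply: (le_trans (poweRD_le (ltW t0) X0 SY0)).
  rewrite EFinM -muleA; apply: lee_wpmul2l; first by rewrite lee_fin powR_ge0.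
  rewrite ge0_muleDr ?poweR_ge0//; apply: leeD.
    by rewrite -[leLHS]mul1e; apply: lee_wpmul2r; rewrite ?poweR_ge0// lee_fin.
  exact: poweR_sum_le.
clear p1; clearbody G.
have volQ : vol Q = (l ^+ n)%R by exact: cube_vol (ltW l0) cQ.
have -> : eucl_term Q = (l ^+ n)%:E *
    ((vol Q `^ (q * alpha / n%:R - 1))%:E * eucl_energy q u s Q) `^ t.
  by rewrite -volQ.
move: (_ * eucl_energy q u s Q) outer {inner Qin0} => Z outer.
have := poweR_ge0 Z t; move: (Z `^ t) outer => W outer W0.
have mtE : mean_term B = (vol B)%:E * X `^ t by [].
have dtE : \sum_e delta_term (block_cell m v e) = (r ^+ n)%:E * \sum_e Y e `^ t.
  rewrite ge0_sume_distrr; last by move=> e _; exact: poweR_ge0.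
  by apply: eq_bigr => e _; rewrite -(cube_vol (ltW r0) (cD e)).
rewrite mtE dtE {mtE dtE}.
move: (X `^ t) (poweR_ge0 X t) (\sum_e _) SYt0 outer => Xt Xt0 SYt SYt0 outer.
set S := Xt + SYt in outer.
have S0 : 0 <= S by exact: adde_ge0.
apply: (@le_trans _ _ ((2 ^+ n * r ^+ n)%:E * (G%:E * S))).
  apply: lee_pmul => //; first by rewrite lee_fin exprn_ge0// ltW.
  by rewrite lee_fin -exprMn lerXn2r// nnegrE ?mulr_ge0 ?(ltW l0) ?(ltW r0).
have -> : (2 ^+ n * r ^+ n)%:E * (G%:E * S) = (2 ^+ n * G)%:E * ((r ^+ n)%:E * S).
  by rewrite muleA [RHS]muleA -EFinM -EFinM mulrAC.
apply: lee_wpmul2l; first by rewrite lee_fin.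
have rn0 : (0 <= r ^+ n)%R by rewrite exprn_ge0// ltW.
rewrite /S ge0_muleDr//; apply: leeD; last exact: lexx.
apply: lee_wpmul2r => //.
by rewrite lee_fin volB exprMn ler_peMl// exprn_ege1// ler1n.
Qed.

End BlockTerm.

Lemma dyadic_scale_exists (R : realType) (l : R) : 0 < l ->
  exists m : int, scale R m 0 <= l <= 2 * scale R m 0.
Proof.
move=> l0; have ln2 : (0 : R) < ln 2 by rewrite ln_gt0 ?ltr1n.
have pE (k : int) : (2 : R) ^ k = 2 `^ k%:~R by rewrite powR_intmul.
have xE : l = 2 `^ (ln l / ln 2).
  by rewrite /powR pnatr_eq0 /= divfK ?gt_eqF// lnK.
set x := ln l / ln 2 in xE.
exists (- Num.floor x); rewrite /scale addr0 opprK.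
rewrite -[X in X * _]expr1z -pow2D !pE xE.
rewrite !ler_powR ?ler1n// ?floor_le_tmp//=.
by rewrite addrC ltW// floorD1_gt.
Qed.

(** * Cubes of equal edge length against a dyadic mesh *)

Section Packing.
Context (R : realType) (n : nat).
Local Notation T := (lebesgueRn R n).
Implicit Types (l : R) (a x : 'rV[R]_n) (v w : 'rV[int]_n) (k m : int).

Definition open_box a l : set 'rV[R]_n := [set x | forall i, a 0 i < x 0 i < a 0 i + l].

Definition closed_box a l : set 'rV[R]_n := [set x | forall i, a 0 i <= x 0 i <= a 0 i + l].

Lemma cube_corner l (Q : set 'rV[R]_n) : cube l Q ->
  exists a, open_box a l `<=` Q /\ Q `<=` closed_box a l.
Proof.
move=> [a [bl [br ->]]]; exists a; split => x /= H i; have := H i.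
  by rewrite itv_boundlr /= => /andP[ax xb]; apply/andP; split;
    [case: (bl i)|case: (br i)]; rewrite /= ?bnd_simp ?ltW.
by rewrite itv_boundlr /= => /andP[/lteifW -> /lteifW ->].
Qed.

Lemma open_box_sub_interior a l (Q : set 'rV[R]_n) :
  open_box a l `<=` Q -> open_box a l `<=` interior Q.
Proof.
move=> aQ x ax.
exists (fun _ i => [set y : R | a 0 i < y < a 0 i + l]).
  move=> i j; rewrite (ord1 i); have := ax j => /andP[a1 a2].
  by near do (apply/andP; split); [exact: lt_nbhsr|exact: lt_nbhsl].
by move=> y /= H; apply: aQ => i; exact: H.
Unshelve. all: by end_near. Qed.

(** Otherwise the corners are less than [l] apart in each coordinate and the
    interiors of the two cubes meet, at the midpoint of the centres. *)
Lemma packing_corner_inj l (C : set (set 'rV[R]_n)) (corner : set 'rV[R]_n -> 'rV[R]_n) m :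
  Pi l C -> scale R m 0 <= l ->
  (forall Q, C Q -> open_box (corner Q) l `<=` Q) ->
  set_inj C (fun Q => cell_index m (corner Q)).
Proof.
move=> [_ tC] rl co Q Q'; rewrite !inE => CQ CQ' eqv; apply: tC => //.
have dist i : `|corner Q 0 i - corner Q' 0 i| < l.
  apply: (lt_le_trans (cell_index_dist i eqv)).
  by rewrite /scale addr0 in rl.
(* The midpoint of the centres of the two cubes. *)
exists (\row_i ((corner Q 0 i + corner Q' 0 i + l) / 2)).
split; [apply: (open_box_sub_interior (co _ CQ))|apply: (open_box_sub_interior (co _ CQ'))];
  by move=> i; rewrite !mxE; have := dist i; rewrite ltr_norml => /andP[? ?];
  apply/andP; split; lra.
Qed.

Lemma closed_box_sub_block a l m : l <= 2 * scale R m 0 ->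
  closed_box a l `<=` block m (cell_index m a).
Proof.
move=> l2 x ax i; have /andP[a1 a2] := ax i; rewrite !mxE.
have p0 := pow2_gt0 R m.
rewrite le_floor ?ler_pM2l//=.
rewrite ltNge floor_ge_int -ltNge intrD.
have H1 : 2 ^ m * a 0 i < (Num.floor (2 ^ m * a 0 i))%:~R + 1.
  by rewrite -[1]/(1%:~R) -intrD floorD1_gt.
have H2 : 2 ^ m * l <= 2.
  have E : 2 ^ m * (2 * scale R m 0) = 2 by rewrite scaleE; field; rewrite gt_eqF.
  by rewrite -[leRHS]E ler_pM2l.
have H3 : 2 ^ m * x 0 i <= 2 ^ m * a 0 i + 2 ^ m * l by rewrite -mulrDr ler_pM2l.
have -> : 3%:~R = 3 :> R by [].
move: (Num.floor _)%:~R H1 H2 H3 => z; lra.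
Qed.

Lemma cell_neq0 m v : cell (R := R) m v !=set0.
Proof.
exists (\row_i (2 ^ (- m) * (v 0 i)%:~R)); apply/cell_indexP => i; rewrite !mxE.
rewrite mulrA -pow2D subrr expr0z mul1r lexx /=.
by rewrite ltr_int ltrDl.
Qed.

Lemma cell_inj m v w : cell (R := R) m v = cell m w -> v = w.
Proof. by move=> E; have [x xv] := cell_neq0 m v; rewrite -xv; move: xv; rewrite E. Qed.

Lemma block_neq0 m v : block (R := R) m v !=set0.
Proof.
have [x xv] := cell_neq0 m v; exists x => i.
by rewrite xv lexx ltrDl.
Qed.

Definition residue v : {ffun 'I_n -> 'I_3} := [ffun i => inord (absz (modz (v 0 i) 3))].

(** Blocks have three cells in each direction, so those with indices in one
    residue class modulo 3 tile the space. The overlapping blocks thus fall into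
    3 ^ n packings. *)
Lemma block_disjoint m v w : residue v = residue w ->
  (block (R := R) m v `&` block m w) !=set0 -> v = w.
Proof.
move=> E [x [xv xw]]; apply/rowP => i; have : val (residue v i) = val (residue w i) by rewrite E.
rewrite !ffunE /= !inordK; try lia.
have := xv i; have := xw i; lia.
Qed.

Lemma dyadic_packing (k : int) : Pi ((2 : R) ^ (- k)) (@dyadic R n k).
Proof.
rewrite dyadicE; split; first by move=> _ [v _ <-]; exact: cell_cube.
move=> _ _ [v _ <-] [w _ <-] [x [/interior_subset xv /interior_subset xw]].
by congr cell; rewrite -xv -xw.
Qed.

End Packing.

(** * Summation over a packing *)

Section PackingSums.
Local Open Scope ereal_scope.
Context (R : realType) (n : nat) (n0 : (0 < n)%N) (p q alpha : R).
Hypotheses (q1 : (1 <= q)%R) (qp : (q <= p)%R) (qa : (q * alpha < 1)%R).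
Local Notation T := (lebesgueRn R n).
Local Notation mu := (@leb R n).
Local Notation t := (p / q)%R.
Implicit Types (l : R) (C : set (set 'rV[R]_n)) (m : int).

Lemma esum_le_classes (I : choiceType) (J : finType) (c : I -> J) (A : set I)
    (a : I -> \bar R) : (forall i, 0 <= a i) ->
  \esum_(i in A) a i <= \sum_j \esum_(i in A `&` [set i | c i = j]) a i.
Proof.
move=> a0; rewrite (eq_esum (b := fun i => \sum_j (if i \in [set i | c i = j] then a i else 0))).
  rewrite esum_sum; last by move=> i j _ _; case: ifP.
  by apply: lee_sum => j _; rewrite esum_mkcondr.
move=> i _; rewrite (bigD1 (c i))//= mem_set// big1 ?adde0// => j jc.
by rewrite ifF//; apply/negbTE; rewrite notin_setE /= => /esym/eqP; exact/negP.
Qed.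

Lemma block_packing m (V : set 'rV[int]_n) :
  {in V &, forall v w, residue v = residue w} ->
  Pi (3 * scale R m 0)%R [set block (R := R) m v | v in V].
Proof.
move=> resV; split; first by move=> _ [v _ <-]; exact: block_cube.
move=> _ _ [v Vv <-] [w Vw <-] [x [/interior_subset xv /interior_subset xw]].
by congr block; apply: (@block_disjoint R n m); [apply: resV; rewrite inE|exists x].
Qed.

Variables (u : T -> R) (mu_u : measurable_fun setT u).
Local Notation eucl_term := (eucl_term p q alpha u).
Local Notation delta_term := (delta_term p q alpha u).
Local Notation mean_term := (mean_term p q u).

Variables (Mc Md : R).
Hypothesis mean_sum : forall l C, (0 < l)%R -> Pi l C ->
  \esum_(Q in C) mean_term Q <= Mc%:E.
Hypothesis delta_sum : forall k : int, \esum_(Q in @dyadic R n k) delta_term Q <= Md%:E.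

Lemma block_osc_fin m v : dint (block (R := R) m v) (osc q u) < +oo.
Proof.
have r0 : (0 < 3 * scale R m 0)%R by rewrite mulr_gt0// scale_gt0.
have := mean_sum r0 (@block_packing m [set v] _); rewrite image_set1.
rewrite esum_set1 ?mean_term_ge0// => /(_ _)/wrap[].
  by move=> w w'; rewrite !inE /= => -> ->.
set B := block m v.
have v0 : (0 < vol B)%R by rewrite vol_block exprn_gt0.
move=> /le_lt_trans/(_ (ltry _)) /(lty_of_pmule v0) H.
have /(lty_of_pmule _) H1 : (vol B)^-1%:E * \int[mu]_(x in B) (`|u x - avg u B| `^ q)%:E < +oo.
  by apply: lty_poweRy H; rewrite gt_eqF// (t_gt0 q1 qp).
have mB : measurable (B : set T) by exact: measurable_block.
have fB : mu B < +oo by exact: block_fin.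
apply: (le_lt_trans (osc_avg_le q1 mu_u (avg u B) mB fB v0)).
rewrite lte_mul_pinfty ?lee_fin ?mulr_ge0 ?powR_ge0 ?(ltW v0)//.
by apply: H1; rewrite invr_gt0.
Qed.

(** Each of the residue classes of indices yields a packing, to which the
    hypothesis on the sums over packings applies. *)
Lemma mean_block_sum m (A : set (set 'rV[R]_n)) (V : set 'rV[R]_n -> 'rV[int]_n) :
  set_inj A V ->
  \esum_(Q in A) mean_term (block m (V Q)) <= (\sum_(c : {ffun 'I_n -> 'I_3}) Mc)%:E.
Proof.
move=> injV; have r0 : (0 < 3 * scale R m 0)%R by rewrite mulr_gt0// scale_gt0.
apply: (le_trans (esum_le_classes (fun Q => residue (V Q)) _ _)).
  by move=> Q; exact: mean_term_ge0.
rewrite -sumEFin; apply: lee_sum => c _.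
set A' := A `&` _.
apply: le_trans (mean_sum r0 (@block_packing m (V @` A') _)); last first.
  by move=> _ _ /set_mem[Q [_ cQ] <-] /set_mem[Q' [_ cQ'] <-]; rewrite cQ cQ'.
apply: (@esum_inj_le _ _ _ _ _ (fun Q => block m (V Q))); last first.
  by move=> Q AQ; exists (V Q) => //; exists Q.
move=> Q Q' /set_mem[AQ cQ] /set_mem[AQ' cQ'] E; apply: injV; rewrite ?inE//.
have [x xB] := block_neq0 R m (V Q); apply: (@block_disjoint R n m).
  by rewrite cQ -cQ'.
by exists x; split=> //; rewrite -E.
Qed.

(** For a fixed position [e] in the block, different cubes use different dyadic
    cells. *)
Lemma delta_cell_sum m (A : set (set 'rV[R]_n)) (V : set 'rV[R]_n -> 'rV[int]_n) e :
  set_inj A V ->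
  \esum_(Q in A) delta_term (block_cell m (V Q) e) <= Md%:E.
Proof.
move=> injV; apply: le_trans (delta_sum m).
apply: (@esum_inj_le _ _ _ _ _ (fun Q => block_cell m (V Q) e)); last first.
  by move=> Q _; rewrite dyadicE; exists (\row_i (V Q 0%R i + (e i)%:Z)%R).
move=> Q Q' AQ AQ' /cell_inj E; apply: injV => //; apply/rowP => i.
by have /rowP/(_ i) := E; rewrite !mxE => /addIr.
Qed.

(** Each cube of the packing is charged to the block at its lower corner, on a
    mesh comparable to its edge; different cubes use different blocks. *)
Lemma eucl_sum_bound : (0 <= Mc)%R -> (0 <= Md)%R -> exists2 M : R, (0 <= M)%R &
  forall l C, (0 < l)%R -> Pi l C -> \esum_(Q in C) eucl_term Q <= M%:E.
Proof.
move=> Mc0 Md0; have [K K0 HK] := eucl_term_le_block n0 q1 qp qa mu_u.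
pose N := (\sum_(c : {ffun 'I_n -> 'I_3}) Mc + \sum_(e : {ffun 'I_n -> 'I_3}) Md)%R.
have N0 : (0 <= N)%R by rewrite addr_ge0// sumr_ge0.
exists (K * N)%R => [|l C l0 PC]; first exact: mulr_ge0.
(* The mesh of level m is comparable to the edge l. *)
have [m /andP[rl lr]] := dyadic_scale_exists l0.
have /choice[corner Hc] : forall Q : set 'rV[R]_n, exists a : 'rV[R]_n,
    C Q -> open_box a l `<=` Q /\ Q `<=` closed_box a l.
  move=> Q; have [CQ|CQ] := pselect (C Q); last by exists 0%R => /CQ.
  by have [a Ha] := cube_corner (PC.1 _ CQ); exists a.
pose V Q := cell_index m (corner Q).
have injV : set_inj C V.
  by apply: (packing_corner_inj PC rl) => Q /Hc[].
have m0 Q : 0 <= mean_term (block m (V Q)) by exact: mean_term_ge0.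
have d0 Q e : 0 <= delta_term (block_cell m (V Q) e) by exact: delta_term_ge0.
apply: (@esum_le_mul _ _ _ _ (fun Q => mean_term (block m (V Q)) +
    \sum_e delta_term (block_cell m (V Q) e)) K N) => //.
- by move=> Q; rewrite adde_ge0// sume_ge0.
- move=> Q CQ; apply: (HK m (V Q) l Q (PC.1 _ CQ) rl lr); last exact: block_osc_fin.
  by apply: (subset_trans (Hc _ CQ).2); exact: closed_box_sub_block.
rewrite esumD//; last by move=> Q _; rewrite sume_ge0.
rewrite EFinD; apply: leeD; first exact: mean_block_sum.
rewrite esum_sum// -sumEFin; apply: lee_sum => e _.
exact: delta_cell_sum.
Qed.

End PackingSums.

Lemma coord_le_norm (R : realType) (n : nat) (x : 'rV[R]_n) i : `|x 0 i| <= `|x|.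
Proof.
have /mapP[j _ ->] : `|x 0 i| \in [seq `|x ij.1 ij.2| | ij : 'I_1 * 'I_n].
  by apply/mapP; exists (0, i) => //=; rewrite mem_enum.
by rewrite [leRHS]/Num.norm /= mx_normrE; apply/bigmax_geP; right => /=; exists j.
Qed.

(** * Finiteness of the norms and local integrability *)

Section NormsFinite.
Local Open Scope ereal_scope.
Context (R : realType) (n : nat) (n0 : (0 < n)%N) (p q alpha : R).
Hypotheses (q1 : (1 <= q)%R) (qp : (q <= p)%R) (qa : (q * alpha < 1)%R).
Local Notation T := (lebesgueRn R n).
Local Notation mu := (@leb R n).
Variables (f : 'rV[R]_n -> \bar R) (af : ae_finite_measurable f).
Local Notation u := (real_rep f : T -> R).
Implicit Types (l : R) (C : set (set 'rV[R]_n)).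

Let p0 : (0 < p)%R. Proof. exact: lt_le_trans (lt_le_trans ltr01 q1) qp. Qed.

Lemma JNQ_norm_ltyP : JNQ_norm p q alpha f < +oo <->
  exists2 M : R, (0 <= M)%R & forall l C, (0 < l)%R -> Pi l C ->
    \esum_(Q in C) eucl_term p q alpha u Q <= M%:E.
Proof.
pose g C := \esum_(Q in C) eucl_term p q alpha u Q.
have g0 C : 0 <= g C by apply: esum_ge0 => Q _; exact: eucl_term_ge0.
have -> : JNQ_norm p q alpha f =
    ereal_sup [set g C `^ p^-1 | C in [set C | exists2 l, (0 < l)%R & Pi l C]].
  rewrite /JNQ_norm.
  apply: (congr1 (@ereal_sup R)).
  apply: eq_imagel => C _.
  apply: (congr1 (fun z => z `^ p^-1)).
  apply: eq_esum => Q _; rewrite /eucl_term.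
  rewrite (double_integral_real q af) // => x y.
  by rewrite invr_ge0 powR_ge0.
split.
  move=> /(sup_poweR_ltyP p0 (fun C _ => g0 C))[M M0 H]; exists M => // l C l0 PC.
  by apply: H; exists l.
move=> [M M0 H]; apply/(sup_poweR_ltyP p0 (fun C _ => g0 C)); exists M => // C [l l0 PC].
exact: H PC.
Qed.

Lemma JNQ_dyadic_norm_ltyP : JNQ_dyadic_norm p q alpha f < +oo <->
  exists2 M : R, (0 <= M)%R & forall k : int,
    \esum_(Q in @dyadic R n k) delta_term p q alpha u Q <= M%:E.
Proof.
pose g k := \esum_(Q in @dyadic R n k) delta_term p q alpha u Q.
have g0 k : 0 <= g k by apply: esum_ge0 => Q _; exact: delta_term_ge0.
have -> : JNQ_dyadic_norm p q alpha f = ereal_sup [set g k `^ p^-1 | k in [set: int]].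
  rewrite /JNQ_dyadic_norm.
  apply: (congr1 (@ereal_sup R)).
  apply: eq_imagel => k _.
  apply: (congr1 (fun z => z `^ p^-1)).
  apply: eq_esum => Q _; rewrite /delta_term.
  rewrite (double_integral_real q af) // => x y.
  by rewrite invr_ge0 powR_ge0.
split.
  by move=> /(sup_poweR_ltyP p0 (fun k _ => g0 k))[M M0 H]; exists M => // k; exact: H.
move=> [M M0 H]; apply/(sup_poweR_ltyP p0 (fun k _ => g0 k)); exists M => // k _.
exact: H.
Qed.

(** Integrability on cubes is what identifies the extended-real mean of [f] with
    the real average of its representative. *)
Lemma JNcon_norm_ltyP :
  (forall l Q, (0 < l)%R -> cube l Q -> mu.-integrable (Q : set T) (EFin \o u)) ->
  JNcon_norm p q f < +oo <->
  exists2 M : R, (0 <= M)%R & forall l C, (0 < l)%R -> Pi l C ->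
    \esum_(Q in C) mean_term p q u Q <= M%:E.
Proof.
move=> iu; pose g C := \esum_(Q in C) mean_term p q u Q.
have g0 C : 0 <= g C by apply: esum_ge0 => Q _; exact: mean_term_ge0.
have -> : JNcon_norm p q f =
    ereal_sup [set g C `^ p^-1 | C in [set C | exists2 l, (0 < l)%R & Pi l C]].
  rewrite /JNcon_norm.
  apply: (congr1 (@ereal_sup R)).
  apply: eq_imagel => C [l l0 [cC _]].
  apply: (congr1 (fun z => z `^ p^-1)).
  apply: eq_esum => Q CQ; rewrite /mean_term.
  have cQ := cC _ CQ.
  rewrite (integral_dev_real q af (cube_measure (ltW l0) cQ).1)//.
  exact: iu cQ.
split.
  move=> /(sup_poweR_ltyP p0 (fun C _ => g0 C))[M M0 H]; exists M => // l C l0 PC.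
  by apply: H; exists l.
move=> [M M0 H]; apply/(sup_poweR_ltyP p0 (fun C _ => g0 C)); exists M => // C [l l0 PC].
exact: H PC.
Qed.

Lemma closed_box_cube (a : 'rV[R]_n) l : cube l (closed_box a l).
Proof.
exists a, (fun=> true), (fun=> false); apply/seteqP; split => x /= H i;
  by have := H i; rewrite in_itv.
Qed.

Lemma closed_box_compact (a : 'rV[R]_n) l : compact (closed_box a l).
Proof.
have -> : closed_box a l =
    [set v | forall i, [set` `[a 0%R i, (a 0%R i + l)%R]] (v ord0 i)].
  by apply/seteqP; split => x /= H i; have := H i; rewrite in_itv.
by apply: (@rV_compact R n (fun i => [set` `[a 0%R i, (a 0%R i + l)%R]])) => i;
  exact: segment_compact.
Qed.

(** The closure of a cube is compact. *)
Lemma L1loc_integrable_cube : L1loc f -> forall l Q, (0 < l)%R -> cube l Q ->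
  mu.-integrable (Q : set T) (EFin \o u).
Proof.
move=> [_ H] l Q l0 cQ; have [a [_ Qa]] := cube_corner cQ.
have mQ := (cube_measure (ltW l0) cQ).1.
have mK := (cube_measure (ltW l0) (closed_box_cube a l)).1.
apply: (integrableS mK mQ Qa); apply: (integrable_real af).
by apply: H; exact: closed_box_compact.
Qed.

(** A compact set is bounded, hence contained in a cube. *)
Lemma integrable_cube_L1loc :
  (forall l Q, (0 < l)%R -> cube l Q -> mu.-integrable (Q : set T) (EFin \o u)) ->
  L1loc f.
Proof.
move=> iu; split=> // K /compact_bounded[M [_ HM]].
pose N := (Num.max M 0 + 1)%R; have MN : (M < N)%R.
  by rewrite ltr_pwDr// le_max lexx.
have N0 : (0 < N)%R by rewrite ltr_wpDl// le_max lexx orbT.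
have l0 : (0 < N + N)%R by exact: addr_gt0.
pose a : 'rV[R]_n := \row_i (- N)%R.
apply: (@integrable_of_real _ _ f af K (closed_box a (N + N)) _ (iu _ _ l0 (closed_box_cube a _))).
move=> x Kx i; rewrite !mxE addrA addNr add0r -ler_norml.
exact: le_trans (coord_le_norm x i) (HM N MN x Kx).
Qed.

End NormsFinite.

(** * Equality of the spaces *)

Theorem theorem3p8 (R : realType) (n : nat) (hn : (1 <= n)%N)
    (p q alpha : R) (hq : 1 <= q) (hqp : q <= p) (halpha : alpha < 1 / q) :
  JNQ n p q alpha = JNQ_dyadic n p q alpha `&` JNcon n p q.
Proof.
have q0 : 0 < q by exact: lt_le_trans hq.
have qa : q * alpha < 1 by rewrite mulrC -ltr_pdivlMr.
apply/seteqP; split=> f.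
- move=> [af /(JNQ_norm_ltyP alpha hq hqp af)[M M0 HM]].
  have mu_u := measurable_real_rep af.
  set u := real_rep f in mu_u HM.
  have iu l Q : 0 < l -> cube l Q -> (@leb R n).-integrable Q (EFin \o u).
    move=> l0 cQ; have [mQ muQ] := cube_measure (ltW l0) cQ.
    apply: (integrable_of_osc hq mu_u mQ).
    + by rewrite [ltLHS]muQ ltry.
    + by rewrite (cube_vol (ltW l0) cQ) exprn_gt0.
    + apply: (eucl_term_fin hn hq hqp mu_u (alpha := alpha) l0 cQ).
      have PQ : Pi l [set Q] by split=> [_ ->//|_ _ -> ->].
      apply: (@le_lt_trans _ _ M%:E); last exact: ltry.
      by have := HM l _ l0 PQ; rewrite esum_set1// eucl_term_ge0.
  have lf : L1loc f by exact: integrable_cube_L1loc.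
  have e0 Q : (0 <= eucl_term p q alpha u Q)%E by exact: eucl_term_ge0.
  split; split=> //.
  + have [K K0 HK] := delta_le_eucl_term hn alpha hq hqp mu_u.
    apply/(JNQ_dyadic_norm_ltyP alpha hq hqp af); exists (K * M); first exact: mulr_ge0.
    move=> k; apply: (esum_le_mul K0 e0).
      by move=> Q; rewrite dyadicE => -[v _ <-]; exact: HK.
    exact: HM (pow2_gt0 R (- k)) (dyadic_packing R n k).
  + have [K K0 HK] := mean_le_eucl_term hn alpha hq hqp mu_u.
    apply/(JNcon_norm_ltyP hq hqp af iu); exists (K * M); first exact: mulr_ge0.
    move=> l C l0 PC; apply: (esum_le_mul K0 e0); last exact: HM PC.
    move=> Q CQ; have cQ := PC.1 _ CQ.
    by apply: (HK l Q l0 cQ); exact: iu cQ.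
- move=> [[af /(JNQ_dyadic_norm_ltyP alpha hq hqp af)[Md Md0 HMd]] [lf conf]].
  have iu := L1loc_integrable_cube af lf.
  have /(JNcon_norm_ltyP hq hqp af iu)[Mc Mc0 HMc] := conf.
  split; first exact: af.
  apply/(JNQ_norm_ltyP alpha hq hqp af).
  exact: (eucl_sum_bound hn hq hqp qa (measurable_real_rep af) HMc HMd Mc0 Md0).
Qed.
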